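(* Let $A$ be a finite dimensional Hopf algebra over $\mathbb C$, and let $A_1,A_2\subset A$ be subalgebras such that (a) the product map $m_A:A_1\otimes A_2\to A$ is a vector space isomorphism, and (b) $A_1$ is a left coideal and $A_2$ a right coideal of $A$, i.e. $\Delta_A(A_1)\subset A\otimes A_1$ and $\Delta_A(A_2)\subset A_2\otimes A$. Let $P_i:A\to A_i$ be defined by $P_1(a_1a_2)=a_1\varepsilon_A(a_2)$, $P_2(a_1a_2)=\varepsilon_A(a_1)a_2$ ($a_i\in A_i$). Let $B:=A^{*cop}$, $B_1:=(A_1^\varepsilon A_2)^\perp\subset B$, $B_2:=(A_1A_2^\varepsilon)^\perp\subset B$. Let $D$ be the double of $A$, $R\in D^{\otimes 2}$ its $R$-matrix, and $R_i:=(P_i\otimes\mathrm{id})(R)$, $i=1,2$. Then: 1) $B_1,B_2$ are subalgebras of $B$; $B_1$ (resp. $B_2$) is a left (resp. right) coideal of $B$, i.e. $\Delta_B(B_1)\subset B\otimes B_1$, $\Delta_B(B_2)\subset B_2\otimes B$; and $m_B:B_2\otimes B_1\to B$ is a vector space isomorphism. 2) Define $P'_i:B\to B_i$ by $P'_2(b_2b_1)=b_2\varepsilon_B(b_1)$, $P'_1(b_2b_1)=\varepsilon_B(b_2)b_1$ ($b_i\in B_i$). Then $R_i=(\mathrm{id}_A\otimes P'_{3-i})(R)$ for $i=1,2$. In fact $R_i=(P_i\otimes P'_{3-i})(R)\in A_i\otimes B_{3-i}$. 3) $R_2$ is a cocycle for $D$, i.e. $$R_2^{1,2}(\Delta_D\otimes\mathrm{id}_D)(R_2)=R_2^{2,3}(\mathrm{id}_D\otimes\Delta_D)(R_2).$$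 It follows that $D$, equipped with the coproduct ${}^{R_2}\Delta_D(x):=R_2\Delta_D(x)R_2^{-1}$, is a quasitriangular Hopf algebra (denoted ${}^{R_2}D$) with $R$-matrix $R_2^{2,1}R_1$. 4) $m_D(A_i\otimes B_i)=m_D(B_i\otimes A_i)$ for $i=1,2$, so $D_i:=m_D(A_i\otimes B_i)\subset D$ are subalgebras of $D$. 5) ${}^{R_2}\Delta_D(A_1)\subset A_1\otimes D_1$, ${}^{R_2}\Delta_D(B_1)\subset D_1\otimes B_1$, ${}^{R_2}\Delta_D(A_2)\subset A_2\otimes D_2$, ${}^{R_2}\Delta_D(B_2)\subset D_2\otimes B_2$. 6) $D_1,D_2$ are Hopf subalgebras of ${}^{R_2}D$. The quasitriangular Hopf algebra ${}^{R_2}D$ is isomorphic to the double of $(D_1,({}^{R_2}\Delta_D)_{|D_1})$, whose dual algebra with opposite coproduct is $(D_2,({}^{R_2}\Delta_D)_{|D_2})$.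
   Context: For a Hopf algebra $X$, $m_X,\Delta_X,S_X,\varepsilon_X,1_X$ denote its operations; $X^{cop}$ is $X$ with the opposite coproduct; for a subspace $Y\subset X$, $Y^\varepsilon:=Y\cap\mathrm{Ker}(\varepsilon_X)$; for subspaces $Y,Z\subset X$, $YZ:=m_X(Y\otimes Z)$. $\perp$ denotes the orthogonal with respect to the pairing $\langle-,-\rangle:A\otimes B\to\mathbb C$ coming from $B=A^{*}$ as a vector space (algebra structure of $B$ dual to $\Delta_A$, coproduct of $B$ opposite to the one dual to $m_A$). The double $D$ of $A$ is the Hopf algebra containing $A$ and $B$ as Hopf subalgebras, such that the product map $A\otimes B\to D$ is a vector space isomorphism, with multiplication rule (Sweedler notation) $ba=\langle S_A(a^{(1)}),b^{(1)}\rangle\langle a^{(3)},b^{(3)}\rangle a^{(2)}b^{(2)}$ for $a\in A$, $b\in B$. Its $R$-matrix $R\in A\otimes B\subset D^{\otimes2}$ is the canonical element of the pairing. Superscripts indicate positions of tensor factors; $x^{2,1}$ is the flip of $x\in D^{\otimes 2}$.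
   Formalization: In the multiplication rule of the double D, S_A(a^{(1)}) is replaced by S_A^{-1}(a^{(1)}): applying the counit of D to the printed rule forces S_A^2=id, so it defines no Hopf algebra otherwise; when S_A^2=id the two rules agree. *)

(* Defs.v *)
From HB Require Import structures.
From mathcomp Require Import all_boot all_order all_algebra all_field.
From mathcomp Require Export complex.
From mathcomp Require Export reals.

Set Implicit Arguments.
Unset Strict Implicit.
Unset Printing Implicit Defensive.

Import GRing.Theory.
Local Open Scope ring_scope.

Reserved Notation "u \ox v" (at level 40, left associativity).

(* The tensor product is realised by the coordinates of a tensor in the       *)
(* library bases [vbasis {:U}] and [vbasis {:V}]; [tliftE] and [tens_ext]     *)
(* below are its universal property.                                          *)
Definition tens (F : fieldType) (U V : vectType F) : Type :=
  'M[F]_(\dim {:U}, \dim {:V}).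

HB.instance Definition _ (F : fieldType) (U V : vectType F) :=
  Vector.on (tens U V).

Section Tensor.
Variable F : fieldType.
Implicit Types U V W : vectType F.

Definition bas U (i : 'I_(\dim {:U})) : U := (vbasis {:U})`_i.
Definition crd U (i : 'I_(\dim {:U})) (u : U) : F := coord (vbasis {:U}) i u.

Definition pure U V (u : U) (v : V) : tens U V :=
  \matrix_(i, j) (crd i u * crd j v).
Local Notation "u \ox v" := (pure u v).

(* The linear extension of f; only meaningful for bilinear f. *)
Definition tlift U V W (f : U -> V -> W) (t : tens U V) : W :=
  \sum_i \sum_j (t : 'M[F]_(_, _)) i j *: f (bas i) (bas j).

Lemma tlift_is_linear U V W (f : U -> V -> W) : linear (tlift f).
Proof.
move=> c s t; rewrite /tlift scaler_sumr -big_split; apply: eq_bigr => i _ /=.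
rewrite scaler_sumr -big_split; apply: eq_bigr => j _ /=.
by rewrite !mxE scalerDl scalerA.
Qed.
HB.instance Definition _ U V W (f : U -> V -> W) :=
  GRing.isLinear.Build F (tens U V) W *:%R (tlift f) (tlift_is_linear f).

Definition bilin U V W (f : U -> V -> W) : Prop :=
  (forall v, linear (f^~ v)) /\ (forall u, linear (f u)).

Lemma crd_bas U (u : U) : u = \sum_i crd i u *: bas i.
Proof. exact: coord_vbasis (memvf u). Qed.

Lemma crd_delta U i j : crd i (bas j : U) = (i == j)%:R.
Proof. by rewrite /crd /bas coord_free ?(basis_free (vbasisP _)) // eq_sym. Qed.

Lemma crd_linear U i : linear (@crd U i : U -> F^o).
Proof. by move=> c u v; rewrite /crd linearP. Qed.

Lemma linear_sumZ U W (f : U -> W) (lf : linear f) (I : finType)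
    (c : I -> F) (u : I -> U) :
  f (\sum_i c i *: u i) = \sum_i c i *: f (u i).
Proof.
pose g : {linear U -> W} := HB.pack f (GRing.isLinear.Build F U W *:%R f lf).
rewrite -[f]/(g : U -> W) linear_sum; apply: eq_bigr => i _.
by rewrite linearZ.
Qed.

Lemma linear_sumE U W (f : U -> W) (lf : linear f) (I : finType) (u : I -> U) :
  f (\sum_i u i) = \sum_i f (u i).
Proof.
under eq_bigr => i _ do rewrite -[u i]scale1r.
by rewrite (linear_sumZ lf); apply: eq_bigr => i _; rewrite !scale1r.
Qed.

Lemma tliftE U V W (f : U -> V -> W) u v : bilin f -> tlift f (u \ox v) = f u v.
Proof.
move=> [fl fr]; rewrite [in RHS](crd_bas u) (linear_sumZ (fl v)).
apply: eq_bigr => i _; rewrite [in RHS](crd_bas v) (linear_sumZ (fr _)).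
by rewrite scaler_sumr; apply: eq_bigr => j _; rewrite mxE scalerA.
Qed.

Lemma pure_bilin U V : bilin (@pure U V).
Proof.
split=> [v c u u'|u c v v']; apply/matrixP=> i j; rewrite !mxE crd_linear.
  by rewrite mulrDl mulrA.
by rewrite mulrDr mulrCA.
Qed.

Lemma tens_sum U V (t : tens U V) : tlift (@pure U V) t = t.
Proof.
apply/matrixP=> i j; rewrite /tlift summxE (bigD1 i) //= summxE (bigD1 j) //=.
rewrite !mxE !crd_delta !eqxx !mulr1 !big1 ?addr0 // => k.
  move=> kj; rewrite summxE big1 // => l _.
  by rewrite !mxE !crd_delta eq_sym (negPf kj) mul0r mulr0.
by move=> kj; rewrite !mxE !crd_delta [j == _]eq_sym (negPf kj) !mulr0.
Qed.

Lemma tlift_comp U V W W' (L : W -> W') (f : U -> V -> W) t : linear L ->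
  L (tlift f t) = tlift (fun u v => L (f u v)) t.
Proof.
move=> lL.
pose g : {linear W -> W'} := HB.pack L (GRing.isLinear.Build F W W' *:%R L lL).
rewrite -[L]/(g : W -> W') linear_sum; apply: eq_bigr => i _.
by rewrite linear_sum; apply: eq_bigr => j _; rewrite linearZ.
Qed.

Lemma eq_tlift U V W (f g : U -> V -> W) t :
  (forall u v, f u v = g u v) -> tlift f t = tlift g t.
Proof. by move=> e; apply: eq_bigr => i _; apply: eq_bigr => j _; rewrite e. Qed.

Lemma tens_ext U V W (L L' : tens U V -> W) : linear L -> linear L' ->
  (forall u v, L (u \ox v) = L' (u \ox v)) -> L =1 L'.
Proof.
move=> lL lL' e t; rewrite -[t]tens_sum !tlift_comp //.
exact: eq_tlift.
Qed.

Lemma tlift_lin U V W c (f g : U -> V -> W) t :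
  tlift (fun u v => c *: f u v + g u v) t = c *: tlift f t + tlift g t.
Proof.
rewrite /tlift scaler_sumr -big_split; apply: eq_bigr => i _ /=.
rewrite scaler_sumr -big_split; apply: eq_bigr => j _ /=.
by rewrite scalerDr !scalerA mulrC.
Qed.

Lemma pureDl U V c (u u' : U) (v : V) :
  (c *: u + u') \ox v = c *: (u \ox v) + u' \ox v.
Proof. exact: (pure_bilin U V).1. Qed.

Lemma pureDr U V c (u : U) (v v' : V) :
  u \ox (c *: v + v') = c *: (u \ox v) + u \ox v'.
Proof. exact: (pure_bilin U V).2. Qed.

Lemma pureZl U V c (u : U) (v : V) : (c *: u) \ox v = c *: (u \ox v).
Proof. by apply/matrixP=> i j; rewrite !mxE /crd linearZ mulrA. Qed.

Lemma pureZr U V c (u : U) (v : V) : u \ox (c *: v) = c *: (u \ox v).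
Proof. by apply/matrixP=> i j; rewrite !mxE /crd linearZ mulrCA. Qed.

Lemma pure_eq0 U V (u : U) (v : V) : u \ox v = 0 -> (u == 0) || (v == 0).
Proof.
move=> /matrixP uv0; apply/norP => -[u0 v0].
have crd0 (X : vectType F) (x : X) : x != 0 -> exists i, crd i x != 0.
  move=> x0; apply/existsP; apply: contraR x0 => /existsPn x0.
  rewrite (crd_bas x) big1 // => i _.
  by have /negPn/eqP-> := x0 i; rewrite scale0r.
have [[i ui] [j vj]] := (crd0 _ _ u0, crd0 _ _ v0).
by have /eqP := uv0 i j; rewrite !mxE mulf_eq0 (negPf ui) (negPf vj).
Qed.

Definition tmap U V U' V' (f : U -> U') (g : V -> V') : tens U V -> tens U' V' :=
  tlift (fun u v => f u \ox g v).

Definition tswap U V : tens U V -> tens V U := tlift (fun u v => v \ox u).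

Definition tassoc U V W : tens U (tens V W) -> tens (tens U V) W :=
  tlift (fun u => tlift (fun v w => (u \ox v) \ox w)).

Definition tlift3 U V W (X : vectType F) (f : U -> V -> W -> X) : tens (tens U V) W -> X :=
  tlift (fun t w => tlift (fun u v => f u v w) t).

Definition tensv U V (X : {vspace U}) (Y : {vspace V}) : {vspace tens U V} :=
  <<[seq x \ox y | x <- vbasis X, y <- vbasis Y]>>%VS.

Lemma tlift_tmap U V U' V' W (f : U' -> V' -> W) (g : U -> U') (h : V -> V') t :
  bilin f -> tlift f (tmap g h t) = tlift (fun u v => f (g u) (h v)) t.
Proof.
move=> bf; rewrite /tmap tlift_comp; last by move=> c x y; rewrite linearP.
by apply: eq_tlift => u v; rewrite tliftE.
Qed.

Lemma tlift_exch U V U' V' W (f : U -> V -> U' -> V' -> W) s t :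
  tlift (fun u v => tlift (f u v) t) s =
  tlift (fun u' v' => tlift (fun u v => f u v u' v') s) t.
Proof.
rewrite /tlift; pose c U V (M : tens U V) i j := (M : 'M[F]_(_, _)) i j.
transitivity (\sum_i \sum_j \sum_k \sum_l
    (c U V s i j * c U' V' t k l) *: f (bas i) (bas j) (bas k) (bas l)).
  apply: eq_bigr => i _; apply: eq_bigr => j _; rewrite scaler_sumr.
  by apply: eq_bigr => k _; rewrite scaler_sumr; apply: eq_bigr => l _; rewrite scalerA.
transitivity (\sum_k \sum_i \sum_j \sum_l
    (c U V s i j * c U' V' t k l) *: f (bas i) (bas j) (bas k) (bas l)).
  rewrite [RHS]exchange_big; apply: eq_bigr => i _ /=.
  by rewrite exchange_big.
apply: eq_bigr => k _.
transitivity (\sum_i \sum_l \sum_j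
    (c U V s i j * c U' V' t k l) *: f (bas i) (bas j) (bas k) (bas l)).
  by apply: eq_bigr => i _; rewrite exchange_big.
rewrite exchange_big; apply: eq_bigr => l _ /=; rewrite scaler_sumr.
apply: eq_bigr => i _; rewrite scaler_sumr; apply: eq_bigr => j _.
by rewrite scalerA mulrC.
Qed.

Definition trilin U V W (X : vectType F) (f : U -> V -> W -> X) : Prop :=
  [/\ forall v w, linear (fun u => f u v w), forall u w, linear (fun v => f u v w)
    & forall u v, linear (f u v)].

Lemma tassocE U V W (u : U) (s : tens V W) :
  tassoc (u \ox s) = tlift (fun v w => (u \ox v) \ox w) s.
Proof.
rewrite /tassoc tliftE //; split=> [t c x y|x c t t']; last by rewrite linearP.
by rewrite -tlift_lin; apply: eq_tlift => v w; rewrite !pureDl.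
Qed.

Lemma tlift3E U V W (X : vectType F) (f : U -> V -> W -> X) t w :
  trilin f -> tlift3 f (t \ox w) = tlift (fun u v => f u v w) t.
Proof.
move=> [fu fv fw]; rewrite /tlift3 tliftE //; split=> [x c s s'|s c x y].
  by rewrite linearP.
by rewrite -tlift_lin; apply: eq_tlift => u v; rewrite fw.
Qed.

Lemma tlift3_tmapl U V W (U' : vectType F) (X : vectType F)
    (f : U -> V -> W -> X) (D : U' -> tens U V) t :
  trilin f -> tlift3 f (tmap D id t) =
  tlift (fun x w => tlift (fun u v => f u v w) (D x)) t.
Proof.
move=> tf; rewrite /tmap tlift_comp; last by move=> c x y; rewrite /tlift3 linearP.
by apply: eq_tlift => u v; rewrite tlift3E.
Qed.

Lemma tlift3_tassoc U V W (V' : vectType F) (X : vectType F)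
    (f : U -> V -> W -> X) (D : V' -> tens V W) t :
  trilin f -> tlift3 f (tassoc (tmap id D t)) =
  tlift (fun u x => tlift (fun v w => f u v w) (D x)) t.
Proof.
move=> tf; have [fu fv fw] := tf; rewrite /tmap tlift_comp; last first.
  by move=> c x y; rewrite /tassoc linearP.
rewrite tlift_comp; last by move=> c x y; rewrite /tlift3 linearP.
apply: eq_tlift => u x; rewrite tassocE tlift_comp; last first.
  by move=> c y z; rewrite /tlift3 linearP.
apply: eq_tlift => v w; rewrite tlift3E // tliftE //.
Qed.

End Tensor.

Notation "u \ox v" := (pure u v) : ring_scope.

Section TensorAlgebra.
Variables (F : fieldType) (A B : falgType F).
Implicit Types s t : tens A B.

Definition tmul s t : tens A B :=
  tlift (fun a b => tlift (fun a' b' => (a * a') \ox (b * b')) t) s.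

Fact tmul_linr s : linear (tmul s).
Proof.
by move=> c t t'; rewrite -tlift_lin; apply: eq_tlift => a b; rewrite linearP.
Qed.

Fact tmul_linl t : linear (tmul^~ t).
Proof. by move=> c s s'; rewrite /tmul linearP. Qed.

Lemma tmulE a b a' b' :
  tmul (a \ox b) (a' \ox b') = (a * a') \ox (b * b').
Proof.
have bil x y : bilin (fun x' y' => (x * x') \ox (y * y') : tens A B).
  by split=> v c u u'; rewrite mulrDr -scalerAr (pureDl, pureDr).
rewrite /tmul tliftE ?tliftE //.
by split=> v c u u'; rewrite -tlift_lin; apply: eq_tlift => x y;
   rewrite mulrDl -scalerAl (pureDl, pureDr).
Qed.

Fact tmulA : associative tmul.
Proof.
move=> r s t; move: r; apply: tens_ext => [||a b].
- by move=> c x y; rewrite tmul_linl.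
- by move=> c x y; rewrite !tmul_linl.
move: s; apply: tens_ext => [||a' b'].
- by move=> c x y; rewrite tmul_linl tmul_linr.
- by move=> c x y; rewrite tmul_linr tmul_linl.
move: t; apply: tens_ext => [||a'' b''].
- by move=> c x y; rewrite !tmul_linr.
- by move=> c x y; rewrite tmul_linr.
by rewrite !tmulE !mulrA.
Qed.

Fact tmul1 : left_id (1 \ox 1) tmul.
Proof.
apply: tens_ext => [||a b]; first exact: tmul_linr; first by [].
by rewrite tmulE !mul1r.
Qed.

Fact tmulr1 : right_id (1 \ox 1) tmul.
Proof.
apply: tens_ext => [||a b]; first exact: tmul_linl; first by [].
by rewrite tmulE !mulr1.
Qed.

Fact tmulDl : left_distributive tmul +%R.
Proof.
by move=> s s' t; have := tmul_linl t 1 s s'; rewrite !scale1r.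
Qed.

Fact tmulDr : right_distributive tmul +%R.
Proof.
by move=> s t t'; have := tmul_linr s 1 t t'; rewrite !scale1r.
Qed.

Fact tone_neq0 : 1 \ox 1 != 0 :> tens A B.
Proof. by apply/eqP => /pure_eq0; rewrite !oner_eq0. Qed.

Fact tmulZl c s t : c *: tmul s t = tmul (c *: s) t.
Proof.
have t0 : tmul 0 t = 0 by rewrite /tmul linear0.
by have := tmul_linl t c s 0; rewrite t0 !addr0 => ->.
Qed.

Fact tmulZr c s t : c *: tmul s t = tmul s (c *: t).
Proof.
have s0 : tmul s 0 = 0.
  by have := tmul_linr s (-1) 0 0; rewrite scaler0 addr0 scaleN1r addNr.
by have := tmul_linr s c t 0; rewrite s0 !addr0 => ->.
Qed.

HB.instance Definition _ := GRing.Zmodule_isNzRing.Build (tens A B)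
  tmulA tmul1 tmulr1 tmulDl tmulDr tone_neq0.
HB.instance Definition _ := GRing.Lmodule_isLalgebra.Build F (tens A B) tmulZl.
HB.instance Definition _ := GRing.Lalgebra_isAlgebra.Build F (tens A B) tmulZr.
HB.instance Definition _ := Algebra_isFalgebra.Build F (tens A B).

End TensorAlgebra.

Section Bialgebra.
Variable F : fieldType.

Record bialgebra (A : falgType F) := Bialgebra {
  comul : 'AHom(A, tens A A);
  counit : 'AHom(A, F^o);
  comulA : forall x,
    tassoc (tmap id comul (comul x)) = tmap comul id (comul x);
  counitl : forall x, tlift (fun a b => counit a *: b) (comul x) = x;
  counitr : forall x, tlift (fun a b => counit b *: a) (comul x) = x }.

Record hopf (A : falgType F) := Hopf {
  hopf_bialgebra :> bialgebra A;
  antipode : 'End(A);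
  antipodel : forall x,
    tlift (fun a b => antipode a * b) (comul hopf_bialgebra x) =
      (counit hopf_bialgebra x : F)%:A;
  antipoder : forall x,
    tlift (fun a b => a * antipode b) (comul hopf_bialgebra x) =
      (counit hopf_bialgebra x : F)%:A }.

End Bialgebra.

(* The dual space of A, as the carrier of A^{*cop}: it carries the product    *)
(* dual to the coproduct of A, whence the parameter H.                        *)
Definition dual (F : fieldType) (A : falgType F) (H : bialgebra A) : Type :=
  'Hom(A, F^o).

HB.instance Definition _ (F : fieldType) (A : falgType F) (H : bialgebra A) :=
  Vector.on (dual H).

Section Dual.
Variables (F : fieldType) (A : falgType F) (H : bialgebra A).
Local Notation B := (dual H).
Local Notation comul := (comul H).
Local Notation counit := (counit H).

Definition pairing (a : A) (b : B) : F^o := (b : 'Hom(A, F^o)) a.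

Lemma regularE (c : F) (x : F^o) : c *: x = c * x. Proof. by []. Qed.

Lemma pairing_ext (b b' : B) : (forall a, pairing a b = pairing a b') -> b = b'.
Proof. by move=> e; apply/lfunP. Qed.

Lemma pairing_linl b : linear (pairing^~ b).
Proof. by move=> c x y; rewrite /pairing linearP. Qed.

Lemma pairing_linr a : linear (pairing a).
Proof. by move=> c x y; rewrite /pairing add_lfunE scale_lfunE. Qed.

(* <a, b b'> = <a_1, b> <a_2, b'> *)
Definition dual_mul (b b' : B) : B :=
  linfun (tlift (fun x y => pairing x b * pairing y b' : F^o) \o comul).

Lemma dual_mulE a b b' : pairing a (dual_mul b b') =
  tlift (fun x y => pairing x b * pairing y b' : F^o) (comul a).
Proof. by rewrite /pairing lfunE. Qed.

Lemma pair2_bilin (b b' : B) :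
  bilin (fun x y => pairing x b * pairing y b' : F^o).
Proof.
split=> [v c u u'|v c u u']; rewrite pairing_linl.
  by rewrite mulrDl -[(c *: pairing u b) * _]mulrA.
by rewrite mulrDr [in LHS]/GRing.scale /= mulrCA.
Qed.

Definition dual_one : B := ahval counit.

Fact dual_mulA : associative dual_mul.
Proof.
move=> b b' b''; apply: pairing_ext => a; rewrite !dual_mulE.
pose f x y z : F^o := pairing x b * pairing y b' * pairing z b''.
have tf : trilin f.
  rewrite /f; split=> [v w|u w|u v] c x y; rewrite pairing_linl.
  - by rewrite !mulrDl !regularE !mulrA.
  - by rewrite mulrDr mulrDl !regularE mulrCA !mulrA.
  - by rewrite mulrDr !regularE mulrCA.
transitivity (tlift3 f (tassoc (tmap id comul (comul a)))).
  rewrite tlift3_tassoc //; apply: eq_tlift => x y; rewrite dual_mulE.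
  pose L (p : F^o) : F^o := pairing x b * p.
  have lL : linear L by move=> c u v; rewrite /L mulrDr !regularE mulrCA.
  rewrite -/(L _) tlift_comp //.
  by apply: eq_tlift => u v; rewrite /L /f mulrA.
rewrite comulA tlift3_tmapl //; apply: eq_tlift => x y; rewrite dual_mulE.
pose L (p : F^o) : F^o := p * pairing y b''.
have lL : linear L by move=> c u v; rewrite /L mulrDl !regularE mulrA.
by rewrite -/(L _) tlift_comp.
Qed.

Fact dual_mul1 : left_id dual_one dual_mul.
Proof.
move=> b; apply: pairing_ext => a; rewrite dual_mulE -[in RHS](counitl H a).
rewrite [RHS]tlift_comp; last exact: pairing_linl.
by apply: eq_tlift => x y; rewrite /pairing linearZ.
Qed.

Fact dual_mulr1 : right_id dual_one dual_mul.
Proof.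
move=> b; apply: pairing_ext => a; rewrite dual_mulE -[in RHS](counitr H a).
rewrite [RHS]tlift_comp; last exact: pairing_linl.
by apply: eq_tlift => x y; rewrite /pairing linearZ /= mulrC.
Qed.

Fact dual_mul_linl b' c b1 b2 :
  dual_mul (c *: b1 + b2) b' = c *: dual_mul b1 b' + dual_mul b2 b'.
Proof.
apply: pairing_ext => a; rewrite pairing_linr !dual_mulE -tlift_lin.
by apply: eq_tlift => x y; rewrite pairing_linr mulrDl !regularE mulrA.
Qed.

Fact dual_mul_linr b' c b1 b2 :
  dual_mul b' (c *: b1 + b2) = c *: dual_mul b' b1 + dual_mul b' b2.
Proof.
apply: pairing_ext => a; rewrite pairing_linr !dual_mulE -tlift_lin.
by apply: eq_tlift => x y; rewrite pairing_linr mulrDr !regularE mulrCA.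
Qed.

Fact dual_mulDl : left_distributive dual_mul +%R.
Proof. by move=> x y z; have := dual_mul_linl z 1 x y; rewrite !scale1r. Qed.

Fact dual_mulDr : right_distributive dual_mul +%R.
Proof. by move=> x y z; have := dual_mul_linr x 1 y z; rewrite !scale1r. Qed.

Fact dual_one_neq0 : dual_one != 0.
Proof.
apply/eqP => /(congr1 (pairing 1)); rewrite /pairing rmorph1 lfunE.
by apply/eqP; exact: oner_neq0.
Qed.

Fact dual_mulZl c b b' : c *: dual_mul b b' = dual_mul (c *: b) b'.
Proof.
apply: pairing_ext => a; rewrite -[c *: dual_mul _ _]addr0 pairing_linr.
rewrite !dual_mulE [pairing a 0]lfunE addr0 tlift_comp.
  apply: eq_tlift => x y; rewrite regularE mulrA; congr (_ * _).
  by rewrite -[c *: b]addr0 pairing_linr [pairing x 0]lfunE addr0.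
by move=> k x y; rewrite scalerDr !scalerA mulrC.
Qed.

Fact dual_mulZr c b b' : c *: dual_mul b b' = dual_mul b (c *: b').
Proof.
apply: pairing_ext => a; rewrite -[c *: dual_mul _ _]addr0 pairing_linr.
rewrite !dual_mulE [pairing a 0]lfunE addr0 tlift_comp.
  apply: eq_tlift => x y; rewrite regularE mulrCA; congr (_ * _).
  by rewrite -[c *: b']addr0 pairing_linr [pairing y 0]lfunE addr0.
by move=> k x y; rewrite scalerDr !scalerA mulrC.
Qed.

HB.instance Definition _ := GRing.Zmodule_isNzRing.Build (dual H)
  dual_mulA dual_mul1 dual_mulr1 dual_mulDl dual_mulDr dual_one_neq0.
HB.instance Definition _ := GRing.Lmodule_isLalgebra.Build F (dual H) dual_mulZl.
HB.instance Definition _ := GRing.Lalgebra_isAlgebra.Build F (dual H) dual_mulZr.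
HB.instance Definition _ := Algebra_isFalgebra.Build F (dual H).

End Dual.

Section DualBialgebra.
Variables (F : fieldType) (A : falgType F) (H : bialgebra A).
Local Notation B := (dual H).
Local Notation comul := (comul H).
Local Notation counit := (counit H).

Lemma pairingM a (b b' : B) : pairing a (b * b') =
  tlift (fun x y => pairing x b * pairing y b' : F^o) (comul a).
Proof. exact: dual_mulE. Qed.

Lemma pairing1 a : pairing a (1 : B) = counit a.
Proof. by []. Qed.

Lemma pairingZ a c (b : B) : pairing a (c *: b) = c * pairing a b.
Proof. exact: scale_lfunE. Qed.

Lemma pairing_sum a (I : finType) (b : I -> B) :
  pairing a (\sum_i b i) = \sum_i pairing a (b i).
Proof. exact: sum_lfunE. Qed.

Definition dual_bas (i : 'I_(\dim {:A})) : B :=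
  linfun (coord (vbasis {:A}) i : A -> F^o).

Lemma dual_basE i a : pairing a (dual_bas i) = crd i a.
Proof. by rewrite /pairing lfunE. Qed.

Lemma dual_crd (b : B) : b = \sum_i pairing (bas i) b *: dual_bas i.
Proof.
apply: pairing_ext => a; rewrite pairing_sum [in LHS](crd_bas a).
rewrite (linear_sumZ (pairing_linl b)); apply: eq_bigr => i _.
by rewrite pairingZ dual_basE mulrC.
Qed.

(* <a a', b> = <a, b_2> <a', b_1>: see [dual_comulE] *)
Definition dual_comul (b : B) : tens B B :=
  \sum_i \sum_j pairing (bas i * bas j) b *: (dual_bas j \ox dual_bas i).

Definition dual_counit (b : B) : F^o := pairing 1 b.

Definition slice (U : vectType F) (a : A) (t : tens U B) : U :=
  tlift (fun u (b : B) => (pairing a b : F) *: u) t.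

Lemma slice_linear (U : vectType F) a : linear (@slice U a).
Proof. by move=> c s t; rewrite /slice linearP. Qed.

Lemma slice_linearZ (U : vectType F) a c (t : tens U B) :
  slice a (c *: t) = c *: slice a t.
Proof. by rewrite /slice linearZ. Qed.

Lemma slice_bilin (U : vectType F) a :
  bilin (fun (u : U) (b : B) => (pairing a b : F) *: u).
Proof.
split=> [b c u v|u c b b']; first by rewrite scalerDr !scalerA mulrC.
by rewrite pairing_linr scalerDl scalerA.
Qed.

Lemma sliceE (U : vectType F) a (u : U) b : slice a (u \ox b) = (pairing a b : F) *: u.
Proof. by rewrite /slice tliftE //; exact: slice_bilin. Qed.

Lemma slice_linl (U : vectType F) (t : tens U B) : linear (fun a => slice a t).
Proof.
move=> c a a'; rewrite /slice -tlift_lin; apply: eq_tlift => u b.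
by rewrite pairing_linl scalerDl scalerA.
Qed.

Lemma slice_ext (U : vectType F) (s t : tens U B) : (forall a, slice a s = slice a t) -> s = t.
Proof.
have rec : forall r : tens U B, \sum_i slice (bas i) r \ox dual_bas i = r.
  apply: tens_ext => [c x y||u b] //.
    rewrite scaler_sumr -big_split; apply: eq_bigr => i _.
    by rewrite slice_linear pureDl.
  transitivity (u \ox \sum_i pairing (bas i) b *: dual_bas i); last first.
    by rewrite -dual_crd.
  rewrite (linear_sumZ ((pure_bilin U B).2 u)); apply: eq_bigr => i _.
  by rewrite sliceE pureZl.
by move=> e; rewrite -(rec s) -(rec t); apply: eq_bigr => i _; rewrite e.
Qed.

Lemma tens_dual_ext (s t : tens B B) :
  (forall x y, pairing x (slice y s) = pairing x (slice y t)) -> s = t.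
Proof.
by move=> e; apply: slice_ext => y; apply: pairing_ext => x; rewrite e.
Qed.

Lemma dual_comulE x y b :
  pairing x (slice y (dual_comul b)) = pairing (y * x) b.
Proof.
have lL : linear (fun t : tens B B => pairing x (slice y t)).
  by move=> c s t; rewrite slice_linear pairing_linr.
have ll : linear (fun y : A => pairing (y * x) b).
  by move=> c u v; rewrite mulrDl -scalerAl pairing_linl.
rewrite (linear_sumE lL) [y in RHS]crd_bas (linear_sumZ ll).
apply: eq_bigr => i _; rewrite (linear_sumE lL) [x in RHS]crd_bas.
have lr : linear (fun x : A => pairing (bas i * x) b).
  by move=> c u v; rewrite mulrDr -scalerAr pairing_linl.
rewrite (linear_sumZ lr) scaler_sumr; apply: eq_bigr => j _.
rewrite slice_linearZ pairingZ sliceE pairingZ !dual_basE.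
by rewrite !regularE mulrC -mulrA.
Qed.

Fact dual_comul_is_linear : linear dual_comul.
Proof.
move=> c b b'; apply: tens_dual_ext => x y.
by rewrite slice_linear pairing_linr !dual_comulE pairing_linr.
Qed.
HB.instance Definition _ :=
  GRing.isLinear.Build F B (tens B B) *:%R dual_comul dual_comul_is_linear.

Lemma pairing_slice_mul x y (s t : tens B B) :
  pairing x (slice y (s * t)) =
  tlift (fun x1 x2 => tlift (fun y1 y2 =>
    pairing x1 (slice y1 s) * pairing x2 (slice y2 t) : F^o) (comul y)) (comul x).
Proof.
move: s; apply: tens_ext => [c s s'|c s s'|p q].
- by rewrite mulrDl -scalerAl slice_linear pairing_linr.
- rewrite -tlift_lin; apply: eq_tlift => x1 x2.
  rewrite -tlift_lin; apply: eq_tlift => y1 y2.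
  by rewrite slice_linear pairing_linr mulrDl !regularE mulrA.
move: t; apply: tens_ext => [c t t'|c t t'|p' q'].
- by rewrite mulrDr -scalerAr slice_linear pairing_linr.
- rewrite -tlift_lin; apply: eq_tlift => x1 x2.
  rewrite -tlift_lin; apply: eq_tlift => y1 y2.
  by rewrite slice_linear pairing_linr mulrDr !regularE mulrCA.
rewrite [_ * _]tmulE sliceE pairingZ !pairingM.
pose L (z : F^o) : F^o :=
  tlift (fun u v => pairing u q * pairing v q' : F^o) (comul y) * z.
have lL : linear L by move=> c u v; rewrite /L mulrDr !regularE mulrCA.
rewrite -/(L _) tlift_comp //; apply: eq_tlift => x1 x2; rewrite /L.
pose M (z : F^o) : F^o := z * (pairing x1 p * pairing x2 p').
have lM : linear M by move=> c u v; rewrite /M mulrDl !regularE -!mulrA.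
rewrite -/(M _) tlift_comp //; apply: eq_tlift => y1 y2; rewrite /M.
by rewrite !sliceE !pairingZ mulrACA.
Qed.

Fact dual_comul_ahom : ahom_in {:B} (linfun dual_comul).
Proof.
apply/ahom_inP; split=> [b b' _ _|]; rewrite !lfunE /=.
  apply: tens_dual_ext => x y.
  rewrite dual_comulE pairing_slice_mul pairingM rmorphM [comul y * _]/GRing.mul /=.
  rewrite /tmul tlift_comp; last by move=> c s t; rewrite linearP.
  rewrite [RHS]tlift_exch; apply: eq_tlift => y1 y2.
  rewrite tlift_comp; last by move=> c s t; rewrite linearP.
  apply: eq_tlift => x1 x2; rewrite tliftE; last exact: pair2_bilin.
  by rewrite !dual_comulE.
apply: tens_dual_ext => x y; rewrite dual_comulE [1]/GRing.one /= sliceE.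
by rewrite pairingZ !pairing1 rmorphM.
Qed.

Fact dual_counit_is_linear : linear (dual_counit : B -> F^o).
Proof. exact: pairing_linr. Qed.
HB.instance Definition _ :=
  GRing.isLinear.Build F B F^o *:%R dual_counit dual_counit_is_linear.

Fact dual_counit_ahom : ahom_in {:B} (linfun (dual_counit : B -> F^o)).
Proof.
apply/ahom_inP; split=> [b b' _ _|]; rewrite !lfunE /= /dual_counit.
  by rewrite pairingM rmorph1 tliftE //; exact: pair2_bilin.
by rewrite pairing1 rmorph1.
Qed.

Lemma dual_comul_lfunE b : AHom dual_comul_ahom b = dual_comul b.
Proof. by rewrite lfunE. Qed.

Fact dual_comulA b :
  tassoc (tmap id (AHom dual_comul_ahom) (AHom dual_comul_ahom b)) =
  tmap (AHom dual_comul_ahom) id (AHom dual_comul_ahom b).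
Proof.
rewrite dual_comul_lfunE; apply: slice_ext => z; apply: tens_dual_ext => x y.
transitivity (pairing x (slice (z * y) (dual_comul b))).
  have lL : linear (fun t : tens B (tens B B) =>
      slice y (slice z (tassoc t))).
    by move=> c s t; rewrite /tassoc linearP !slice_linear.
  rewrite /tmap (tlift_comp _ _ lL) [slice (z * y) _]/slice; congr (pairing x _).
  apply: eq_tlift => b1 b2; rewrite tassocE dual_comul_lfunE.
  have lM : linear (fun t : tens (tens B B) B => slice y (slice z t)).
    by move=> c s t; rewrite !slice_linear.
  rewrite (tlift_comp _ _ lM) -dual_comulE.
  have lN : linear (fun t : tens B B => (pairing y (slice z t) : F) *: b1).
    by move=> c s t; rewrite slice_linear pairing_linr scalerDl scalerA.
  rewrite -[in RHS](tens_sum (dual_comul b2)) (tlift_comp _ _ lN).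
  apply: eq_tlift => v w; rewrite !sliceE slice_linearZ sliceE pairingZ.
  by rewrite scalerA.
have -> : slice z (tmap (AHom dual_comul_ahom) id (dual_comul b)) =
    dual_comul (slice z (dual_comul b)).
  rewrite /tmap tlift_comp; last exact: slice_linear.
  rewrite [in RHS]/slice [RHS]tlift_comp; last exact: dual_comul_is_linear.
  by apply: eq_tlift => b1 b2; rewrite sliceE dual_comul_lfunE linearZ.
by rewrite !dual_comulE mulrA.
Qed.

Fact dual_counitl b : tlift (fun b1 b2 : B =>
  ((AHom dual_counit_ahom b1 : F^o) : F) *: b2) (AHom dual_comul_ahom b) = b.
Proof.
rewrite dual_comul_lfunE; apply: pairing_ext => a.
rewrite tlift_comp; last exact: pairing_linr.
rewrite -[a in RHS]mulr1 -dual_comulE /slice [RHS]tlift_comp; last exact: pairing_linr.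
by apply: eq_tlift => b1 b2; rewrite !pairingZ lfunE mulrC.
Qed.

Fact dual_counitr b : tlift (fun b1 b2 : B =>
  ((AHom dual_counit_ahom b2 : F^o) : F) *: b1) (AHom dual_comul_ahom b) = b.
Proof.
rewrite dual_comul_lfunE; apply: pairing_ext => a.
rewrite -[a in RHS]mul1r -dual_comulE /slice; congr (pairing a _).
by apply: eq_tlift => b1 b2; rewrite lfunE.
Qed.

Definition dual_cop : bialgebra B :=
  Bialgebra dual_comulA dual_counitl dual_counitr.

End DualBialgebra.

Arguments pairing {F A H} a b.

Section Subspaces.
Variable F : fieldType.
Implicit Type A : falgType F.

(* Unital subalgebras, unlike the library's {aspace A}. *)
Definition subalgebra A (U : {vspace A}) : bool :=
  (1 \in U) && (U * U <= U)%VS.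

Definition left_coideal A (H : bialgebra A) (U : {vspace A}) : bool :=
  (comul H @: U <= tensv fullv U)%VS.

Definition right_coideal A (H : bialgebra A) (U : {vspace A}) : bool :=
  (comul H @: U <= tensv U fullv)%VS.

Definition factorization A (U V : {vspace A}) : Prop :=
  let m : 'Hom(tens A A, A) := linfun (tlift (fun a b : A => a * b)) in
  {in tensv U V &, injective m} /\ (m @: tensv U V = fullv)%VS.

Definition augmentation A (H : bialgebra A) (U : {vspace A}) : {vspace A} :=
  (U :&: lker (counit H))%VS.

Definition is_left_proj A (H : bialgebra A) (U V : {vspace A}) (P : 'End(A)) :=
  {in U & V, forall u v, P (u * v) = (counit H v : F) *: u}.

Definition is_right_proj A (H : bialgebra A) (U V : {vspace A}) (P : 'End(A)) :=
  {in U & V, forall u v, P (u * v) = (counit H u : F) *: v}.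

Definition perp A (H : bialgebra A) (U : {vspace A}) : {vspace dual H} :=
  lker (linfun (fun b : dual H => (b \o projv U)%VF : dual H)).

Lemma memv_perp A (H : bialgebra A) (U : {vspace A}) (b : dual H) :
  reflect {in U, forall a, pairing a b = 0} (b \in perp H U).
Proof.
pose f (b : dual H) : dual H := (b \o projv U)%VF.
have lf : linear f.
  by move=> c x y; rewrite /f comp_lfunDl comp_lfunZl.
pose g : {linear dual H -> dual H} :=
  HB.pack f (GRing.isLinear.Build F (dual H) (dual H) *:%R f lf).
rewrite memv_ker (lfunE g) /= /f; apply: (iffP eqP) => [b0 a aU|b0].
  by have /lfunP/(_ a) := b0; rewrite comp_lfunE projv_id // zero_lfunE.
apply/lfunP => a; rewrite comp_lfunE zero_lfunE.
by apply: (b0 (projv U a)); exact: memv_proj.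
Qed.

Lemma memv_tensv (U V : vectType F) (X : {vspace U}) (Y : {vspace V}) x y :
  x \in X -> y \in Y -> x \ox y \in tensv X Y.
Proof.
move=> xX yY; rewrite (coord_vbasis xX) (coord_vbasis yY).
rewrite (linear_sumZ ((pure_bilin U V).1 _)); apply: rpred_sum => i _.
rewrite rpredZ // (linear_sumZ ((pure_bilin U V).2 _)); apply: rpred_sum => j _.
rewrite rpredZ // memv_span //; apply/allpairsP.
by exists ((vbasis X)`_i, (vbasis Y)`_j); rewrite !mem_nth ?size_tuple.
Qed.

End Subspaces.

Section Double.
Variable F : fieldType.

Definition bialg_morph (A A' : falgType F) (H : bialgebra A) (H' : bialgebra A')
    (f : 'AHom(A, A')) : Prop :=
  (forall x, comul H' (f x) = tmap f f (comul H x)) /\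
  (forall x, counit H' (f x) = counit H x).

Definition hopf_subalgebra (A : falgType F) (H : hopf A) (U : {vspace A}) : bool :=
  [&& subalgebra U, (comul H @: U <= tensv U U)%VS & (antipode H @: U <= U)%VS].

Section Legs.
Variable A : falgType F.
Implicit Types (H : bialgebra A) (R : tens A A).

Definition leg12 R : tens (tens A A) A := R \ox 1.
Definition leg13 R : tens (tens A A) A := tlift (fun a b : A => (a \ox 1) \ox b) R.
Definition leg23 R : tens (tens A A) A := tlift (fun a b : A => (1 \ox a) \ox b) R.
Definition comul_id H R : tens (tens A A) A := tmap (comul H) id R.
Definition id_comul H R : tens (tens A A) A := tassoc (tmap id (comul H) R).

Definition quasitriangular H R : Prop :=
  [/\ R \is a GRing.unit,
      forall x, R * comul H x = tswap (comul H x) * R,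
      comul_id H R = leg13 R * leg23 R
    & id_comul H R = leg13 R * leg12 R].

Definition is_cocycle H R : Prop :=
  leg12 R * comul_id H R = leg23 R * id_comul H R.

Definition comul3 H (a : A) : tens (tens A A) A := comul_id H (comul H a).
End Legs.

Definition canonical_tensor (A : falgType F) (H : bialgebra A) : tens A (dual H) :=
  \sum_i bas i \ox dual_bas H i.

(* The right-hand side of                                                     *)
(*   b a = <S^-1(a_1), b_1> <a_3, b_3> a_2 b_2.                               *)
(* It is the inverse of the antipode that occurs: with S itself, applying the *)
(* counit to the rule would give epsilon(a) = a_2 S(a_1), i.e. S^2 = id.      *)
Definition double_rule (A D : falgType F) (HA : hopf A)
    (iA : A -> D) (iB : dual HA -> D) (a : A) (b : dual HA) : D :=
  tlift3 (fun a1 a2 a3 : A =>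
    tlift3 (fun b1 b2 b3 : dual HA =>
      (pairing ((antipode HA)^-1%VF a1) b1 * pairing a3 b3 : F) *:
        (iA a2 * iB b2))
      (comul3 (dual_cop HA) b))
    (comul3 HA a).

(* D is the double of A, containing A and A^{*cop} through iA and iB. *)
Record is_double (A D : falgType F) (HA : hopf A) (HD : hopf D)
    (iA : 'AHom(A, D)) (iB : 'AHom(dual HA, D)) : Prop := IsDouble {
  double_injA : lker iA = 0%VS;
  double_morphA : bialg_morph HA HD iA;
  double_subA : hopf_subalgebra HD (limg iA);
  double_injB : lker iB = 0%VS;
  double_morphB : bialg_morph (dual_cop HA) HD iB;
  double_subB : hopf_subalgebra HD (limg iB);
  double_bij : bijective (tlift (fun a b => iA a * iB b) : tens A (dual HA) -> D);
  double_mul : forall a b, iB b * iA a = double_rule iA iB a b }.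

Definition double_rmatrix (A D : falgType F) (HA : hopf A)
    (iA : 'AHom(A, D)) (iB : 'AHom(dual HA, D)) : tens D D :=
  tmap iA iB (canonical_tensor HA).

(* f identifies the bialgebra A with the subspace U of H'. *)
Definition embeds_onto (A A' : falgType F) (H : bialgebra A) (H' : bialgebra A')
    (f : 'AHom(A, A')) (U : {vspace A'}) : Prop :=
  [/\ bialg_morph H H' f, lker f = 0%VS & limg f = U].

(* f is an isomorphism of quasitriangular Hopf algebras (A, R) -> (A', R'). *)
Definition qt_isom (A A' : falgType F) (H : hopf A) (H' : hopf A')
    (R : tens A A) (R' : tens A' A') (f : 'AHom(A, A')) : Prop :=
  [/\ bijective f, bialg_morph H H' f & tmap f f R = R'].

End Double.

Arguments is_double {F A D} HA HD iA iB.

(* Main.v *)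
Require Import Defs.
From HB Require Import structures.
From mathcomp Require Import all_boot all_order all_algebra all_field.
From mathcomp Require Import complex reals.

(** Let [T] be the inverse of the antipode [S] of [A] and [<a, b>] the pairing.

    In leg notation all of [D] is governed by the canonical tensor [r]. Through
    [slice], an element of [U (x) B] is a linear map from [A] to [U], products become
    convolution products and [r] becomes the identity of [A]. In this way the
    multiplication rule of the double is equivalent to the cross relation
    [<a1, b1> b2 a2 = a1 b1 <a2, b2>] ([crossed_rule], [rule_crossed]), which in turn
    says that [R] intertwines the coproduct and its opposite on [A]
    ([crossed_R_comul]); hence [R] is a quasitriangular structure
    ([double_quasitriangular]). The rule also forces [S] to be invertible.

    The hypotheses on [A1] and [A2] say that [P1 * P2 = id] for the convolution
    ([P1_conv_P2]), that is [r = r1 * r2]. The spaces [B1] and [B2] are the images of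
    the transposes of [P2] and [P1] ([memB1], [memB2]), so they are dual to [A2] and
    [A1], and their properties follow by pairing with products [x y].

    For the cocycle identity, pair its third leg with [a]. Both sides depend on [P2 a]
    only, and for [y] in [A2] the identity is what remains of
    [R * comul y = comul^op y * R] after applying [P2] to the first leg
    ([R2_comulAD], [cocycle_slice]). A cocycle twists any quasitriangular Hopf algebra
    into another one ([twist_hopf], [twist_quasitriangular]); as [R = R1 * R2], the
    new R-matrix is [R2^(2,1) * R1].

    On [A1] and [B1], and on [A2] and [B2], one of the two pairings of the cross
    relation degenerates to counits. So [Ai] and [Bi] commute as spaces
    ([D1_swap], [D2_swap]). The twisted coproduct is both [R2 comul(x) R2^-1] and
    [R1^-1 comul^op(x) R1]; as [R2] lies in [A2 (x) B1] and [R1] in [A1 (x) B2], each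
    form confines one leg of the coproducts. So [D1] and [D2] are subbialgebras, and
    a finite dimensional subbialgebra is stable under the antipode
    ([subbialgebra_antipode]).

    Finally, the new R-matrix lies in [D1 (x) D2], and any R-matrix in [U (x) D]
    with [U] a Hopf subalgebra defines a Hopf algebra map [y |-> (y (x) id) R] from
    the dual of [U], with opposite coproduct, to [D] ([pair_map], [pair_map_morph]).
    The intertwining property of the R-matrix is again equivalent to the
    multiplication rule of a double ([pair_map_rule]). Here the map is an isomorphism
    onto [D2] ([dual_incl_inj], [dual_incl_img]), and [D1 D2] is all of [D], since the
    rule makes it a subalgebra and it contains generators ([D1_D2_full]). So the
    twisted [D] itself is the double of [D1] ([D1_D2_double]). *)

Set Implicit Arguments.
Unset Strict Implicit.
Unset Printing Implicit Defensive.

Import GRing.Theory.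
Local Open Scope ring_scope.

(** * Automation for linear maps *)

Section LinearClosure.
Variable F : fieldType.
Implicit Types U V W X : vectType F.

Lemma lin_id U : linear (fun x : U => x). Proof. by []. Qed.

Lemma lin_comp U V W (g : V -> W) (f : U -> V) :
  linear g -> linear f -> linear (fun x => g (f x)).
Proof. by move=> lg lf c x y; rewrite lf lg. Qed.

Lemma lin_tlift U V W X (f : X -> U -> V -> W) t :
  (forall u v, linear (fun x => f x u v)) -> linear (fun x => tlift (f x) t).
Proof. by move=> lf c x y; rewrite -tlift_lin; apply: eq_tlift => u v; rewrite lf. Qed.

Lemma lin_pairl (A : falgType F) (H : bialgebra A) (b : dual H) :
  linear (fun a => pairing a b).
Proof. exact: pairing_linl. Qed.

Lemma lin_pairr (A : falgType F) (H : bialgebra A) (a : A) :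
  linear (fun b : dual H => pairing a b).
Proof. exact: pairing_linr. Qed.

Lemma lin_mull (A : falgType F) (a : A) : linear (fun x : A => a * x).
Proof. by move=> c x y; rewrite mulrDr -scalerAr. Qed.

Lemma lin_mulr (A : falgType F) (a : A) : linear (fun x : A => x * a).
Proof. by move=> c x y; rewrite mulrDl -scalerAl. Qed.

Lemma lin_scaler V (k : F) : linear (fun x : V => k *: x).
Proof. by move=> c x y; rewrite scalerDr !scalerA mulrC. Qed.

Lemma lin_scalel U V (f : U -> F^o) (v : V) :
  linear f -> linear (fun x => (f x : F) *: v).
Proof. by move=> lf c x y; rewrite lf scalerDl scalerA. Qed.

Lemma lin_regl U (f : U -> F^o) (c : F) :
  linear f -> linear (fun x => ((f x : F) * c : F^o)).
Proof. by move=> lf k x y; rewrite lf mulrDl !regularE !mulrA. Qed.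

Lemma lin_regr U (f : U -> F^o) (c : F) :
  linear f -> linear (fun x => (c * (f x : F) : F^o)).
Proof. by move=> lf k x y; rewrite lf mulrDr !regularE mulrCA. Qed.

Lemma lin_purel U V (v : V) : linear (fun u : U => u \ox v).
Proof. exact: (pure_bilin U V).1. Qed.

Lemma lin_purer U V (u : U) : linear (fun v : V => u \ox v).
Proof. exact: (pure_bilin U V).2. Qed.

Lemma lin_lift U V W (f : U -> V -> W) : linear (tlift f).
Proof. exact: linearP. Qed.

Lemma lin_map U V U' V' (f : U -> U') (g : V -> V') : linear (tmap f g).
Proof. exact: lin_lift. Qed.

Lemma lin_swap U V : linear (@tswap F U V). Proof. exact: lin_lift. Qed.

Lemma lin_assoc U V W : linear (@tassoc F U V W). Proof. exact: lin_lift. Qed.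

Lemma lin_lfun U V (f : 'Hom(U, V)) : linear f. Proof. exact: linearP. Qed.

Lemma lin_slice (A : falgType F) (H : bialgebra A) U a : linear (@slice F A H U a).
Proof. exact: slice_linear. Qed.

Lemma lin_slicel (A : falgType F) (H : bialgebra A) U t :
  linear (fun a => @slice F A H U a t).
Proof. exact: slice_linl. Qed.
End LinearClosure.

(** Identities between tensors are checked on pure tensors, which is legitimate only
    for linear maps. [lin] discharges these side conditions ([linear f], [bilin f],
    [trilin f]) by following the syntax of [f]. *)
Ltac lin_base := solve [ exact: lin_id | exact: lin_lfun | exact: lin_pairl
  | exact: lin_pairr | exact: lin_mull | exact: lin_mulr | exact: lin_purel
  | exact: lin_purer | exact: lin_scaler | exact: lin_lift
  | exact: lin_map | exact: lin_swap | exact: lin_assoc 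
  | exact: lin_slice | exact: lin_slicel
  | exact: linearP | eassumption
  | match goal with H : bilin _ |- _ => solve [exact: H.1 | exact: H.2] end ].

Ltac lin_step :=
  match goal with
  | |- GRing.linear_for _ (fun x => @tlift _ _ _ _ (@?f x) ?t) =>
      apply: (@lin_tlift _ _ _ _ _ f t); do 2 intro
  | |- GRing.linear_for _ (fun x => @GRing.mul _ (@?f x) ?b) =>
      apply: (@lin_comp _ _ _ _ (fun y => GRing.mul y b) f)
  | |- GRing.linear_for _ (fun x => @GRing.scale _ _ (@?f x) ?b) =>
      apply: (@lin_scalel _ _ _ f b)
  | |- GRing.linear_for _ (fun x => @pure _ _ _ (@?f x) ?b) =>
      apply: (@lin_comp _ _ _ _ (fun y => pure y b) f)
  | |- GRing.linear_for _ (fun x => @GRing.mul _ (@?f x) ?b) =>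
      apply: (@lin_regl _ _ f b)
  | |- GRing.linear_for _ (fun x => @GRing.mul _ ?b (@?f x)) =>
      apply: (@lin_regr _ _ f b)
  | |- GRing.linear_for _ (fun x => @pairing _ _ _ (@?f x) ?b) =>
      apply: (@lin_comp _ _ _ _ (fun y => pairing y b) f)
  | |- GRing.linear_for _ (fun x => ?g (@?f x)) =>
      apply: (@lin_comp _ _ _ _ g f)
  | |- GRing.linear_for _ (fun x => ?g (@?f x) ?b) =>
      apply: (@lin_comp _ _ _ _ (fun y => g y b) f)
  end.

Ltac lin :=
  cbv beta;
  lazymatch goal with
  | |- bilin _ => split; intro; lin
  | |- trilin _ => split; do 2 intro; lin
  | |- _ => first [ lin_base | lin_step; lin ]
  end.

(** * Linear maps on tensor products and Sweedler calculus *)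

Section TensorMaps.
Variable F : fieldType.
Implicit Types U V W X : vectType F.

Lemma lin0 U V (f : U -> V) : linear f -> f 0 = 0.
Proof. by move=> lf; have := lf (-1) 0 0; rewrite !scaleN1r !addNr. Qed.

Lemma linZ U V (f : U -> V) : linear f -> forall c x, f (c *: x) = c *: f x.
Proof. by move=> lf c x; rewrite -[c *: x]addr0 lf lin0 // addr0. Qed.

Lemma tmapE U V U' V' (f : U -> U') (g : V -> V') u v :
  linear f -> linear g -> tmap f g (u \ox v) = f u \ox g v.
Proof. by move=> lf lg; rewrite /tmap tliftE //; lin. Qed.

Lemma tswapE U V (u : U) (v : V) : tswap (u \ox v) = v \ox u.
Proof. by rewrite /tswap tliftE //; lin. Qed.

Lemma tassoc_pure U V W (u : U) (v : V) (w : W) :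
  tassoc (u \ox (v \ox w)) = (u \ox v) \ox w.
Proof. by rewrite tassocE tliftE //; lin. Qed.

Lemma tmap_id U V (t : tens U V) : tmap id id t = t.
Proof. exact: tens_sum. Qed.

Lemma tmap_comp U V U' V' U'' V'' (f : U -> U') (g : V -> V')
    (f' : U' -> U'') (g' : V' -> V'') t : linear f' -> linear g' ->
  tmap f' g' (tmap f g t) = tmap (fun x => f' (f x)) (fun x => g' (g x)) t.
Proof. by move=> lf lg; rewrite [LHS]tlift_tmap //; lin. Qed.

Lemma eq_tmap U V U' V' (f f' : U -> U') (g g' : V -> V') t :
  f =1 f' -> g =1 g' -> tmap f g t = tmap f' g' t.
Proof. by move=> ef eg; apply: eq_tlift => u v; rewrite ef eg. Qed.

Lemma tmap_tlift U V W W' X X' (f : W -> W') (g : X -> X')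
    (h : U -> V -> tens W X) t :
  tmap f g (tlift h t) = tlift (fun u v => tmap f g (h u v)) t.
Proof. by rewrite tlift_comp //; lin. Qed.

Lemma tliftDZ U V W c (f : U -> V -> W) (t : tens U V) :
  tlift (fun u v => c *: f u v) t = c *: tlift f t.
Proof. by rewrite [RHS]tlift_comp //; lin. Qed.
End TensorMaps.

Section TensorAlgebraMaps.
Variable F : fieldType.
Implicit Types A B : falgType F.

Lemma pureM A B (a a' : A) (b b' : B) :
  (a \ox b) * (a' \ox b') = (a * a') \ox (b * b').
Proof. exact: tmulE. Qed.

Lemma tmapM A B A' B' (f : A -> A') (g : B -> B') :
  linear f -> linear g -> {morph f : x y / x * y} -> {morph g : x y / x * y} ->
  {morph tmap f g : s t / s * t}.
Proof.
move=> lf lg mf mg s t; move: s; apply: tens_ext => [||a b]; [lin|lin|].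
move: t; apply: tens_ext => [||a' b']; [lin|lin|].
by rewrite pureM !tmapE // pureM mf mg.
Qed.

Lemma tmap1 A B A' B' (f : A -> A') (g : B -> B') : linear f -> linear g ->
  f 1 = 1 -> g 1 = 1 -> tmap f g 1 = 1.
Proof. by move=> lf lg f1 g1; rewrite [LHS]tmapE // f1 g1. Qed.

Lemma tswapM A B : {morph @tswap F A B : s t / s * t}.
Proof.
move=> s t; move: s; apply: tens_ext => [||a b]; [lin|lin|].
move: t; apply: tens_ext => [||a' b']; [lin|lin|].
by rewrite pureM !tswapE pureM.
Qed.

Lemma tswap1 A B : tswap (1 : tens A B) = 1.
Proof. exact: tswapE. Qed.
End TensorAlgebraMaps.

Section Sweedler.
Variables (F : fieldType) (A : falgType F) (H : bialgebra A).
Local Notation comul := (comul H).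
Local Notation counit := (counit H).
Implicit Type W : vectType F.

(** [tlift f (comul a)] is the Sweedler sum of the [f a1 a2]. In this form the axioms
    of a bialgebra become rewriting rules for arbitrary multilinear [f]. *)
Lemma sw_counitl W (f : A -> W) a : linear f ->
  tlift (fun x y => (counit x : F) *: f y) (comul a) = f a.
Proof.
move=> lf; rewrite -[in RHS](counitl H a) tlift_comp //.
by apply: eq_tlift => x y; rewrite (linZ lf).
Qed.

Lemma sw_counitr W (f : A -> W) a : linear f ->
  tlift (fun x y => (counit y : F) *: f x) (comul a) = f a.
Proof.
move=> lf; rewrite -[in RHS](counitr H a) tlift_comp //.
by apply: eq_tlift => x y; rewrite (linZ lf).
Qed.

Lemma sw_coassoc W (f : A -> A -> A -> W) a : trilin f ->
  tlift (fun x y => tlift (fun u v => f u v y) (comul x)) (comul a) =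
  tlift (fun x y => tlift (f x) (comul y)) (comul a).
Proof. by move=> tf; rewrite -tlift3_tmapl // -comulA tlift3_tassoc. Qed.

Lemma sw_mul W (f : A -> A -> W) a b : bilin f ->
  tlift f (comul (a * b)) =
  tlift (fun a1 a2 => tlift (fun b1 b2 => f (a1 * b1) (a2 * b2)) (comul b)) (comul a).
Proof.
move=> bf; rewrite rmorphM /=.
move: (comul a) (comul b) => s t.
move: s; apply: tens_ext => [||x y]; [lin| lin |].
move: t; apply: tens_ext => [||u v]; [lin|lin|].
by rewrite pureM !tliftE //; lin.
Qed.

End Sweedler.

(** * Convolution and antipodes *)

Section Convolution.
Variables (F : fieldType) (C C' W : falgType F).
Variables (HC : bialgebra C) (HC' : bialgebra C').

(** The convolution product on the linear maps from the coalgebra [C (x) C'] to [W],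
    read on the corresponding bilinear maps. *)
Definition conv2 (f g : C -> C' -> W) c d : W :=
  tlift (fun c1 c2 => tlift (fun d1 d2 => f c1 d1 * g c2 d2) (comul HC' d))
    (comul HC c).

Definition conv2_unit (c : C) (d : C') : W :=
  ((counit HC c : F) * (counit HC' d : F))%:A.

Lemma conv2_bilin f g : bilin (conv2 f g).
Proof. rewrite /conv2; lin. Qed.

Lemma eq_conv2 f f' g g' : f =2 f' -> g =2 g' -> conv2 f g =2 conv2 f' g'.
Proof.
move=> ef eg c d; apply: eq_tlift => c1 c2; apply: eq_tlift => d1 d2.
by rewrite ef eg.
Qed.

Lemma conv2A f g h : bilin f -> bilin g -> bilin h ->
  conv2 (conv2 f g) h =2 conv2 f (conv2 g h).
Proof.
move=> bf bg bh c d.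
pose k u v w := tlift (fun d1 d2 =>
  tlift (fun p q => f u d1 * (g v p * h w q)) (comul HC' d2)) (comul HC' d).
transitivity (tlift (fun c1 c2 => tlift (k c1) (comul HC c2)) (comul HC c)).
  rewrite -sw_coassoc; last by rewrite /k; lin.
  apply: eq_tlift => c1 c2.
  transitivity (tlift (fun d1 d2 => tlift (fun u v => tlift (fun p q =>
      f u p * (g v q * h c2 d2)) (comul HC' d1)) (comul HC c1)) (comul HC' d)).
    apply: eq_tlift => d1 d2.
    rewrite (tlift_comp (L := fun x => x * h c2 d2)); last by lin.
    apply: eq_tlift => u v.
    rewrite (tlift_comp (L := fun x => x * h c2 d2)); last by lin.
    by apply: eq_tlift => p q; rewrite mulrA.
  rewrite tlift_exch; apply: eq_tlift => u v.
  by rewrite /k (sw_coassoc _ (f := fun p q d2 => f u p * (g v q * h c2 d2))) //; lin.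
apply: eq_tlift => c1 c2; rewrite tlift_exch; apply: eq_tlift => d1 d2.
rewrite (tlift_comp (L := fun x => f c1 d1 * x)); last by lin.
apply: eq_tlift => u v.
by rewrite (tlift_comp (L := fun x => f c1 d1 * x)); last by lin.
Qed.

Lemma conv2_unitl f : bilin f -> conv2 conv2_unit f =2 f.
Proof.
move=> bf c d; rewrite -[RHS](@sw_counitl _ _ HC _ (f^~ d) c); last by lin.
apply: eq_tlift => c1 c2; rewrite -[in RHS](@sw_counitl _ _ HC' _ (f c2) d); last by lin.
by rewrite -tliftDZ; apply: eq_tlift => d1 d2; rewrite mulr_algl scalerA.
Qed.

Lemma conv2_unitr f : bilin f -> conv2 f conv2_unit =2 f.
Proof.
move=> bf c d; rewrite -[RHS](@sw_counitr _ _ HC _ (f^~ d) c); last by lin.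
apply: eq_tlift => c1 c2; rewrite -[in RHS](@sw_counitr _ _ HC' _ (f c1) d); last by lin.
by rewrite -tliftDZ; apply: eq_tlift => d1 d2; rewrite mulr_algr scalerA.
Qed.

(** [f = f * (g * h) = (f * g) * h = h]. *)
Lemma conv2_inv_uniq f g h : bilin f -> bilin g -> bilin h ->
  conv2 f g =2 conv2_unit -> conv2 g h =2 conv2_unit -> f =2 h.
Proof.
move=> bf bg bh fg gh c d.
rewrite -[LHS]conv2_unitr // -(eq_conv2 (fun x y => erefl (f x y)) gh) //.
by rewrite -conv2A // (eq_conv2 fg (fun x y => erefl (h x y))) conv2_unitl.
Qed.

Lemma conv_inv_uniq (f g h : C -> W) : linear f -> linear g -> linear h ->
  (forall c, tlift (fun x y => f x * g y) (comul HC c) = (counit HC c : F)%:A) ->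
  (forall c, tlift (fun x y => g x * h y) (comul HC c) = (counit HC c : F)%:A) ->
  f =1 h.
Proof.
move=> lf lg lh fg gh c.
rewrite -(sw_counitr HC c lf) -(sw_counitl HC c lh).
transitivity (tlift (fun x y => tlift (fun u v => f x * (g u * h v))
    (comul HC y)) (comul HC c)).
  apply: eq_tlift => x y; rewrite -(tlift_comp (L := fun z => f x * z)); last by lin.
  by rewrite gh mulr_algr.
rewrite -(sw_coassoc _ (f := fun x u v => f x * (g u * h v))); last by lin.
apply: eq_tlift => x y; rewrite -mulr_algl -fg.
rewrite (tlift_comp (L := fun z => z * h y)); last by lin.
by apply: eq_tlift => u v; rewrite mulrA.
Qed.

End Convolution.

Section Antipode.
Variables (F : fieldType) (A : falgType F) (H : hopf A).
Local Notation S := (antipode H).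

(** Both sides are convolution inverses of the multiplication [A (x) A -> A]. *)
Lemma antipodeM a b : S (a * b) = S b * S a.
Proof.
pose f a b := S (a * b); pose g a b : A := a * b; pose h a b := S b * S a.
suff: f =2 h by apply.
apply: (conv2_inv_uniq (HC := H) (HC' := H) (g := g)).
- by rewrite /f; lin.
- by rewrite /g; lin.
- by rewrite /h; lin.
- move=> c d; rewrite /conv2 /f /g /conv2_unit.
  have <- : counit H (c * d) = (counit H c : F) * (counit H d : F) :> F.
    by rewrite rmorphM.
  by rewrite -(antipodel H) sw_mul //; lin.
move=> c d; rewrite /conv2 /g /h /conv2_unit.
transitivity (tlift (fun c1 c2 => (counit H d : F) *: (c1 * S c2)) (comul H c)).
  apply: eq_tlift => c1 c2.
  transitivity (tlift (fun x y => c1 * (x * S y) * S c2) (comul H d)).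
    by apply: eq_tlift => x y; rewrite !mulrA.
  rewrite -(tlift_comp (L := fun z => c1 * z * S c2)); last by lin.
  by rewrite antipoder mulr_algr -scalerAl.
by rewrite tliftDZ antipoder scalerA mulrC.
Qed.

Lemma antipode1 : S 1 = 1.
Proof.
have := antipodel H 1; rewrite !rmorph1 [1 in LHS]/GRing.one /= tliftE; last by lin.
by rewrite mulr1 scale1r.
Qed.

(** [S] reverses products, so it turns the hypothesis on [g] into: [S o g] is a left
    inverse of [S o f] for the convolution. The coalgebra morphism [f] is a right
    inverse of [S o f]. *)
Lemma antipode_skew (C : falgType F) (HC : bialgebra C) (f g : C -> A) :
  linear f -> linear g ->
  (forall c, comul H (f c) = tmap f f (comul HC c)) ->
  (forall c, counit H (f c) = counit HC c) ->
  (forall c, tlift (fun x y => f y * g x) (comul HC c) = (counit HC c : F)%:A) ->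
  forall c, S (g c) = f c.
Proof.
move=> lf lg mf ef fg.
apply: (conv_inv_uniq (HC := HC) (g := fun c => S (f c))).
- by lin.
- by lin.
- by [].
- move=> c; transitivity (S (tlift (fun x y => f y * g x) (comul HC c))).
    by rewrite tlift_comp; [apply: eq_tlift => x y; rewrite antipodeM|lin].
  by rewrite fg linearZ /= antipode1.
move=> c; rewrite -ef -antipodel mf tlift_tmap //.
by lin.
Qed.
End Antipode.

(** * Subspaces of tensor products, slices *)

Section TensorSubspaces.
Variable F : fieldType.
Implicit Types U V W : vectType F.

Lemma tensv_mem U V W (X : {vspace U}) (Y : {vspace V}) (Z : {vspace W})
    (f : tens U V -> W) : linear f ->
  {in X & Y, forall x y, f (x \ox y) \in Z} -> {in tensv X Y, forall t, f t \in Z}.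
Proof.
move=> lf fXY t tXY; rewrite (coord_span (X := in_tuple _) tXY) (linear_sumZ lf).
apply: rpred_sum => i _; rewrite rpredZ //.
have /allpairsP[[x y] /= [xX yY ->]] := mem_nth 0 (ltn_ord i).
by apply: fXY; apply: vbasis_mem.
Qed.

Lemma tensv_ext U V W (X : {vspace U}) (Y : {vspace V}) (f g : tens U V -> W) :
  linear f -> linear g ->
  {in X & Y, forall x y, f (x \ox y) = g (x \ox y)} -> {in tensv X Y, f =1 g}.
Proof.
move=> lf lg e t tXY; apply/eqP; rewrite -subr_eq0 -memv0.
apply: (tensv_mem (f := fun t => f t - g t) _ _ tXY) => [c x y|x y xX yY].
  by rewrite lf lg scalerBr opprD addrACA.
by rewrite memv0 e ?subrr.
Qed.

Lemma tensv_sub U V (X : {vspace U}) (Y : {vspace V}) (Z : {vspace tens U V}) :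
  {in X & Y, forall x y, x \ox y \in Z} -> (tensv X Y <= Z)%VS.
Proof. by move=> XYZ; apply/subvP; apply: (tensv_mem (f := id)). Qed.

Lemma tensvS U V (X X' : {vspace U}) (Y Y' : {vspace V}) :
  (X <= X')%VS -> (Y <= Y')%VS -> (tensv X Y <= tensv X' Y')%VS.
Proof.
move=> /subvP XX' /subvP YY'; apply: tensv_sub => x y /XX' xX /YY' yY.
exact: memv_tensv.
Qed.

Lemma tensv_full U V (t : tens U V) : t \in tensv fullv fullv.
Proof.
rewrite -[t]tens_sum; apply: rpred_sum => i _; apply: rpred_sum => j _.
by rewrite rpredZ // memv_tensv ?memvf.
Qed.

Lemma memv_tmap U V U' V' (f : U -> U') (g : V -> V') (X : {vspace U})
    (Y : {vspace V}) (X' : {vspace U'}) (Y' : {vspace V'}) t :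
  linear f -> linear g -> {in X, forall x, f x \in X'} ->
  {in Y, forall y, g y \in Y'} -> t \in tensv X Y -> tmap f g t \in tensv X' Y'.
Proof.
move=> lf lg fX gY; apply: (tensv_mem (f := tmap f g)); first by lin.
by move=> x y xX yY; rewrite tmapE //; apply: memv_tensv; [apply: fX|apply: gY].
Qed.

Lemma memv_tswap U V (X : {vspace U}) (Y : {vspace V}) t :
  t \in tensv X Y -> tswap t \in tensv Y X.
Proof.
apply: (tensv_mem (f := @tswap _ _ _)); first by lin.
by move=> x y xX yY; rewrite tswapE memv_tensv.
Qed.

Lemma tmap_projv U V (X : {vspace U}) (Y : {vspace V}) t :
  t \in tensv X Y -> tmap (projv X) (projv Y) t = t.
Proof.
apply: (tensv_ext (f := tmap (projv X) (projv Y)) (g := id)); [by lin|by lin|].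
move=> x y xX yY; rewrite tmapE; [|by lin|by lin].
by rewrite !projv_id.
Qed.

(** Apply the projection onto [X] to the first leg: it fixes [t] and keeps the second
    leg in [Y]. *)
Lemma tensv_cap U V (X : {vspace U}) (Y : {vspace V}) t :
  t \in tensv X fullv -> t \in tensv fullv Y -> t \in tensv X Y.
Proof.
move=> tX tY; rewrite -(tmap_projv tX).
apply: (memv_tmap _ _ _ _ tY) => [||x _|y yY]; [lin|lin|exact: memv_proj|].
by rewrite projv_id ?memvf.
Qed.

Lemma tmap_vsval_inj U V (X : {vspace U}) (Y : {vspace V}) :
  injective (tmap (@vsval _ _ X) (@vsval _ _ Y)).
Proof.
apply: (can_inj (g := tmap (vsproj X) (vsproj Y))) => t.
rewrite tmap_comp; [|lin|lin].
by rewrite -[RHS]tmap_id; apply: eq_tmap => x; rewrite vsvalK.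
Qed.

Lemma tmap_vsvalK U V (X : {vspace U}) (Y : {vspace V}) t : t \in tensv X Y ->
  tmap vsval vsval (tmap (vsproj X) (vsproj Y) t) = t.
Proof.
move: t; apply: (tensv_ext (g := id)); [lin|lin|] => x y xX yY.
by rewrite tmapE ?tmapE ?vsprojK //; lin.
Qed.

Lemma dim_tens U V : \dim {:tens U V} = (\dim {:U} * \dim {:V})%N.
Proof. by rewrite [LHS]dimvf; exact: dim_matrix. Qed.

Lemma dim_tensv U V (X : {vspace U}) (Y : {vspace V}) :
  \dim (tensv X Y) = (\dim X * \dim Y)%N.
Proof.
pose f := tmap (@vsval _ _ X) (@vsval _ _ Y).
have fE t : linfun f t = f t by rewrite lfunE.
have -> : tensv X Y = limg (linfun f).
  apply: subv_anti; apply/andP; split.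
    apply/subvP => t tXY; rewrite -(tmap_vsvalK tXY) -/f -fE.
    exact: memv_img (memvf _).
  apply/subvP => _ /memv_imgP[t _ ->]; rewrite fE.
  by apply: (memv_tmap _ _ _ _ (tensv_full t)) => [||x _|y _];
    [lin|lin|apply: subvsP|apply: subvsP].
rewrite limg_dim_eq; last first.
  apply/eqP; rewrite capfv; apply/lker0P => s t; rewrite !fE; exact: tmap_vsval_inj.
by rewrite dim_tens !dimvf.
Qed.
End TensorSubspaces.

Section TensorAlgebraSubspaces.
Variable F : fieldType.
Implicit Types A B : falgType F.

Lemma tensvM A B (X X' : {vspace A}) (Y Y' : {vspace B}) s t :
  s \in tensv X Y -> t \in tensv X' Y' -> s * t \in tensv (X * X') (Y * Y').
Proof.
move=> sXY tXY; move: s sXY.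
apply: (tensv_mem (f := fun s => s * t)) => [|x y xX yY]; first by lin.
move: t tXY; apply: (tensv_mem (f := fun t => (x \ox y) * t)) => [|x' y' xX' yY'].
  by lin.
by rewrite pureM memv_tensv // memv_mul.
Qed.

Lemma subalgebraP A (U : {vspace A}) :
  reflect (1 \in U /\ {in U &, forall x y, x * y \in U}) (subalgebra U).
Proof.
by apply: (iffP andP) => -[U1 /prodvP UU].
Qed.

Lemma subalgebra_tensv A B (X : {vspace A}) (Y : {vspace B}) :
  subalgebra X -> subalgebra Y -> subalgebra (tensv X Y).
Proof.
move=> /andP[X1 XX] /andP[Y1 YY]; apply/subalgebraP; split=> [|s t sXY tXY].
  exact: memv_tensv.
exact: (subvP (tensvS XX YY)) (tensvM sXY tXY).
Qed.

(** Multiplication by [y] on the left is injective, hence surjective. *)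
Lemma mulr1_unit A (x y : A) : x * y = 1 -> x \is a GRing.unit /\ y * x = 1.
Proof.
move=> xy1; suff yx1 : y * x = 1 by split => //; apply/unitrP; exists y.
have inj : lker (amull y) = 0%VS.
  apply/eqP/lker0P => u v; rewrite !lfunE /= => e.
  by rewrite -[u]mul1r -xy1 -mulrA e mulrA xy1 mul1r.
have /memv_imgP[z _] : 1 \in limg (amull y).
  by rewrite lker0_limgf ?memvf ?inj.
rewrite lfunE /= => yz1.
by rewrite [RHS]yz1 -[z]mul1r -[in RHS]xy1 -[in RHS]mulrA -yz1 mulr1.
Qed.

(** Multiplication by [x] maps [U] injectively to itself, hence reaches [1]. *)
Lemma subalgebra_inv A (U : {vspace A}) x : subalgebra U -> x \in U ->
  x \is a GRing.unit -> x^-1 \in U.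
Proof.
move=> /subalgebraP[U1 UU] xU ux.
have /eqP xUU : (amull x @: U == U)%VS.
  rewrite eqEdim limg_dim_eq.
    rewrite leqnn andbT; apply/subvP => _ /memv_imgP[y yU ->].
    by rewrite lfunE /= UU.
  by apply/eqP; rewrite -subv0 (eqP (lker0_amull ux)) capv0.
have /memv_imgP[z zU] : 1 \in (amull x @: U)%VS by rewrite xUU.
by rewrite lfunE /= => xz1; rewrite -[x^-1]mulr1 xz1 mulKr.
Qed.
End TensorAlgebraSubspaces.

Section Slices.
Variables (F : fieldType) (A : falgType F) (H : bialgebra A).
Local Notation B := (dual H).

Lemma pairing_scale c a (b : B) : pairing (c *: a) b = c * pairing a b.
Proof. exact: (linZ (@lin_pairl _ _ _ b)). Qed.

(** Through [slice], the algebra [U (x) A^*] is the algebra of linear maps from [A] to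
    [U] with the convolution product; the canonical tensor is the identity map. *)
Lemma slice_mul (U : falgType F) a (s t : tens U B) :
  slice a (s * t) = tlift (fun x y => slice x s * slice y t) (comul H a).
Proof.
move: s; apply: tens_ext => [||u b]; [lin|lin|].
move: t; apply: tens_ext => [||v c]; [lin|lin|].
rewrite pureM sliceE pairingM.
rewrite (tlift_comp (L := fun k : F^o => (k : F) *: (u * v))); last by lin.
by apply: eq_tlift => x y; rewrite !sliceE -scalerAl -scalerAr scalerA.
Qed.

Lemma slice1 (U : falgType F) a : slice a (1 : tens U B) = (counit H a : F)%:A.
Proof. by rewrite [LHS]sliceE pairing1. Qed.

Lemma slice_canon a : slice a (canonical_tensor H) = a.
Proof.
rewrite /canonical_tensor (linear_sumE (slice_linear _)) [RHS]crd_bas.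
by apply: eq_bigr => i _; rewrite sliceE dual_basE.
Qed.

Lemma slice_tmap (U V : vectType F) (f : U -> V) a (t : tens U B) : linear f ->
  slice a (tmap f id t) = f (slice a t).
Proof.
move=> lf; move: t; apply: tens_ext => [||u b]; [lin|lin|].
by rewrite tmapE ?sliceE ?(linZ lf) //; lin.
Qed.

Lemma slice_tmapr (U : vectType F) (g : B -> B) (P : A -> A) a (t : tens U B) :
  linear g -> linear P -> (forall x b, pairing x (g b) = pairing (P x) b) ->
  slice a (tmap id g t) = slice (P a) t.
Proof.
move=> lg lP gP; move: t; apply: tens_ext => [||u b]; [lin|lin|].
by rewrite tmapE // !sliceE gP.
Qed.

(** The analogue of [slice] for the other leg, paired with an element of the dual. *)
Definition coslice (W : vectType F) (b : B) (t : tens A W) : W :=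
  tlift (fun a w => (pairing a b : F) *: w) t.

Lemma lin_coslice (W : vectType F) b : linear (@coslice W b).
Proof. exact: lin_lift. Qed.

Lemma coslice_pure (W : vectType F) b a (w : W) : coslice b (a \ox w) = (pairing a b : F) *: w.
Proof. by rewrite /coslice tliftE //; lin. Qed.

Lemma coslice_ext (W : vectType F) (s t : tens A W) :
  (forall b, coslice b s = coslice b t) -> s = t.
Proof.
have rec : forall r : tens A W, \sum_i bas i \ox coslice (dual_bas H i) r = r.
  apply: tens_ext => [||a w]; [|lin|].
    move=> c x y; rewrite scaler_sumr -big_split; apply: eq_bigr => i _.
    by rewrite lin_coslice pureDr.
  rewrite [in RHS](crd_bas a) (linear_sumZ (lin_purel w)).
  by apply: eq_bigr => i _; rewrite coslice_pure dual_basE pureZr.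
by move=> e; rewrite -(rec s) -(rec t); apply: eq_bigr => i _; rewrite e.
Qed.

Lemma pairing_mul a a' (b : B) : pairing (a * a') b =
  tlift (fun b1 b2 => pairing a' b1 * pairing a b2 : F^o) (comul (dual_cop H) b).
Proof.
rewrite dual_comul_lfunE -dual_comulE /slice tlift_comp; last by lin.
by apply: eq_tlift => b1 b2; rewrite pairingZ mulrC.
Qed.

Lemma counit_dual (b : B) : counit (dual_cop H) b = pairing 1 b.
Proof. exact: lfunE. Qed.
End Slices.

(** * Placing a tensor in the legs of a triple tensor product *)

Section Placement.
Variable F : fieldType.
Implicit Types D W E V : falgType F.

(** A predicate on bare functions, so that composites and placements of morphisms need
    not be repackaged. *)
Record alg_morph D W (l : D -> W) : Prop := AlgMorph {
  alg_lin : linear l;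
  algM : {morph l : x y / x * y};
  alg1 : l 1 = 1 }.

Lemma ahom_alg D W (l : 'AHom(D, W)) : alg_morph l.
Proof. by split; [exact: lin_lfun|exact: rmorphM|exact: rmorph1]. Qed.

Lemma alg_morph_comp D W V (l : D -> W) (k : V -> D) :
  alg_morph l -> alg_morph k -> alg_morph (fun x => l (k x)).
Proof.
move=> [ll lM l1] [kl kM k1]; split=> [|x y|]; last by rewrite k1.
  exact: lin_comp.
by rewrite kM lM.
Qed.

Lemma alg_morph_id D : alg_morph (fun x : D => x). Proof. by []. Qed.

Lemma alg_morph_tmap D W D' W' (f : D -> W) (g : D' -> W') :
  alg_morph f -> alg_morph g -> alg_morph (tmap f g).
Proof.
move=> [fl fM f1] [gl gM g1]; split; [exact: lin_lift|exact: tmapM|exact: tmap1].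
Qed.

Definition commuting D D' W (l : D -> W) (l' : D' -> W) :=
  forall x y, l x * l' y = l' y * l x.

(** For [l] and [l'] the inclusions of the legs [i] and [j], this is the usual
    [t^(i,j)]. Taking for [l] the map [place l1 l2 o comul] gives
    [(comul (x) id) t] in the legs attached to [l1], [l2], [l']. *)
Definition place D D' W (l : D -> W) (l' : D' -> W) (t : tens D D') : W :=
  tlift (fun a b => l a * l' b) t.

Lemma lin_place D D' W (l : D -> W) (l' : D' -> W) : linear (place l l').
Proof. exact: lin_lift. Qed.

Lemma placeE D D' W (l : D -> W) (l' : D' -> W) a b : linear l -> linear l' ->
  place l l' (a \ox b) = l a * l' b.
Proof. by move=> ll ll'; rewrite /place tliftE //; lin. Qed.

Lemma alg_morph_place D D' W (l : D -> W) (l' : D' -> W) :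
  alg_morph l -> alg_morph l' -> commuting l l' -> alg_morph (place l l').
Proof.
move=> [ll lM l1] [ll' lM' l1'] cll'; split; first exact: lin_lift.
- move=> s t; have lP := @lin_place _ _ _ l l'.
  move: s; apply: tens_ext => [||a b]; [lin|lin|].
  move: t; apply: tens_ext => [||c d]; [lin|lin|].
  by rewrite pureM !placeE // lM lM' !mulrA -(mulrA (l a) (l c)) cll' !mulrA.
- by rewrite [LHS]placeE // l1 l1' mulr1.
Qed.

Lemma commuting_sym D D' W (l : D -> W) (l' : D' -> W) :
  commuting l l' -> commuting l' l.
Proof. by move=> c x y; rewrite c. Qed.

Lemma commuting_comp D D' D'' W (l : D -> W) (l' : D' -> W) (k : D'' -> D) :
  commuting l l' -> commuting (fun x => l (k x)) l'.
Proof. by move=> c x y; rewrite c. Qed.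

Lemma commuting_place D D' D'' W (l : D -> W) (l' : D' -> W) (l'' : D'' -> W) :
  commuting l l'' -> commuting l' l'' -> commuting (place l l') l''.
Proof.
move=> c c' t z; rewrite /place (tlift_comp (L := fun x => x * l'' z)); last by lin.
rewrite (tlift_comp (L := fun x => l'' z * x)); last by lin.
by apply: eq_tlift => a b; rewrite -mulrA c' mulrA c mulrA.
Qed.

Lemma place_swap D D' W (l : D -> W) (l' : D' -> W) t : linear l -> linear l' ->
  commuting l l' -> place l l' (tswap t) = place l' l t.
Proof.
move=> ll ll' c; rewrite /place /tswap tlift_comp; last by lin.
by apply: eq_tlift => a b; rewrite -[LHS]/(place l l' _) placeE // c.
Qed.

Lemma eq_place D D' W (l k : D -> W) (l' k' : D' -> W) t : l =1 k -> l' =1 k' ->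
  place l l' t = place k k' t.
Proof. by move=> e e'; apply: eq_tlift => a b; rewrite e e'. Qed.

Lemma place_comp D D' W V (m : W -> V) (l : D -> W) (l' : D' -> W) t :
  linear m -> {morph m : x y / x * y} ->
  m (place l l' t) = place (fun x => m (l x)) (fun x => m (l' x)) t.
Proof. by move=> lm mM; rewrite /place tlift_comp //; apply: eq_tlift => a b. Qed.

End Placement.

Section Legs.
Variables (F : fieldType) (D : falgType F).
Local Notation W0 := (tens (tens D D) D).

Definition in1 (a : D) : W0 := (a \ox 1) \ox 1.
Definition in2 (a : D) : W0 := (1 \ox a) \ox 1.
Definition in3 (a : D) : W0 := 1 \ox a.

Lemma in1_alg : alg_morph in1.
Proof. by split=> [|a b|//]; rewrite /in1; [lin|rewrite !pureM !mulr1]. Qed.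
Lemma in2_alg : alg_morph in2.
Proof. by split=> [|a b|//]; rewrite /in2; [lin|rewrite !pureM !mulr1]. Qed.
Lemma in3_alg : alg_morph in3.
Proof. by split=> [|a b|//]; rewrite /in3; [lin|rewrite !pureM !mulr1]. Qed.

Lemma in12 : commuting in1 in2.
Proof. by move=> a b; rewrite /in1 /in2 !pureM !mulr1 !mul1r. Qed.
Lemma in13 : commuting in1 in3.
Proof. by move=> a b; rewrite /in1 /in3 !pureM !mulr1 !mul1r. Qed.
Lemma in23 : commuting in2 in3.
Proof. by move=> a b; rewrite /in2 /in3 !pureM !mulr1 !mul1r. Qed.

Variables (W : falgType F) (l1 l2 l3 : D -> W).
Hypotheses (a1 : alg_morph l1) (a2 : alg_morph l2) (a3 : alg_morph l3).
Hypotheses (c12 : commuting l1 l2) (c13 : commuting l1 l3) (c23 : commuting l2 l3).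

(** The algebra morphism out of the third tensor power defined by three
    commuting morphisms: it turns an identity between legs into one that holds
    for every choice, hence for every ordering, of the legs. *)
Definition place3 : W0 -> W := place (place l1 l2) l3.

Lemma place3_alg : alg_morph place3.
Proof.
by apply: alg_morph_place => //; [exact: alg_morph_place|exact: commuting_place].
Qed.

Lemma place3_in1 a : place3 (in1 a) = l1 a.
Proof.
rewrite /place3 /in1 placeE ?(alg1 a3) ?mulr1; [|exact: lin_lift|exact: alg_lin].
by rewrite placeE ?(alg1 a2) ?mulr1 //; exact: alg_lin.
Qed.

Lemma place3_in2 a : place3 (in2 a) = l2 a.
Proof.
rewrite /place3 /in2 placeE ?(alg1 a3) ?mulr1; [|exact: lin_lift|exact: alg_lin].
by rewrite placeE ?(alg1 a1) ?mul1r //; exact: alg_lin.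
Qed.

Lemma place3_in3 a : place3 (in3 a) = l3 a.
Proof.
rewrite /place3 /in3 placeE; [|exact: lin_lift|exact: alg_lin].
by rewrite (alg1 (alg_morph_place a1 a2 c12)) mul1r.
Qed.

Lemma place3_12 t : place3 (place in1 in2 t) = place l1 l2 t.
Proof.
rewrite (place_comp _ _ _ (alg_lin place3_alg) (algM place3_alg)).
exact: eq_place place3_in1 place3_in2.
Qed.
Lemma place3_13 t : place3 (place in1 in3 t) = place l1 l3 t.
Proof.
rewrite (place_comp _ _ _ (alg_lin place3_alg) (algM place3_alg)).
exact: eq_place place3_in1 place3_in3.
Qed.
Lemma place3_23 t : place3 (place in2 in3 t) = place l2 l3 t.
Proof.
rewrite (place_comp _ _ _ (alg_lin place3_alg) (algM place3_alg)).
exact: eq_place place3_in2 place3_in3.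
Qed.
End Legs.

Section LegsE.
Variables (F : fieldType) (D : falgType F) (H : bialgebra D).
Local Notation in1 := (@in1 F D).
Local Notation in2 := (@in2 F D).
Local Notation in3 := (@in3 F D).
Implicit Type t : tens D D.

Lemma place_in12 t : place in1 in2 t = t \ox 1.
Proof.
move: t; apply: tens_ext => [||a b]; [exact: lin_lift|lin|].
rewrite placeE; [|exact: alg_lin (in1_alg _)|exact: alg_lin (in2_alg _)].
by rewrite /in1 /in2 !pureM !mulr1 mul1r.
Qed.

Lemma leg12E t : leg12 t = place in1 in2 t.
Proof. by rewrite place_in12. Qed.

Lemma leg13E t : leg13 t = place in1 in3 t.
Proof. by apply: eq_tlift => a b; rewrite /in1 /in3 !pureM !mulr1 mul1r. Qed.

Lemma leg23E t : leg23 t = place in2 in3 t.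
Proof. by apply: eq_tlift => a b; rewrite /in2 /in3 !pureM !mulr1 mul1r. Qed.

Lemma comul_idE t : comul_id H t = place (fun x => place in1 in2 (comul H x)) in3 t.
Proof.
apply: eq_tlift => a b; rewrite place_in12 /in3 pureM mul1r.
by rewrite mulr1.
Qed.

Lemma id_comulE t : id_comul H t = place in1 (fun x => place in2 in3 (comul H x)) t.
Proof.
rewrite /id_comul /tmap tlift_comp; last by lin.
apply: eq_tlift => a b; rewrite tassocE /place.
rewrite (tlift_comp (L := fun x => in1 a * x)); last by lin.
by apply: eq_tlift => x y; rewrite /in1 /in2 /in3 !pureM !mulr1 !mul1r.
Qed.

End LegsE.

(** * Twisting a quasitriangular Hopf algebra by a cocycle *)

Lemma alg_morph_conj (F : fieldType) (D W : falgType F) (l : D -> W) (u : W) :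
  alg_morph l -> u \is a GRing.unit -> alg_morph (fun x => u * l x * u^-1).
Proof.
move=> [ll lM l1] uu; split=> [|x y|]; first by lin.
  by rewrite lM !mulrA mulrVK.
by rewrite l1 mulr1 divrr.
Qed.

Section AlgUnit.
Variables (F : fieldType) (D W : falgType F) (l : D -> W) (x : D).
Hypotheses (la : alg_morph l) (ux : x \is a GRing.unit).

Lemma alg_unitr : l x * l x^-1 = 1.
Proof. by rewrite -(algM la) divrr // (alg1 la). Qed.

Lemma alg_unitl : l x^-1 * l x = 1.
Proof. by rewrite -(algM la) mulVr // (alg1 la). Qed.
End AlgUnit.

Section AhomOf.
Variables (F : fieldType).

Lemma linfunE (U V : vectType F) (f : U -> V) : linear f -> linfun f =1 f.
Proof.
move=> lf x; pose g : {linear U -> V} := HB.pack f (GRing.isLinear.Build F U V *:%R f lf).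
exact: (lfunE g).
Qed.

Variables (D W : falgType F) (l : D -> W) (la : alg_morph l).

Fact ahom_of_subproof : ahom_in fullv (linfun l).
Proof.
have [ll lM l1] := la.
by apply/ahom_inP; split=> [x y _ _|]; rewrite !linfunE.
Qed.
Definition ahom_of : 'AHom(D, W) := AHom ahom_of_subproof.

Lemma ahom_ofE : ahom_of =1 l.
Proof. by move=> x; rewrite linfunE //; exact: alg_lin la. Qed.
End AhomOf.

Section Twist.
Variables (F : fieldType) (D : falgType F) (H : hopf D).
Variables (R J : tens D D).
Hypothesis R_qt : quasitriangular H R.
Hypotheses (J_unit : J \is a GRing.unit) (J_cocycle : is_cocycle H J).
Hypothesis J_counitl : place (fun a => (counit H a : F)%:A) id J = (1 : D).
Hypothesis J_counitr : place id (fun a => (counit H a : F)%:A) J = (1 : D).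
Local Notation S := (antipode H).
Local Notation comul := (comul H).

Let aS : alg_morph comul := ahom_alg comul.

Lemma scalar_counit_alg : alg_morph (fun a => (counit H a : F)%:A : D).
Proof.
split=> [|a b|]; first by lin.
  by rewrite rmorphM /= mulr_algl scalerA.
by rewrite rmorph1 scale1r.
Qed.

Lemma commuting_scalar (l : D -> D) :
  commuting (fun a => (counit H a : F)%:A) l.
Proof. by move=> x y; rewrite mulr_algl mulr_algr. Qed.

(** The cocycle identity is used for several orders of the legs, so it is transported
    to an arbitrary algebra with three commuting copies [l1], [l2], [l3] of [D]. *)
Section Triple.
Variables (W : falgType F) (l1 l2 l3 : D -> W).
Hypotheses (a1 : alg_morph l1) (a2 : alg_morph l2) (a3 : alg_morph l3).
Hypotheses (c12 : commuting l1 l2) (c13 : commuting l1 l3) (c23 : commuting l2 l3).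
Local Notation pl1 := (place l1 (fun x => place l2 l3 (comul x))).
Local Notation pl3 := (place (fun x => place l1 l2 (comul x)) l3).

Lemma alg12 : alg_morph (fun x => place l1 l2 (comul x)).
Proof. exact/alg_morph_comp/aS/alg_morph_place. Qed.

Lemma alg23 : alg_morph (fun x => place l2 l3 (comul x)).
Proof. exact/alg_morph_comp/aS/alg_morph_place. Qed.

Lemma comm12_3 : commuting (fun x => place l1 l2 (comul x)) l3.
Proof. exact/commuting_comp/commuting_place. Qed.

Lemma comm1_23 : commuting l1 (fun x => place l2 l3 (comul x)).
Proof.
apply/commuting_sym/commuting_comp/commuting_place; exact/commuting_sym.
Qed.

Lemma pl3_alg : alg_morph pl3.
Proof. exact: alg_morph_place alg12 a3 comm12_3. Qed.

Lemma pl1_alg : alg_morph pl1.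
Proof. exact: alg_morph_place a1 alg23 comm1_23. Qed.

Lemma place3_comul_id t : place3 l1 l2 l3 (comul_id H t) = pl3 t.
Proof.
have p3 := place3_alg a1 a2 a3 c12 c13 c23.
rewrite comul_idE (place_comp _ _ _ (alg_lin p3) (algM p3)).
by apply: eq_place => x; [exact: place3_12|exact: place3_in3].
Qed.

Lemma place3_id_comul t : place3 l1 l2 l3 (id_comul H t) = pl1 t.
Proof.
have p3 := place3_alg a1 a2 a3 c12 c13 c23.
rewrite id_comulE (place_comp _ _ _ (alg_lin p3) (algM p3)).
by apply: eq_place => x; [exact: place3_in1|exact: place3_23].
Qed.

Lemma coassoc_place x : place (fun x => place l1 l2 (comul x)) l3 (comul x) = pl1 (comul x).
Proof.
by rewrite -place3_comul_id -place3_id_comul /comul_id /id_comul comulA.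
Qed.

Lemma cocycle_place : place l1 l2 J * pl3 J = place l2 l3 J * pl1 J.
Proof.
have p3 := place3_alg a1 a2 a3 c12 c13 c23.
have := congr1 (place3 l1 l2 l3) J_cocycle; rewrite !(algM p3).
by rewrite place3_comul_id place3_id_comul leg12E leg23E place3_12 // place3_23.
Qed.

(** The two sides are inverse to the two sides of the cocycle identity. *)
Lemma cocycle_placeV : pl3 J^-1 * place l1 l2 J^-1 = pl1 J^-1 * place l2 l3 J^-1.
Proof.
have p12 := alg_morph_place a1 a2 c12; have p23 := alg_morph_place a2 a3 c23.
have X : (pl3 J^-1 * place l1 l2 J^-1) * (place l1 l2 J * pl3 J) = 1.
  rewrite mulrA -(mulrA (pl3 _)) (alg_unitl p12) // mulr1.
  exact: (alg_unitl pl3_alg).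
have Y : (place l2 l3 J * pl1 J) * (pl1 J^-1 * place l2 l3 J^-1) = 1.
  rewrite mulrA -(mulrA (place l2 l3 J)) (alg_unitr pl1_alg) // mulr1.
  exact: (alg_unitr p23).
rewrite -[LHS]mulr1 -Y mulrA -[in RHS](mul1r (pl1 _)) -cocycle_place.
by rewrite X !mul1r.
Qed.

Lemma twist_coassoc x :
  place l1 l2 J * pl3 (J * comul x * J^-1) * place l1 l2 J^-1 =
  place l2 l3 J * pl1 (J * comul x * J^-1) * place l2 l3 J^-1.
Proof.
have ac := pl3_alg; have ai := pl1_alg.
rewrite !(algM ac) !(algM ai) coassoc_place !mulrA cocycle_place -!mulrA.
by rewrite cocycle_placeV.
Qed.

Lemma Rmatrix_place x : place l1 l2 R * place l1 l2 (comul x) =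
  place l2 l1 (comul x) * place l1 l2 R.
Proof.
have p12 := alg_morph_place a1 a2 c12; have [_ RD _ _] := R_qt.
rewrite -(algM p12) RD (algM p12) place_swap //; exact: alg_lin.
Qed.

(** [R^(1,2)] intertwines the coproduct and its opposite in the first two legs and
    commutes with the third one. *)
Lemma Rmatrix_place3 t : place l1 l2 R * pl3 t =
  place (fun x => place l2 l1 (comul x)) l3 t * place l1 l2 R.
Proof.
move: t; apply: tens_ext => [||a b].
- have ? := lin_place (fun x => place l1 l2 (comul x)) l3; lin.
- have ? := lin_place (fun x => place l2 l1 (comul x)) l3; lin.
have ll : linear (fun x => place l2 l1 (comul x)).
  by apply: lin_comp; [exact: lin_place|lin].
have [l3l l12l] := (alg_lin a3, alg_lin alg12).
rewrite !placeE //.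
have p12 := commuting_place c13 c23.
by rewrite mulrA Rmatrix_place -!mulrA -p12.
Qed.

Lemma Rmatrix_place1 t : place l2 l3 R * pl1 t =
  place l1 (fun x => place l3 l2 (comul x)) t * place l2 l3 R.
Proof.
have [_ RD _ _] := R_qt; have p23 := alg_morph_place a2 a3 c23.
have R23 x : place l2 l3 R * place l2 l3 (comul x) =
    place l3 l2 (comul x) * place l2 l3 R.
  by rewrite -(algM p23) RD (algM p23) place_swap //; exact: alg_lin.
move: t; apply: tens_ext => [||a b].
- have ? := lin_place l1 (fun x => place l2 l3 (comul x)); lin.
- have ? := lin_place l1 (fun x => place l3 l2 (comul x)); lin.
have ll : linear (fun x => place l3 l2 (comul x)).
  by apply: lin_comp; [exact: lin_place|lin].
have [l1l l23l] := (alg_lin a1, alg_lin alg23).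
rewrite !placeE //.
have p12 := commuting_place (commuting_sym c12) (commuting_sym c13).
by rewrite mulrA p12 -!mulrA R23.
Qed.
End Triple.

Definition twist_Rmatrix : tens D D := tswap J * R * J^-1.

Lemma twist_Rmatrix_place (W : falgType F) (l1 l2 : D -> W) :
  alg_morph l1 -> alg_morph l2 -> commuting l1 l2 ->
  place l1 l2 twist_Rmatrix = place l2 l1 J * place l1 l2 R * place l1 l2 J^-1.
Proof.
move=> a1 a2 c12; have p12 := alg_morph_place a1 a2 c12.
by rewrite /twist_Rmatrix !(algM p12) place_swap //; exact: alg_lin.
Qed.

Section TripleR.
Variables (W : falgType F) (l1 l2 l3 : D -> W).
Hypotheses (a1 : alg_morph l1) (a2 : alg_morph l2) (a3 : alg_morph l3).
Hypotheses (c12 : commuting l1 l2) (c13 : commuting l1 l3) (c23 : commuting l2 l3).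
Let c21 := commuting_sym c12.
Let c31 := commuting_sym c13.
Let c32 := commuting_sym c23.
Local Notation pl1 := (place l1 (fun x => place l2 l3 (comul x))).
Local Notation pl3 := (place (fun x => place l1 l2 (comul x)) l3).

Lemma R_pl3 : pl3 R = place l1 l3 R * place l2 l3 R.
Proof.
have p3 := place3_alg a1 a2 a3 c12 c13 c23; have [_ _ Rc _] := R_qt.
by rewrite -place3_comul_id // Rc (algM p3) leg13E leg23E place3_13 // place3_23.
Qed.

Lemma R_pl1 : pl1 R = place l1 l3 R * place l1 l2 R.
Proof.
have p3 := place3_alg a1 a2 a3 c12 c13 c23; have [_ _ _ Rc] := R_qt.
by rewrite -place3_id_comul // Rc (algM p3) leg13E leg12E place3_13 // place3_12.
Qed.

(** Moving the two factors of [R] past the inverse cocycle permutes its legs;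
    each permuted copy is then absorbed by the cocycle identity for that order of
    the legs. *)
Lemma twist_R_pl3 :
  place l1 l2 J * pl3 twist_Rmatrix * place l1 l2 J^-1 =
  place l1 l3 twist_Rmatrix * place l2 l3 twist_Rmatrix.
Proof.
have [l1l l2l l3l] := And3 (alg_lin a1) (alg_lin a2) (alg_lin a3).
have p13 := alg_morph_place a1 a3 c13; have p23 := alg_morph_place a2 a3 c23.
have p32 := alg_morph_place a3 a2 c32.
have ac := pl3_alg a1 a2 a3 c12 c13 c23.
have a312 := pl3_alg a3 a1 a2 c31 c32 c12.
have e1 : place l1 (fun x => place l3 l2 (comul x)) J^-1 =
    place (fun x => place l1 l3 (comul x)) l2 J^-1 * place l1 l3 J^-1 * place l3 l2 J.
  by rewrite cocycle_placeV // -mulrA (alg_unitl p32) // mulr1.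
have e2 : place l1 l2 J * place l3 (fun x => place l1 l2 (comul x)) J *
    place (fun x => place l3 l1 (comul x)) l2 J^-1 = place l3 l1 J.
  by rewrite -cocycle_place // -mulrA (alg_unitr a312) // mulr1.
rewrite [X in _ = X * _]twist_Rmatrix_place // [X in _ = _ * X]twist_Rmatrix_place //.
rewrite /twist_Rmatrix.
have l12l := alg_lin (alg12 a1 a2 c12).
rewrite !(algM ac) place_swap //; last exact: comm12_3.
rewrite R_pl3 -!mulrA cocycle_placeV // (mulrA (place l2 l3 R)).
rewrite Rmatrix_place1 // e1 -!mulrA (mulrA (place l1 l3 R)).
rewrite Rmatrix_place3 // -e2 !mulrA.
by [].
Qed.

Lemma twist_R_pl1 :
  place l2 l3 J * pl1 twist_Rmatrix * place l2 l3 J^-1 =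
  place l1 l3 twist_Rmatrix * place l1 l2 twist_Rmatrix.
Proof.
have [l1l l2l l3l] := And3 (alg_lin a1) (alg_lin a2) (alg_lin a3).
have p21 := alg_morph_place a2 a1 c21.
have ai := pl1_alg a1 a2 a3 c12 c13 c23.
have a231 := pl1_alg a2 a3 a1 c23 c21 c31.
have e1 : place (fun x => place l2 l1 (comul x)) l3 J^-1 =
    place l2 (fun x => place l1 l3 (comul x)) J^-1 * place l1 l3 J^-1 * place l2 l1 J.
  by rewrite -cocycle_placeV // -mulrA (alg_unitl p21) // mulr1.
have e2 : place l2 l3 J * place (fun x => place l2 l3 (comul x)) l1 J *
    place l2 (fun x => place l3 l1 (comul x)) J^-1 = place l3 l1 J.
  by rewrite cocycle_place // -mulrA (alg_unitr a231) // mulr1.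
rewrite [X in _ = X * _]twist_Rmatrix_place // [X in _ = _ * X]twist_Rmatrix_place //.
rewrite /twist_Rmatrix.
have l23l := alg_lin (alg23 a2 a3 c23).
rewrite !(algM ai) place_swap //; last exact: comm1_23.
rewrite R_pl1 -!mulrA -cocycle_placeV // (mulrA (place l1 l2 R)).
rewrite Rmatrix_place3 // e1 -!mulrA (mulrA (place l1 l3 R)).
rewrite Rmatrix_place1 // -e2 !mulrA.
by [].
Qed.
End TripleR.

Local Notation in1 := (@in1 F D).
Local Notation in2 := (@in2 F D).
Local Notation in3 := (@in3 F D).
Let a1 := in1_alg D.
Let a2 := in2_alg D.
Let a3 := in3_alg D.
Let c12 := @in12 F D.
Let c13 := @in13 F D.
Let c23 := @in23 F D.
Let c21 := commuting_sym c12.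
Let c31 := commuting_sym c13.
Let c32 := commuting_sym c23.

Definition twist_fun x := J * comul x * J^-1.

Lemma twist_alg : alg_morph twist_fun.
Proof.
exact: alg_morph_conj aS J_unit.
Qed.

Definition twist_comul : 'AHom(D, tens D D) := ahom_of twist_alg.

Lemma twist_comulE x : twist_comul x = J * comul x * J^-1.
Proof. exact: ahom_ofE. Qed.

Lemma twist_comul_id t : tmap twist_comul id t =
  place in1 in2 J * comul_id H t * place in1 in2 J^-1.
Proof.
rewrite /comul_id /tmap (tlift_comp (L := fun z => _ * z * _)); last by lin.
apply: eq_tlift => a b; rewrite twist_comulE -!leg12E /leg12 !pureM.
by rewrite mulr1 mul1r.
Qed.

Lemma twist_id_comul t : tassoc (tmap id twist_comul t) =
  place in2 in3 J * id_comul H t * place in2 in3 J^-1.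
Proof.
have p23 := alg_morph_place a2 a3 c23.
rewrite id_comulE /tmap /place (tlift_comp (L := @tassoc _ _ _ _)); last by lin.
rewrite [RHS](tlift_comp (L := fun z => _ * z * _)); last by lin.
apply: eq_tlift => a b; rewrite tassocE twist_comulE.
transitivity (in1 a * place in2 in3 (J * comul b * J^-1)).
  rewrite /place (tlift_comp (L := fun z => _ * z)); last by lin.
  by apply: eq_tlift => x y; rewrite /in1 /in2 /in3 !pureM !mulr1 !mul1r.
rewrite !(algM p23) !mulrA; congr (_ * _ * _).
exact/esym/(commuting_place c21 c31).
Qed.

Lemma twist_comulA x :
  tassoc (tmap id twist_comul (twist_comul x)) = tmap twist_comul id (twist_comul x).
Proof.
rewrite twist_id_comul twist_comul_id twist_comulE comul_idE id_comulE.
exact/esym/twist_coassoc.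
Qed.

Lemma counitl_alg : alg_morph (place (fun a => (counit H a : F)%:A) id : tens D D -> D).
Proof.
apply: alg_morph_place; [exact: scalar_counit_alg|by []|exact: commuting_scalar].
Qed.

Lemma counitr_alg : alg_morph (place id (fun a => (counit H a : F)%:A) : tens D D -> D).
Proof.
apply: alg_morph_place; [by []|exact: scalar_counit_alg|].
exact/commuting_sym/commuting_scalar.
Qed.

Lemma twist_counitl x : tlift (fun a b => (counit H a : F) *: b) (twist_comul x) = x.
Proof.
transitivity (place (fun a => (counit H a : F)%:A) id (twist_comul x) : D).
  by apply: eq_tlift => a b; rewrite mulr_algl.
have al := counitl_alg.
have := alg_unitr al J_unit; rewrite J_counitl mul1r => JV1.
rewrite twist_comulE !(algM al) J_counitl mul1r JV1 mulr1.
rewrite -[RHS](counitl H).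
by apply: eq_tlift => a b; rewrite mulr_algl.
Qed.

Lemma twist_counitr x : tlift (fun a b => (counit H b : F) *: a) (twist_comul x) = x.
Proof.
transitivity (place id (fun a => (counit H a : F)%:A) (twist_comul x) : D).
  by apply: eq_tlift => a b; rewrite mulr_algr.
have al := counitr_alg.
have := alg_unitr al J_unit; rewrite J_counitr mul1r => JV1.
rewrite twist_comulE !(algM al) J_counitr mul1r JV1 mulr1.
rewrite -[RHS](counitr H).
by apply: eq_tlift => a b; rewrite mulr_algr.
Qed.

Definition twist_bialgebra : bialgebra D :=
  Bialgebra twist_comulA twist_counitl twist_counitr.

(** [k |-> sandl k t] and [k |-> sandr k t] are a right and a left action of the
    algebra [D (x) D] on [D]; the antipode axioms compute them on coproducts. *)
Definition sandl k (t : tens D D) : D := tlift (fun a b => S a * k * b) t.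
Definition sandr k (t : tens D D) : D := tlift (fun a b => a * k * S b) t.
(** The element [u = J' S(J'')] that conjugates [S] into the antipode of the twisted
    coproduct; [twist_elt_inv] is [S(G') G''] for [G] the inverse of [J]. *)
Definition twist_elt : D := sandr 1 J.
Definition twist_elt_inv : D := sandl 1 J^-1.

(** The cocycle identity says that [(J^-1)^(2,3) J^(1,2)] is the product of
    [(id (x) comul) J] and [(comul (x) id) J^-1]. The map [a (x) b (x) c |-> a S(b) c]
    sends the former to [u S(G') G''] and, by the antipode axioms, the latter to a
    product of two counits of legs of [J] and of [J^-1], that is, to 1. *)
Lemma twist_eltV : twist_elt * twist_elt_inv = 1.
Proof.
pose mu := tlift (fun t c => tlift (fun a b => a * S b) t * c) :
  tens (tens D D) D -> D.
have muE a b c : mu ((a \ox b) \ox c) = a * S b * c.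
  by rewrite /mu tliftE ?tliftE //; lin.
have lmu : linear mu by exact: lin_lift.
have ac := pl3_alg a1 a2 a3 c12 c13 c23; have ai := pl1_alg a1 a2 a3 c12 c13 c23.
have p23 := alg_morph_place a2 a3 c23.
have mid : place in2 in3 J^-1 * place in1 in2 J =
    place in1 (fun x => place in2 in3 (comul x)) J *
    place (fun x => place in1 in2 (comul x)) in3 J^-1.
  rewrite -[place in1 in2 J]mulr1 -(alg_unitr ac J_unit).
  rewrite [place in1 in2 J * _]mulrA cocycle_place // !mulrA.
  by rewrite (alg_unitl p23) // mul1r.
have lhs s t : mu (place in2 in3 s * place in1 in2 t) =
    tlift (fun a b => a * S b) t * tlift (fun a b => S a * b) s.
  move: s; apply: tens_ext => [||g g'].
  - by have ? := lin_place in2 in3; lin.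
  - by lin.
  move: t; apply: tens_ext => [||f f'].
  - by have ? := lin_place in1 in2; lin.
  - by lin.
  have [l1 l2 l3] := And3 (alg_lin a1) (alg_lin a2) (alg_lin a3).
  rewrite !placeE // !tliftE; [|lin|lin].
  rewrite /in1 /in2 /in3 !pureM !mulr1 !mul1r muE antipodeM.
  by rewrite !mulrA.
have rhs s t : mu (place in1 (fun x => place in2 in3 (comul x)) s *
      place (fun x => place in1 in2 (comul x)) in3 t) =
    place id (fun a => (counit H a : F)%:A) s *
    place (fun a => (counit H a : F)%:A) id t.
  move: s; apply: tens_ext => [||p p'].
  - by have ? := lin_place in1 (fun x => place in2 in3 (comul x)); lin.
  - by have ? := lin_place id (fun a : D => (counit H a : F)%:A : D); lin.
  move: t; apply: tens_ext => [||q q'].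
  - by have ? := lin_place (fun x => place in1 in2 (comul x)) in3; lin.
  - by have ? := lin_place (fun a : D => (counit H a : F)%:A : D) id; lin.
  have [l1 l2 l3] := And3 (alg_lin a1) (alg_lin a2) (alg_lin a3).
  have [l12 l23] := (lin_comp (lin_place in1 in2) (lin_lfun comul),
                     lin_comp (lin_place in2 in3) (lin_lfun comul)).
  have le : linear (fun a => (counit H a : F)%:A : D) by lin.
  rewrite !placeE //; try by lin.
  have sw (k l : F) : p * k%:A * (l%:A * q') = p * l%:A * (k%:A * q').
    by rewrite !mulr_algr !mulr_algl -!scalerAl -!scalerAr !scalerA mulrC.
  rewrite [X in _ = X]sw -(antipoder H q) -(antipodel H p').
  move: (comul q) (comul p') => x y.
  move: x; apply: tens_ext => [||x1 x2].
  - by have ? := lin_place in1 in2; lin.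
  - by lin.
  move: y; apply: tens_ext => [||y1 y2].
  - by have ? := lin_place in2 in3; lin.
  - by lin.
  rewrite !placeE // !tliftE; [|lin|lin].
  rewrite /in1 /in2 /in3 !pureM !mulr1 !mul1r muE antipodeM.
  by rewrite !mulrA.
have -> : twist_elt = tlift (fun a b => a * S b) J.
  by apply: eq_tlift => a b; rewrite mulr1.
have -> : twist_elt_inv = tlift (fun a b => S a * b) J^-1.
  by apply: eq_tlift => a b; rewrite mulr1.
rewrite -lhs mid rhs J_counitr mul1r.
have al := counitl_alg.
by rewrite -[LHS]mul1r -{1}J_counitl (alg_unitr al).
Qed.

Lemma twist_antipode_lin : linear (fun x => twist_elt * S x * twist_elt_inv).
Proof. by lin. Qed.

Definition twist_antipode : 'End(D) := linfun (fun x => twist_elt * S x * twist_elt_inv).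

Lemma twist_antipodeE x : twist_antipode x = twist_elt * S x * twist_elt_inv.
Proof. by rewrite linfunE //; exact: twist_antipode_lin. Qed.

Lemma sandl_mul k s t : sandl k (s * t) = sandl (sandl k s) t.
Proof.
rewrite /sandl.
move: t; apply: tens_ext => [||c d]; [lin|lin|].
rewrite [RHS]tliftE; last by lin.
move: s; apply: tens_ext => [||a b]; [lin|lin|].
by rewrite pureM !tliftE ?antipodeM ?mulrA //; lin.
Qed.

Lemma sandr_mul k s t : sandr k (s * t) = sandr (sandr k t) s.
Proof.
rewrite /sandr.
move: s; apply: tens_ext => [||a b]; [lin|lin|].
rewrite [RHS]tliftE; last by lin.
move: t; apply: tens_ext => [||c d]; [lin|lin|].
by rewrite pureM !tliftE ?antipodeM ?mulrA //; lin.
Qed.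

Lemma sandl1 k : sandl k 1 = k.
Proof. by rewrite /sandl tliftE ?antipode1 ?mul1r ?mulr1 //; lin. Qed.

Lemma sandr1 k : sandr k 1 = k.
Proof. by rewrite /sandr tliftE ?antipode1 ?mul1r ?mulr1 //; lin. Qed.

Lemma sandlZ c t : sandl c%:A t = c *: sandl 1 t.
Proof.
rewrite /sandl -tliftDZ; apply: eq_tlift => a b.
by rewrite mulr_algr mulr1 scalerAl.
Qed.

Lemma sandrZ c t : sandr c%:A t = c *: sandr 1 t.
Proof.
rewrite /sandr -tliftDZ; apply: eq_tlift => a b.
by rewrite mulr_algr mulr1 scalerAl.
Qed.

(** The three factors of [J * comul x * J^-1] act one after the other: the first gives
    [S(J') u^-1 J'' = 1], the second the counit of [x], the third [u^-1] again. *)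
Lemma twist_antipodel x :
  tlift (fun a b => twist_antipode a * b) (twist_comul x) = (counit H x : F)%:A.
Proof.
transitivity (twist_elt * sandl twist_elt_inv (twist_comul x)).
  rewrite /sandl (tlift_comp (L := fun z => _ * z)); last by lin.
  by apply: eq_tlift => a b; rewrite twist_antipodeE !mulrA.
rewrite twist_comulE !sandl_mul -[sandl twist_elt_inv J]sandl_mul.
rewrite mulVr // sandl1.
have -> : sandl 1 (comul x) = (counit H x : F)%:A.
  by rewrite -antipodel; apply: eq_tlift => a b; rewrite mulr1.
by rewrite sandlZ -scalerAr twist_eltV.
Qed.

Lemma twist_antipoder x :
  tlift (fun a b => a * twist_antipode b) (twist_comul x) = (counit H x : F)%:A.
Proof.
transitivity (sandr twist_elt (twist_comul x) * twist_elt_inv).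
  rewrite /sandr (tlift_comp (L := fun z => z * _)); last by lin.
  by apply: eq_tlift => a b; rewrite twist_antipodeE !mulrA.
rewrite twist_comulE !sandr_mul -[sandr twist_elt J^-1]sandr_mul.
rewrite mulVr // sandr1.
have -> : sandr 1 (comul x) = (counit H x : F)%:A.
  by rewrite -antipoder; apply: eq_tlift => a b; rewrite mulr1.
by rewrite sandrZ -scalerAl twist_eltV.
Qed.

Definition twist_hopf : hopf D :=
  @Hopf _ _ twist_bialgebra twist_antipode twist_antipodel twist_antipoder.

Lemma twist_antipode_inj : lker S == 0%VS -> lker twist_antipode == 0%VS.
Proof.
move=> /lker0P Si; have [uu _] := mulr1_unit twist_eltV.
have [_ /mulr1_unit[uv _]] := mulr1_unit twist_eltV.
by apply/lker0P => x y; rewrite !twist_antipodeE => /(mulIr uv)/(mulrI uu)/Si.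
Qed.

Lemma tswap_unit : tswap J \is a GRing.unit.
Proof.
have e : tswap J * tswap J^-1 = 1 by rewrite -tswapM divrr // tswap1.
exact: (mulr1_unit e).1.
Qed.

Lemma twist_Rcomul x : twist_Rmatrix * twist_comul x =
  tswap (twist_comul x) * twist_Rmatrix.
Proof.
have [_ RD _ _] := R_qt.
rewrite twist_comulE !tswapM /twist_Rmatrix -!mulrA mulKr // [R * (_ * _)]mulrA RD.
congr (_ * _); rewrite -!mulrA; congr (_ * _); rewrite mulrA -tswapM.
by rewrite mulVr // tswap1 mul1r.
Qed.

Lemma twist_quasitriangular : quasitriangular twist_hopf twist_Rmatrix.
Proof.
have [uR _ _ _] := R_qt; split.
- by rewrite !unitrMl ?unitrV ?tswap_unit.
- exact: twist_Rcomul.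
- by rewrite [LHS]twist_comul_id comul_idE leg13E leg23E twist_R_pl3.
- by rewrite [LHS]twist_id_comul id_comulE leg13E leg12E twist_R_pl1.
Qed.
End Twist.

(** * The double and its R-matrix *)

Lemma tassoc_tmap (F : fieldType) (U V W U' V' W' : vectType F)
    (f : U -> U') (g : V -> V') (h : W -> W') t :
  linear f -> linear g -> linear h ->
  tassoc (tmap f (tmap g h) t) = tmap (tmap f g) h (tassoc t).
Proof.
move=> lf lg lh; move: t; apply: tens_ext => [||u t]; [lin|lin|].
rewrite tmapE; [|by []|exact: lin_map].
move: t; apply: tens_ext => [||v w]; [lin|lin|].
by rewrite tmapE // !tassoc_pure !tmapE //; lin.
Qed.

Lemma intertwineM (W : nzRingType) (u x x' y y' : W) :
  u * x = x' * u -> u * y = y' * u -> u * (x * y) = (x' * y') * u.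
Proof. by move=> ux uy; rewrite mulrA ux -!mulrA uy. Qed.

Section CrossRelation.
Variables (F : fieldType) (A D : falgType F) (HA : hopf A).
Variables (iA : A -> D) (iB : dual HA -> D) (T : A -> A).
Hypotheses (lA : linear iA) (lB : linear iB) (lT : linear T).
Hypothesis T_l : forall a,
  tlift (fun x y => y * T x) (comul HA a) = (counit HA a : F)%:A.
Hypothesis T_r : forall a,
  tlift (fun x y => T y * x) (comul HA a) = (counit HA a : F)%:A.
Local Notation B := (dual HA).
Local Notation HB := (dual_cop HA).

(** The pairings are made [D]-valued in order to be convolved with the two products
    [prodAB] and [prodBA]. *)
Definition pair_form (a : A) (b : B) : D := (pairing a b : F)%:A.
Definition skew_form (a : A) (b : B) : D := (pairing (T a) b : F)%:A.
Definition prodAB (a : A) (b : B) : D := iA a * iB b.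
Definition prodBA (a : A) (b : B) : D := iB b * iA a.
Local Notation conv := (@conv2 F A B D HA HB).
Local Notation cunit := (@conv2_unit F A B D HA HB).

Lemma pair_form_bilin : bilin pair_form. Proof. rewrite /pair_form; lin. Qed.
Lemma skew_form_bilin : bilin skew_form. Proof. rewrite /skew_form; lin. Qed.
Lemma prodAB_bilin : bilin prodAB. Proof. rewrite /prodAB; lin. Qed.
Lemma prodBA_bilin : bilin prodBA. Proof. rewrite /prodBA; lin. Qed.

Lemma conv_pair_forms (f g : A -> A) a b : linear f -> linear g ->
  conv (fun a b => (pairing (f a) b : F)%:A) (fun a b => (pairing (g a) b : F)%:A) a b =
  (pairing (tlift (fun x y => g y * f x) (comul HA a)) b : F)%:A.
Proof.
move=> lf lg; rewrite /conv2.
rewrite (tlift_comp (L := fun z => (pairing z b : F)%:A)); last by lin.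
apply: eq_tlift => a1 a2; rewrite pairing_mul.
rewrite (tlift_comp (L := fun z : F^o => (z : F)%:A)); last by lin.
by apply: eq_tlift => b1 b2; rewrite mulr_algl scalerA.
Qed.

Lemma conv_pair_skew : conv pair_form skew_form =2 cunit.
Proof.
move=> a b; rewrite [LHS]conv_pair_forms // T_r pairing_scale.
by rewrite /conv2_unit counit_dual.
Qed.

Lemma conv_skew_pair : conv skew_form pair_form =2 cunit.
Proof.
move=> a b; rewrite [LHS]conv_pair_forms // T_l pairing_scale.
by rewrite /conv2_unit counit_dual.
Qed.

(** The cross relation [<a1, b1> b2 a2 = a1 b1 <a2, b2>], an equivalent of the
    multiplication rule of the double in which no antipode occurs. *)
Definition crossed := conv pair_form prodBA =2 conv prodAB pair_form.

(** [skew_form] is the convolution inverse of [pair_form], so [pair_form] can be moved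
    to the other side of the relation. *)
Lemma crossed_rule : crossed ->
  prodBA =2 conv (conv skew_form prodAB) pair_form.
Proof.
have [bp bs bab bba] := And4 pair_form_bilin skew_form_bilin prodAB_bilin prodBA_bilin.
move=> cr a b; rewrite conv2A // -(eq_conv2 HA HB (fun x y => erefl (skew_form x y)) cr).
rewrite -conv2A // (eq_conv2 HA HB conv_skew_pair (fun x y => erefl (prodBA x y))).
by rewrite conv2_unitl.
Qed.

Lemma rule_crossed :
  prodBA =2 conv (conv skew_form prodAB) pair_form -> crossed.
Proof.
have [bp bs bab bba] := And4 pair_form_bilin skew_form_bilin prodAB_bilin prodBA_bilin.
move=> ru a b; rewrite (eq_conv2 HA HB (fun x y => erefl (pair_form x y)) ru).
have e : conv (conv skew_form prodAB) pair_form =2 conv skew_form (conv prodAB pair_form).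
  exact: conv2A.
rewrite (eq_conv2 HA HB (fun x y => erefl (pair_form x y)) e).
have bb := conv2_bilin HA HB prodAB pair_form.
rewrite -conv2A // (eq_conv2 HA HB conv_pair_skew (fun x y => erefl (conv prodAB pair_form x y))).
by rewrite conv2_unitl.
Qed.

Section Canonical.
Local Notation r := (canonical_tensor HA).

Lemma coslice_mul (W : falgType F) (b : B) (s t : tens A W) :
  coslice b (s * t) = tlift (fun b1 b2 => coslice b2 s * coslice b1 t) (comul HB b).
Proof.
have lc := @lin_coslice F A HA W.
move: s; apply: tens_ext => [||x w]; [lin|lin|].
move: t; apply: tens_ext => [||y v]; [lin|lin|].
rewrite pureM coslice_pure pairing_mul.
rewrite (tlift_comp (L := fun k : F^o => (k : F) *: (w * v))); last by lin.
by apply: eq_tlift => b1 b2; rewrite !coslice_pure -scalerAl -scalerAr scalerA mulrC.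
Qed.

Lemma coslice_tmap (U V : vectType F) (g : U -> V) (b : B) (t : tens A U) :
  linear g -> coslice b (tmap id g t) = g (coslice b t).
Proof.
move=> lg; have lc := @lin_coslice F A HA.
move: t; apply: tens_ext => [||u w]; [lin|lin|].
by rewrite tmapE ?coslice_pure ?(linZ lg).
Qed.

Lemma coslice_canon (b : B) : coslice b r = b.
Proof.
rewrite /canonical_tensor (linear_sumE (@lin_coslice _ _ _ _ b)) [RHS]dual_crd.
by apply: eq_bigr => i _; rewrite coslice_pure.
Qed.

Lemma coslice_R_comul (a : A) (b : B) :
  coslice b (tmap id iB r * tmap id iA (comul HA a)) = conv pair_form prodBA a b.
Proof.
rewrite coslice_mul /conv2 tlift_exch; apply: eq_tlift => b1 b2.
rewrite !coslice_tmap // coslice_canon /coslice.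
rewrite (tlift_comp (L := fun z => iB b2 * iA z)); last by lin.
apply: eq_tlift => a1 a2.
by rewrite (linZ lA) -scalerAr /pair_form /prodBA mulr_algl.
Qed.

Lemma coslice_comulop_R (a : A) (b : B) :
  coslice b (tlift (fun x y => y \ox iA x) (comul HA a) * tmap id iB r) =
  conv prodAB pair_form a b.
Proof.
rewrite coslice_mul /conv2 tlift_exch; apply: eq_tlift => b1 b2.
rewrite !coslice_tmap // coslice_canon.
have lc := @lin_coslice F A HA D b2.
rewrite (tlift_comp (L := fun z => coslice b2 z * iB b1)); last by lin.
apply: eq_tlift => a1 a2; rewrite coslice_pure.
by rewrite /pair_form /prodAB mulr_algr scalerAl.
Qed.

(** Pairing the first leg with [b] turns the two sides into the two sides of the cross
    relation. *)
Lemma crossed_R_comul : crossed <-> forall a,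
  tmap id iB r * tmap id iA (comul HA a) =
  tlift (fun x y => y \ox iA x) (comul HA a) * tmap id iB r.
Proof.
split=> [cr a|RD a b]; last by rewrite -coslice_R_comul RD coslice_comulop_R.
by apply: (@coslice_ext _ _ HA) => b; rewrite coslice_R_comul coslice_comulop_R.
Qed.

Lemma crossed_R_comulB : crossed -> forall b : B,
  tmap iA id r * tmap iB id (comul HB b) =
  tlift (fun x y => iB y \ox x) (comul HB b) * tmap iA id r.
Proof.
move=> cr b; apply: slice_ext => a; rewrite !slice_mul.
transitivity (conv prodAB pair_form a b); last rewrite -cr.
  rewrite /conv2; apply: eq_tlift => a1 a2; rewrite slice_tmap // slice_canon /tmap.
  rewrite (tlift_comp (L := fun z => iA a1 * slice a2 z)); last by lin.
  apply: eq_tlift => b1 b2; rewrite sliceE.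
  by rewrite /pair_form /prodAB mulr_algr -scalerAr.
rewrite /conv2; apply: eq_tlift => a1 a2; rewrite slice_tmap // slice_canon.
rewrite (tlift_comp (L := fun z => slice a1 z * iA a2)); last by lin.
apply: eq_tlift => b1 b2; rewrite sliceE.
by rewrite /pair_form /prodBA mulr_algl -scalerAl.
Qed.
End Canonical.
End CrossRelation.

Section DoubleRule.
Variables (F : fieldType) (A D : falgType F) (HA : hopf A).
Variables (iA : A -> D) (iB : dual HA -> D).
Hypotheses (lA : linear iA) (lB : linear iB).

(** The rule [b a = <T a1, b1> a2 b2 <a3, b3>] is a triple convolution product. *)
Lemma double_ruleE a b : double_rule iA iB a b =
  conv2 HA (dual_cop HA)
    (conv2 HA (dual_cop HA) (@skew_form F A D HA (antipode HA)^-1%VF) (prodAB iA iB))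
    (@pair_form F A D HA) a b.
Proof.
set T := (antipode HA)^-1%VF; rewrite /double_rule -/T.
pose k (a1 a2 a3 : A) (b1 b2 b3 : dual HA) : D :=
  (pairing (T a1) b1 * pairing a3 b3 : F) *: (iA a2 * iB b2).
rewrite tlift3_tmapl; last by rewrite /tlift3; lin.
apply: eq_tlift => x a3.
transitivity (tlift (fun a1 a2 => tlift (fun y b3 => tlift (fun b1 b2 =>
    k a1 a2 a3 b1 b2 b3) (comul (dual_cop HA) y)) (comul (dual_cop HA) b)) (comul HA x)).
  by apply: eq_tlift => a1 a2; rewrite tlift3_tmapl //; lin.
rewrite tlift_exch; apply: eq_tlift => y b3; rewrite /conv2 /pair_form.
rewrite [RHS](tlift_comp (L := fun z => z * _)); last by lin.
apply: eq_tlift => a1 a2.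
rewrite [RHS](tlift_comp (L := fun z => z * _)); last by lin.
apply: eq_tlift => b1 b2; rewrite /k /skew_form /prodAB.
by rewrite mulr_algr mulr_algl scalerA mulrC.
Qed.
End DoubleRule.

Section SkewInverse.
Variables (F : fieldType) (A : falgType F) (HA : hopf A).
Local Notation S := (antipode HA).
Local Notation T := ((antipode HA)^-1%VF).

Lemma pairing_extl (a a' : A) :
  (forall b : dual HA, pairing a b = pairing a' b) -> a = a'.
Proof.
move=> e; rewrite (crd_bas a) (crd_bas a'); apply: eq_bigr => i _.
by rewrite -!(@dual_basE _ _ HA) e.
Qed.

Hypothesis S_inj : lker S == 0%VS.

Lemma antipodeVK : cancel T S. Proof. exact: lker0_lfunVK S_inj. Qed.

Let S_injective : injective S. Proof. exact/lker0P. Qed.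

Lemma antipodeV_l a :
  tlift (fun x y => y * T x) (comul HA a) = (counit HA a : F)%:A.
Proof.
apply: S_injective; rewrite linearZ /= antipode1 -antipoder tlift_comp; last by lin.
by apply: eq_tlift => x y; rewrite antipodeM antipodeVK.
Qed.

Lemma antipodeV_r a :
  tlift (fun x y => T y * x) (comul HA a) = (counit HA a : F)%:A.
Proof.
apply: S_injective; rewrite linearZ /= antipode1 -antipodel tlift_comp; last by lin.
by apply: eq_tlift => x y; rewrite antipodeM antipodeVK.
Qed.
End SkewInverse.

Lemma conv2_map (F : fieldType) (C C' W V : falgType F) (HC : bialgebra C)
    (HC' : bialgebra C') (m : W -> V) (f g : C -> C' -> W) c d : alg_morph m ->
  m (conv2 HC HC' f g c d) =
  conv2 HC HC' (fun x y => m (f x y)) (fun x y => m (g x y)) c d.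
Proof.
move=> [ml mM _]; rewrite /conv2 tlift_comp //; apply: eq_tlift => c1 c2.
by rewrite tlift_comp //; apply: eq_tlift => d1 d2; rewrite mM.
Qed.

Section Double.
Variables (F : fieldType) (A D : falgType F) (HA : hopf A) (HD : hopf D).
Variables (iA : 'AHom(A, D)) (iB : 'AHom(dual HA, D)).
Hypothesis dD : is_double HA HD iA iB.
Local Notation B := (dual HA).
Local Notation HB := (dual_cop HA).
Local Notation S := (antipode HA).
Local Notation T := ((antipode HA)^-1%VF).
Local Notation r := (canonical_tensor HA).

(** The counit of the double, applied to both sides of the multiplication rule, gives
    [<a2 * T a1, b> = eps(a) eps(b)] for all [b]. *)
Lemma double_counit a :
  tlift (fun x y => y * T x) (comul HA a) = (counit HA a : F)%:A.
Proof.
apply: (pairing_extl (HA := HA)) => b.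
have := congr1 (counit HD) (double_mul dD a b).
have [_ eA] := double_morphA dD; have [_ eB] := double_morphB dD.
rewrite double_ruleE; [|lin|lin]; rewrite rmorphM /= eA eB counit_dual.
have ae := ahom_alg (counit HD).
have eZ (k : F) : counit HD k%:A = k%:A by rewrite linearZ /= rmorph1.
rewrite conv2_map //.
have -> : conv2 HA HB (fun x y => counit HD (conv2 HA HB (skew_form D T) (prodAB iA iB) x y))
  (fun x y => counit HD (pair_form D x y)) a b =
    conv2 HA HB (skew_form F^o T) (pair_form F^o (HA := HA)) a b.
  apply: eq_conv2 => x y; last by rewrite /pair_form eZ.
  rewrite conv2_map // -[RHS](conv2_unitr HA HB); last by rewrite /skew_form; lin.
  apply: eq_conv2 => u v; first by rewrite /skew_form eZ.
  rewrite /prodAB rmorphM /= eA eB /conv2_unit.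
  by rewrite regularE mulr1.
rewrite conv_pair_forms; [|lin|lin]; rewrite regularE mulr1 pairing_scale => <-.
by rewrite mulrC.
Qed.

(** [T] is a priori only a linear section of [S] over the image of [S]; that it is its
    inverse is forced by the existence of the double. *)
Lemma double_antipodeK : cancel T S.
Proof.
move=> a; apply: (antipode_skew (HC := HA) (f := id)) => //; try by lin.
- by move=> c; rewrite tmap_id.
- exact: double_counit.
Qed.

Lemma double_antipode_inj : lker S == 0%VS.
Proof.
have kT : lker T = 0%VS by apply/eqP/lker0P; exact: can_inj double_antipodeK.
apply/lker0P => x y.
have /memv_imgP[u _ ->] : x \in limg T by rewrite lker0_limgf ?memvf ?kT.
have /memv_imgP[v _ ->] : y \in limg T by rewrite lker0_limgf ?memvf ?kT.
by rewrite !double_antipodeK => ->.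
Qed.

Lemma double_crossed : crossed iA iB.
Proof.
apply: (rule_crossed (T := T)); [by lin|by lin|by lin| |].
  exact: antipodeV_r double_antipode_inj.
move=> a b; by rewrite -double_ruleE; [exact: (double_mul dD a b)|lin|lin].
Qed.

Local Notation R := (double_rmatrix iA iB).

Lemma canonical_inv : r * tmap S id r = 1.
Proof.
apply: slice_ext => a; rewrite slice_mul slice1 -antipoder; apply: eq_tlift => x y.
by rewrite slice_canon slice_tmap ?slice_canon //; lin.
Qed.

Lemma double_R_unit : R \is a GRing.unit.
Proof.
have [_ mM m1] := alg_morph_tmap (ahom_alg iA) (ahom_alg iB).
have := congr1 (tmap iA iB) canonical_inv; rewrite mM m1 => e.
exact: (mulr1_unit e).1.
Qed.

Lemma double_R_comulA a : R * comul HD (iA a) = tswap (comul HD (iA a)) * R.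
Proof.
have RA := (crossed_R_comul (lin_lfun iA) (lin_lfun iB)).1 double_crossed a.
have [_ mM _] := alg_morph_tmap (ahom_alg iA) (alg_morph_id D).
have := congr1 (tmap iA (fun x => x)) RA; rewrite !mM.
have -> : tmap iA (fun x => x) (tmap id iB r) = R.
  by rewrite tmap_comp //; lin.
have -> : tmap iA (fun x => x) (tmap id iA (comul HA a)) = comul HD (iA a).
  by rewrite tmap_comp // ?(double_morphA dD).1 //; lin.
move=> ->; congr (_ * _); rewrite (double_morphA dD).1 /tswap tlift_tmap; last by lin.
rewrite tmap_tlift; apply: eq_tlift => x y; rewrite tmapE //; lin.
Qed.

Lemma double_R_comulB b : R * comul HD (iB b) = tswap (comul HD (iB b)) * R.
Proof.
have RB := crossed_R_comulB (lin_lfun iA) double_crossed b.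
have [_ mM _] := alg_morph_tmap (alg_morph_id D) (ahom_alg iB).
have := congr1 (tmap (fun x => x) iB) RB; rewrite !mM.
have -> : tmap (fun x => x) iB (tmap iA id r) = R.
  by rewrite tmap_comp //; lin.
have -> : tmap (fun x => x) iB (tmap iB id (comul HB b)) = comul HD (iB b).
  by rewrite tmap_comp // ?(double_morphB dD).1 //; lin.
move=> ->; congr (_ * _); rewrite (double_morphB dD).1 /tswap tlift_tmap; last by lin.
rewrite tmap_tlift; apply: eq_tlift => x y; rewrite tmapE //; lin.
Qed.

Lemma double_ext (W : vectType F) (f g : D -> W) : linear f -> linear g ->
  (forall a b, f (iA a * iB b) = g (iA a * iB b)) -> f =1 g.
Proof.
move=> lf lg e x; have [h _ hK] := double_bij dD; rewrite -(hK x).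
by rewrite !tlift_comp //; apply: eq_tlift.
Qed.

Lemma double_R_comul x : R * comul HD x = tswap (comul HD x) * R.
Proof.
move: x; apply: double_ext => [||a b]; [lin|lin|].
rewrite rmorphM tswapM.
exact: intertwineM (double_R_comulA a) (double_R_comulB b).
Qed.

Lemma canonical_comul_id : tmap (comul HA) id r =
  tlift (fun a b => (a \ox 1) \ox b) r * tlift (fun a b => (1 \ox a) \ox b) r.
Proof.
have sl (f : A -> tens A A) a : linear f -> slice a (tlift (fun a b => f a \ox b) r) = f a.
  by move=> lf; rewrite -[tlift _ r]/(tmap f id r) slice_tmap // slice_canon.
apply: slice_ext => a; rewrite slice_tmap ?slice_canon ?slice_mul; last by lin.
rewrite -[LHS]tens_sum; apply: eq_tlift => x y.
by rewrite !sl ?pureM ?mulr1 ?mul1r //; lin.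
Qed.

Lemma slice_canonical_id_comul y :
  slice y (tassoc (tmap id (comul HB) r)) = (y \ox 1) * r.
Proof.
apply: slice_ext => x; rewrite slice_mul.
transitivity (y * x); last first.
  transitivity (tlift (fun u v => (counit HA u : F) *: (y * v)) (comul HA x)).
    by rewrite sw_counitl //; lin.
  by apply: eq_tlift => u v; rewrite sliceE slice_canon pairing1 scalerAl.
transitivity (slice (y * x) r); last exact: slice_canon.
rewrite /tmap (tlift_comp (L := fun t => slice x (slice y (tassoc t)))); last by lin.
rewrite [in RHS]/slice; apply: eq_tlift => a b.
rewrite tassocE (tlift_comp (L := fun t => slice x (slice y t))); last by lin.
rewrite pairing_mul (tlift_comp (L := fun k : F^o => (k : F) *: a)); last by lin.
apply: eq_tlift => b1 b2; rewrite sliceE.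
by rewrite slice_linearZ sliceE scalerA mulrC.
Qed.

Lemma canonical_id_comul : tassoc (tmap id (comul HB) r) =
  tlift (fun a b => (a \ox 1) \ox b) r * tlift (fun a b => (a \ox b) \ox 1) r.
Proof.
apply: slice_ext => y; rewrite slice_mul.
have s1 x : slice x (tlift (fun a b => (a \ox 1 : tens A B) \ox b) r) = x \ox 1.
  by rewrite -[tlift _ r]/(tmap (fun a => a \ox 1) id r) slice_tmap ?slice_canon //; lin.
have s2 x : slice x (tlift (fun a b => (a \ox b : tens A B) \ox (1 : B)) r) =
    (counit HA x : F) *: r.
  rewrite -[in RHS](tens_sum r) -tliftDZ tlift_comp; last by lin.
  by apply: eq_tlift => a b; rewrite sliceE.
rewrite slice_canonical_id_comul.
transitivity (tlift (fun x z => (counit HA z : F) *: ((x \ox 1) * r)) (comul HA y)).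
  by rewrite sw_counitr //; lin.
by apply: eq_tlift => x z; rewrite s1 s2 -scalerAr.
Qed.

Lemma double_R_comul_id : comul_id HD R = leg13 R * leg23 R.
Proof.
have ai := ahom_alg iA; have aj := ahom_alg iB.
have aa := alg_morph_tmap (alg_morph_tmap ai ai) aj.
have := congr1 (tmap (tmap iA iA) iB) canonical_comul_id; rewrite (algM aa).
have -> : tmap (tmap iA iA) iB (tmap (comul HA) id r) = comul_id HD R.
  rewrite /comul_id /double_rmatrix !tmap_comp; try by lin.
  by apply: eq_tmap => // x; rewrite (double_morphA dD).1.
move=> ->; rewrite /leg13 /leg23 /double_rmatrix !tlift_tmap; try by lin.
rewrite !tmap_tlift; congr (_ * _); apply: eq_tlift => a b.
  by rewrite tmapE ?tmapE ?rmorph1 //; lin.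
by rewrite tmapE ?tmapE ?rmorph1 //; lin.
Qed.

Lemma double_R_id_comul : id_comul HD R = leg13 R * leg12 R.
Proof.
have ai := ahom_alg iA; have aj := ahom_alg iB.
have aa := alg_morph_tmap (alg_morph_tmap ai aj) aj.
have := congr1 (tmap (tmap iA iB) iB) canonical_id_comul; rewrite (algM aa).
have -> : tmap (tmap iA iB) iB (tassoc (tmap id (comul HB) r)) = id_comul HD R.
  rewrite /id_comul /double_rmatrix -tassoc_tmap; [|lin|lin|lin].
  rewrite !tmap_comp; try by lin.
  by congr tassoc; apply: eq_tmap => // x; rewrite (double_morphB dD).1.
move=> ->; rewrite /leg13 /leg12 /double_rmatrix !tlift_tmap; try by lin.
rewrite !tmap_tlift; congr (_ * _).
  by apply: eq_tlift => a b; rewrite tmapE ?tmapE ?rmorph1 //; lin.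
rewrite /tmap (tlift_comp (L := fun t => t \ox 1)); last by lin.
by apply: eq_tlift => a b; rewrite -/(tmap iA iB) -/(tmap (tmap iA iB) iB)
  tmapE ?tmapE ?rmorph1 //; lin.
Qed.

Lemma double_quasitriangular : quasitriangular HD R.
Proof.
split; [exact: double_R_unit|exact: double_R_comul|exact: double_R_comul_id|].
exact: double_R_id_comul.
Qed.
End Double.

(** * Factorizations of A and of its dual *)

Section Factorization.
Variables (F : fieldType) (A : falgType F) (HA : hopf A).
Variables (A1 A2 : {vspace A}).
Hypotheses (A1_subalg : subalgebra A1) (A2_subalg : subalgebra A2).
Hypothesis A_fact : factorization A1 A2.
Hypotheses (A1_coideal : left_coideal HA A1) (A2_coideal : right_coideal HA A2).
Variables (P1 P2 : 'End(A)).
Hypotheses (P1_def : is_left_proj HA A1 A2 P1) (P2_def : is_right_proj HA A1 A2 P2).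
Local Notation B := (dual HA).
Local Notation HB := (dual_cop HA).
Local Notation eps := (counit HA).
Local Notation r := (canonical_tensor HA).
Implicit Types (a x y : A) (b : B).

Lemma factorization_ext (W : vectType F) (f g : A -> W) : linear f -> linear g ->
  {in A1 & A2, forall x y, f (x * y) = g (x * y)} -> f =1 g.
Proof.
move=> lf lg e a; have [_ im] := A_fact.
have /memv_imgP[t tA ->] : a \in
    (linfun (tlift (fun a b : A => a * b)) @: tensv A1 A2)%VS by rewrite im memvf.
rewrite lfunE /=; move: t tA; apply: tensv_ext; [lin|lin|] => x y xA yA /=.
by rewrite tliftE ?e //; lin.
Qed.

Lemma dim_factorization (C : falgType F) (U V : {vspace C}) : factorization U V ->
  (\dim U * \dim V)%N = \dim {:C}.
Proof.
move=> [inj im]; rewrite -im limg_dim_eq ?dim_tensv //.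
apply/eqP; rewrite -subv0; apply/subvP => t /memv_capP[tU].
rewrite memv_ker => /eqP t0; rewrite memv0; apply/eqP; apply: inj => //.
  exact: mem0v.
by rewrite t0 linear0.
Qed.

Let A1_1 : 1 \in A1. Proof. by have /subalgebraP[] := A1_subalg. Qed.
Let A2_1 : 1 \in A2. Proof. by have /subalgebraP[] := A2_subalg. Qed.
Let A1_M : {in A1 &, forall x y, x * y \in A1}.
Proof. by have /subalgebraP[] := A1_subalg. Qed.
Let A2_M : {in A2 &, forall x y, x * y \in A2}.
Proof. by have /subalgebraP[] := A2_subalg. Qed.

Lemma sw_sub (W : vectType F) (X Y : {vspace A}) (f g : A -> A -> W) a :
  comul HA a \in tensv X Y -> bilin f -> bilin g ->
  {in X & Y, f =2 g} -> tlift f (comul HA a) = tlift g (comul HA a).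
Proof.
move=> aXY bf bg e; move: (comul HA a) aXY; apply: tensv_ext; [lin|lin|] => x y xX yY.
by rewrite !tliftE // e.
Qed.

Lemma comul_A1 x : x \in A1 -> comul HA x \in tensv fullv A1.
Proof. by move=> xA; apply: (subvP A1_coideal); apply: memv_img. Qed.

Lemma comul_A2 y : y \in A2 -> comul HA y \in tensv A2 fullv.
Proof. by move=> yA; apply: (subvP A2_coideal); apply: memv_img. Qed.

Lemma P1_id x : x \in A1 -> P1 x = x.
Proof. by move=> xA; rewrite -[x in LHS]mulr1 P1_def // rmorph1 scale1r. Qed.

Lemma P2_id y : y \in A2 -> P2 y = y.
Proof. by move=> yA; rewrite -[y in LHS]mul1r P2_def // rmorph1 scale1r. Qed.

Lemma P1_mulr a y : y \in A2 -> P1 (a * y) = (eps y : F) *: P1 a.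
Proof.
move=> yA; move: a; apply: factorization_ext; [lin|lin|] => u v uA vA.
by rewrite -mulrA !P1_def ?A2_M // rmorphM /= scalerA mulrC.
Qed.

Lemma P2_mull x a : x \in A1 -> P2 (x * a) = (eps x : F) *: P2 a.
Proof.
move=> xA; move: a; apply: factorization_ext; [lin|lin|] => u v uA vA.
by rewrite mulrA !P2_def ?A1_M // rmorphM /= scalerA.
Qed.

Lemma P1_mem a : P1 a \in A1.
Proof.
have /(_ a) : (fun a => P1 a) =1 (fun a => projv A1 (P1 a)).
  apply: factorization_ext; [lin|lin|] => u v uA vA.
  by rewrite P1_def // linearZ /= projv_id.
by move=> ->; exact: memv_proj.
Qed.

Lemma P2_mem a : P2 a \in A2.
Proof.
have /(_ a) : (fun a => P2 a) =1 (fun a => projv A2 (P2 a)).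
  apply: factorization_ext; [lin|lin|] => u v uA vA.
  by rewrite P2_def // linearZ /= projv_id.
by move=> ->; exact: memv_proj.
Qed.

Lemma counit_P1 a : eps (P1 a) = eps a.
Proof.
move: a; apply: factorization_ext; [lin|lin|] => u v uA vA.
by rewrite P1_def // linearZ rmorphM /= mulrC.
Qed.

Lemma counit_P2 a : eps (P2 a) = eps a.
Proof.
move: a; apply: factorization_ext; [lin|lin|] => u v uA vA.
by rewrite P2_def // linearZ rmorphM.
Qed.

(** Since the coproduct of [x y] has the form [x1 y1 (x) x2 y2] with [x2] in
    [A1] and [y1] in [A2], the projections only see [x] and [y]. *)
Lemma P1_conv_P2 a : tlift (fun u v => P1 u * P2 v) (comul HA a) = a.
Proof.
move: a; apply: factorization_ext; [lin|lin|] => x y xA yA.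
rewrite sw_mul; last by lin.
transitivity (tlift (fun x1 x2 => (eps x2 : F) *: (P1 x1 * P2 y)) (comul HA x)).
  apply: (sw_sub (comul_A1 xA)); [lin|lin|] => x1 x2 _ x2A.
  transitivity (tlift (fun y1 y2 => (eps y1 : F) *: ((eps x2 : F) *: (P1 x1 * P2 y2))) (comul HA y)).
    apply: (sw_sub (comul_A2 yA)); [lin|lin|] => y1 y2 y1A _.
    by rewrite P1_mulr // P2_mull // -scalerAl -scalerAr.
  by rewrite (sw_counitl _ (f := fun y => (eps x2 : F) *: (P1 x1 * P2 y))) //; lin.
rewrite (sw_counitr _ (f := fun x => P1 x * P2 y)) ?P1_id ?P2_id //; lin.
Qed.

Local Notation B1 := (perp HA (augmentation HA A1 * A2)%VS).
Local Notation B2 := (perp HA (A1 * augmentation HA A2)%VS).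

Lemma sub_counit_mem (U : {vspace A}) x : 1 \in U -> x \in U ->
  x - (eps x : F)%:A \in augmentation HA U.
Proof.
move=> U1 xU; rewrite memv_cap memvB ?memvZ //= memv_ker linearB linearZ /=.
by rewrite rmorph1 regularE mulr1 subrr.
Qed.

(** [B1] consists of the linear forms that factor through [P2]: it is the dual of [A2].
    Likewise [B2] below is the dual of [A1]. *)
Lemma memB1 b : reflect (forall a, pairing (P2 a) b = pairing a b) (b \in B1).
Proof.
apply: (iffP (@memv_perp _ _ _ _ _)) => [b0 a|b0].
  move: a; apply: factorization_ext; [lin|lin|] => x y xA yA.
  rewrite P2_def //; apply/esym/eqP; rewrite -subr_eq0; apply/eqP.
  rewrite -(b0 _ (memv_mul (sub_counit_mem A1_1 xA) yA)) mulrBl mulr_algl.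
  by rewrite [RHS]raddfB.
suff /subvP s : (augmentation HA A1 * A2 <= lker (b : 'Hom(A, F^o)))%VS.
  by move=> a /s; rewrite memv_ker => /eqP.
apply/prodvP => x y /memv_capP[xA]; rewrite !memv_ker => /eqP x0 yA.
by apply/eqP; rewrite -[LHS]/(pairing (x * y) b) -b0 P2_def // x0 scale0r /pairing linear0.
Qed.

Lemma memB2 b : reflect (forall a, pairing (P1 a) b = pairing a b) (b \in B2).
Proof.
apply: (iffP (@memv_perp _ _ _ _ _)) => [b0 a|b0].
  move: a; apply: factorization_ext; [lin|lin|] => x y xA yA.
  rewrite P1_def //; apply/esym/eqP; rewrite -subr_eq0; apply/eqP.
  rewrite -(b0 _ (memv_mul xA (sub_counit_mem A2_1 yA))) mulrBr mulr_algr.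
  by rewrite [RHS]raddfB.
suff /subvP s : (A1 * augmentation HA A2 <= lker (b : 'Hom(A, F^o)))%VS.
  by move=> a /s; rewrite memv_ker => /eqP.
apply/prodvP => x y xA /memv_capP[yA]; rewrite !memv_ker => /eqP y0.
by apply/eqP; rewrite -[LHS]/(pairing (x * y) b) -b0 P1_def // y0 scale0r /pairing linear0.
Qed.

Lemma pairing_B1 b x a : b \in B1 -> x \in A1 ->
  pairing (x * a) b = eps x * pairing a b.
Proof.
by move=> /memB1 bB xA; rewrite -bB P2_mull // pairing_scale bB.
Qed.

Lemma pairing_B2 b a y : b \in B2 -> y \in A2 ->
  pairing (a * y) b = eps y * pairing a b.
Proof.
by move=> /memB2 bB yA; rewrite -bB P1_mulr // pairing_scale bB.
Qed.

(** The projections of [B] are the transposes of those of [A], with the indices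
    exchanged. *)
Definition dproj1 : 'End(B) := linfun (fun b => (b \o P2)%VF : B).
Definition dproj2 : 'End(B) := linfun (fun b => (b \o P1)%VF : B).

Lemma pairing_dproj1 a b : pairing a (dproj1 b) = pairing (P2 a) b.
Proof.
rewrite linfunE; last by move=> c u v; rewrite comp_lfunDl comp_lfunZl.
by rewrite /pairing comp_lfunE.
Qed.

Lemma pairing_dproj2 a b : pairing a (dproj2 b) = pairing (P1 a) b.
Proof.
rewrite linfunE; last by move=> c u v; rewrite comp_lfunDl comp_lfunZl.
by rewrite /pairing comp_lfunE.
Qed.

Lemma dproj1_mem b : dproj1 b \in B1.
Proof. by apply/memB1 => a; rewrite !pairing_dproj1 P2_id // P2_mem. Qed.

Lemma dproj2_mem b : dproj2 b \in B2.
Proof. by apply/memB2 => a; rewrite !pairing_dproj2 P1_id // P1_mem. Qed.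

Lemma dproj1_id b : b \in B1 -> dproj1 b = b.
Proof. by move=> /memB1 bB; apply: pairing_ext => a; rewrite pairing_dproj1 bB. Qed.

Lemma dproj2_id b : b \in B2 -> dproj2 b = b.
Proof. by move=> /memB2 bB; apply: pairing_ext => a; rewrite pairing_dproj2 bB. Qed.

Lemma B1_subalgebra : subalgebra B1.
Proof.
apply/subalgebraP; split=> [|b b' bB b'B].
  by apply/memB1 => a; rewrite !pairing1 counit_P2.
apply/memB1; apply: factorization_ext; [lin|lin|] => x y xA yA.
rewrite P2_def // pairing_scale !pairingM sw_mul; last by lin.
transitivity (tlift (fun x1 x2 => (eps x2 : F) *:
   tlift (fun y1 y2 => pairing (x1 * y1) b * pairing y2 b' : F^o) (comul HA y)) (comul HA x)).
  rewrite sw_counitr; last by lin.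
  rewrite -[LHS]/(_ *: _ : F^o) -tliftDZ; apply: eq_tlift => y1 y2.
  by rewrite pairing_B1 // regularE mulrA.
apply: (sw_sub (comul_A1 xA)); [lin|lin|] => x1 x2 _ x2A.
rewrite -tliftDZ; apply: eq_tlift => y1 y2; rewrite (pairing_B1 _ b'B) //.
by rewrite regularE mulrCA.
Qed.

Lemma B2_subalgebra : subalgebra B2.
Proof.
apply/subalgebraP; split=> [|b b' bB b'B].
  by apply/memB2 => a; rewrite !pairing1 counit_P1.
apply/memB2; apply: factorization_ext; [lin|lin|] => x y xA yA.
rewrite P1_def // pairing_scale !pairingM sw_mul; last by lin.
rewrite -[LHS]/(_ *: _ : F^o) -tliftDZ; apply: eq_tlift => x1 x2.
transitivity (tlift (fun y1 y2 => (eps y1 : F) *: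
   (pairing x1 b * pairing (x2 * y2) b' : F^o)) (comul HA y)).
  rewrite (sw_counitl _ (f := fun y2 => pairing x1 b * pairing (x2 * y2) b' : F^o)); last by lin.
  by rewrite pairing_B2 // regularE mulrCA.
apply: (sw_sub (comul_A2 yA)); [lin|lin|] => y1 y2 y1A _.
by rewrite (pairing_B2 _ bB) // regularE mulrA.
Qed.

Lemma B1_coideal_id b : b \in B1 -> tmap id dproj1 (comul HB b) = comul HB b.
Proof.
move=> bB; apply: tens_dual_ext => x y.
rewrite (slice_tmapr (P := P2)); [|lin|lin|exact: pairing_dproj1].
rewrite dual_comul_lfunE !dual_comulE.
move: y; apply: factorization_ext; [lin|lin|] => u v uA vA.
by rewrite P2_def // -scalerAl pairing_scale -mulrA pairing_B1.
Qed.

Lemma B2_coideal_id b : b \in B2 -> tmap dproj2 id (comul HB b) = comul HB b.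
Proof.
move=> bB; apply: tens_dual_ext => x y.
rewrite slice_tmap ?pairing_dproj2; last by lin.
rewrite dual_comul_lfunE !dual_comulE.
move: x; apply: factorization_ext; [lin|lin|] => u v uA vA.
by rewrite P1_def // -scalerAr pairing_scale mulrA pairing_B2.
Qed.

Lemma comul_B1 b : b \in B1 -> comul HB b \in tensv fullv B1.
Proof.
move=> bB; rewrite -(B1_coideal_id bB).
apply: (memv_tmap _ _ _ _ (tensv_full _)) => [||x _|y _]; [lin|lin|exact: memvf|].
exact: dproj1_mem.
Qed.

Lemma comul_B2 b : b \in B2 -> comul HB b \in tensv B2 fullv.
Proof.
move=> bB; rewrite -(B2_coideal_id bB).
apply: (memv_tmap _ _ _ _ (tensv_full _)) => [||x _|y _]; [lin|lin| |exact: memvf].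
exact: dproj2_mem.
Qed.

Lemma B1_coideal : left_coideal HB B1.
Proof. by apply/subvP => _ /memv_imgP[b bB ->]; exact: comul_B1. Qed.

Lemma B2_coideal : right_coideal HB B2.
Proof. by apply/subvP => _ /memv_imgP[b bB ->]; exact: comul_B2. Qed.

Lemma dproj2_left_proj : is_left_proj HB B2 B1 dproj2.
Proof.
move=> b2 b1 b2B b1B; apply: pairing_ext => a.
rewrite pairing_dproj2 pairingM pairingZ counit_dual -[in RHS](memB2 _ b2B).
transitivity (tlift (fun u v => (eps v : F) *: (pairing 1 b1 * pairing u b2 : F^o))
    (comul HA (P1 a))).
  apply: (sw_sub (comul_A1 (P1_mem a))); [lin|lin|] => u v _ vA.
  by rewrite -[v]mulr1 pairing_B1 // mulr1 regularE mulrC -mulrA.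
by rewrite (sw_counitr _ (f := fun u => pairing 1 b1 * pairing u b2 : F^o)) //; lin.
Qed.

Lemma dproj1_right_proj : is_right_proj HB B2 B1 dproj1.
Proof.
move=> b2 b1 b2B b1B; apply: pairing_ext => a.
rewrite pairing_dproj1 pairingM pairingZ counit_dual -[in RHS](memB1 _ b1B).
transitivity (tlift (fun u v => (eps u : F) *: (pairing 1 b2 * pairing v b1 : F^o))
    (comul HA (P2 a))).
  apply: (sw_sub (comul_A2 (P2_mem a))); [lin|lin|] => u v uA _.
  by rewrite -[u]mul1r pairing_B2 // mul1r regularE -mulrA.
by rewrite (sw_counitl _ (f := fun v => pairing 1 b2 * pairing v b1 : F^o)) //; lin.
Qed.

Local Notation r1 := (tmap P1 id r).
Local Notation r2 := (tmap P2 id r).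

Lemma slice_r1 a : slice a r1 = P1 a.
Proof. by rewrite slice_tmap ?slice_canon //; lin. Qed.

Lemma slice_r2 a : slice a r2 = P2 a.
Proof. by rewrite slice_tmap ?slice_canon //; lin. Qed.

(** Under [slice], this is the convolution identity [P1 * P2 = id]. *)
Lemma r1_mul_r2 : r1 * r2 = r.
Proof.
apply: slice_ext => a; rewrite slice_mul slice_canon -[RHS]P1_conv_P2.
by apply: eq_tlift => u v; rewrite slice_r1 slice_r2.
Qed.

Lemma slice_dproj1 (U : vectType F) a (t : tens U B) :
  slice a (tmap id dproj1 t) = slice (P2 a) t.
Proof. by apply: slice_tmapr; [lin|lin|exact: pairing_dproj1]. Qed.

Lemma slice_dproj2 (U : vectType F) a (t : tens U B) :
  slice a (tmap id dproj2 t) = slice (P1 a) t.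
Proof. by apply: slice_tmapr; [lin|lin|exact: pairing_dproj2]. Qed.

Lemma r1_dproj2 : r1 = tmap id dproj2 r.
Proof. by apply: slice_ext => a; rewrite slice_r1 slice_dproj2 slice_canon. Qed.

Lemma r2_dproj1 : r2 = tmap id dproj1 r.
Proof. by apply: slice_ext => a; rewrite slice_r2 slice_dproj1 slice_canon. Qed.

Lemma r1_P1_dproj2 : r1 = tmap P1 dproj2 r.
Proof.
have -> : tmap P1 dproj2 r = tmap P1 id (tmap id dproj2 r) by rewrite tmap_comp //; lin.
apply: slice_ext => a; rewrite slice_r1 slice_tmap; last by lin.
by rewrite slice_dproj2 slice_canon [RHS]P1_id ?P1_mem.
Qed.

Lemma r2_P2_dproj1 : r2 = tmap P2 dproj1 r.
Proof.
have -> : tmap P2 dproj1 r = tmap P2 id (tmap id dproj1 r) by rewrite tmap_comp //; lin.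
apply: slice_ext => a; rewrite slice_r2 slice_tmap; last by lin.
by rewrite slice_dproj1 slice_canon [RHS]P2_id ?P2_mem.
Qed.

Lemma r1_mem : r1 \in tensv A1 B2.
Proof.
rewrite r1_P1_dproj2; apply: (memv_tmap _ _ _ _ (tensv_full r)) => [||x _|y _]; [lin|lin| |].
  exact: P1_mem.
exact: dproj2_mem.
Qed.

Lemma r2_mem : r2 \in tensv A2 B1.
Proof.
rewrite r2_P2_dproj1; apply: (memv_tmap _ _ _ _ (tensv_full r)) => [||x _|y _]; [lin|lin| |].
  exact: P2_mem.
exact: dproj1_mem.
Qed.

Lemma coslice_r1 b : coslice b r1 = dproj2 b.
Proof. by rewrite r1_dproj2 coslice_tmap ?coslice_canon //; lin. Qed.

Lemma coslice_r2 b : coslice b r2 = dproj1 b.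
Proof. by rewrite r2_dproj1 coslice_tmap ?coslice_canon //; lin. Qed.

Lemma pairing_mul_B2_B1 b2 b1 x y : b2 \in B2 -> b1 \in B1 -> x \in A1 -> y \in A2 ->
  pairing (x * y) (b2 * b1) = pairing x b2 * pairing y b1.
Proof.
move=> b2B b1B xA yA; rewrite pairingM sw_mul; last by lin.
transitivity (tlift (fun x1 x2 => (eps x2 : F) *: (pairing x1 b2 * pairing y b1 : F^o))
    (comul HA x)).
  apply: (sw_sub (comul_A1 xA)); [lin|lin|] => x1 x2 _ x2A.
  transitivity (tlift (fun y1 y2 => (eps y1 : F) *:
      (eps x2 * (pairing x1 b2 * pairing y2 b1) : F^o)) (comul HA y)).
    apply: (sw_sub (comul_A2 yA)); [lin|lin|] => y1 y2 y1A _.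
    rewrite pairing_B2 // pairing_B1 // regularE.
    by rewrite mulrACA -!mulrA.
  by rewrite (sw_counitl _ (f := fun y2 => eps x2 * (pairing x1 b2 * pairing y2 b1) : F^o)) //; lin.
by rewrite (sw_counitr _ (f := fun x1 => pairing x1 b2 * pairing y b1 : F^o)) //; lin.
Qed.

(** By [pairing_mul_B2_B1] the tensor [t] is recovered from its product, evaluated at
    the [x * y]. Each [b] is a product because [r = r1 * r2]. *)
Lemma B_factorization : factorization B2 B1.
Proof.
pose m := tlift (fun a b : B => a * b).
have mE t : linfun m t = m t by rewrite linfunE //; exact: lin_lift.
split.
  move=> s t sB tB; rewrite !mE => est.
  have sl t' x y : t' \in tensv B2 B1 -> pairing x (slice y t') =
      pairing (P1 x * P2 y) (m t').
    move: t'; apply: tensv_ext; [lin|rewrite /m; lin|] => b2 b1 b2B b1B.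
    rewrite /m tliftE; last by lin.
    rewrite pairing_mul_B2_B1 ?P1_mem ?P2_mem // (memB2 _ b2B) (memB1 _ b1B).
    by rewrite sliceE pairingZ mulrC.
  by apply: tens_dual_ext => x y; rewrite !sl // est.
apply/eqP; rewrite eqEsubv subvf /=; apply/subvP => b _; apply/memv_imgP.
exists (tlift (fun b1 b2 => dproj2 b2 \ox dproj1 b1) (comul HB b)).
  move: (comul HB b) => t; rewrite /tlift.
  apply: rpred_sum => i _; apply: rpred_sum => j _; rewrite rpredZ //.
  by apply: memv_tensv; [exact: dproj2_mem|exact: dproj1_mem].
rewrite mE /m tlift_comp; last by exact: lin_lift.
transitivity (coslice b (r1 * r2)); first by rewrite r1_mul_r2 coslice_canon.
rewrite coslice_mul; apply: eq_tlift => b1 b2.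
by rewrite coslice_r1 coslice_r2 tliftE //; lin.
Qed.
End Factorization.

(** * Hopf subalgebras *)

Lemma tmap_can (F : fieldType) (U V U' V' : vectType F) (f : U -> U') (g : V -> V')
    (f' : U' -> U) (g' : V' -> V) : linear f -> linear g -> linear f' -> linear g' ->
  cancel f f' -> cancel g g' -> cancel (tmap f g) (tmap f' g').
Proof.
move=> lf lg lf' lg' fK gK t; rewrite tmap_comp // -[RHS]tmap_id.
exact: eq_tmap.
Qed.

Section SubAntipode.
Variables (F : fieldType) (D : falgType F) (H : hopf D) (U : {vspace D}).
Hypotheses (U_subalg : subalgebra U) (U_comul : (comul H @: U <= tensv U U)%VS).
Local Notation S := (antipode H).

(** The Galois map [a (x) b |-> a1 (x) a2 b] and its inverse [a (x) b |-> a1 (x) S(a2) b]. *)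
Definition galois : tens D D -> tens D D :=
  tlift (fun a b => tlift (fun x y => x \ox (y * b)) (comul H a)).
Definition galois_inv : tens D D -> tens D D :=
  tlift (fun a b => tlift (fun x y => x \ox (S y * b)) (comul H a)).

Lemma galoisK : cancel galois galois_inv.
Proof.
have lg : linear galois by exact: lin_lift.
have lgi : linear galois_inv by exact: lin_lift.
apply: tens_ext => [||a b]; [lin|lin|].
rewrite [galois _]tliftE; last by lin.
rewrite tlift_comp //.
transitivity (tlift (fun x y => tlift (fun u v => u \ox (S v * y * b)) (comul H x))
    (comul H a)).
  apply: eq_tlift => x y; rewrite [LHS]tliftE; last by lin.
  by apply: eq_tlift => u v; rewrite mulrA.
rewrite (sw_coassoc _ (f := fun u v y => u \ox (S v * y * b))); last by lin.
transitivity (tlift (fun x y => (counit H y : F) *: (x \ox b)) (comul H a)).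
  apply: eq_tlift => x y; rewrite -(tlift_comp (L := fun z => x \ox (z * b))); last by lin.
  by rewrite antipodel mulr_algl pureZr.
by rewrite (sw_counitr H (f := fun x => x \ox b)) //; lin.
Qed.

(** The Galois map preserves the tensor square of a subbialgebra, hence so does its
    inverse, by finiteness of the dimension; and the inverse sends [a (x) 1] to
    [a1 (x) S a2], whose second leg determines [S a]. *)
Lemma subbialgebra_antipode : (S @: U <= U)%VS.
Proof.
have /subalgebraP[U1 UM] := U_subalg.
have lg : linear galois by exact: lin_lift.
have lgi : linear galois_inv by exact: lin_lift.
have gE := linfunE lg.
have /eqP gUU : (linfun galois @: tensv U U == tensv U U)%VS.
  rewrite eqEdim limg_dim_eq; last first.
    apply/eqP; rewrite -subv0; apply/subvP => t /memv_capP[_].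
    rewrite memv_ker gE memv0 => /eqP t0.
    by rewrite -(galoisK t) t0 (lin0 lgi).
  rewrite leqnn andbT; apply/subvP => _ /memv_imgP[t tU ->]; rewrite gE.
  move: t tU; apply: tensv_mem => // a b aU bU; rewrite /galois tliftE; last by lin.
  have : comul H a \in tensv U U by apply: (subvP U_comul); apply: memv_img.
  move: (comul H a); apply: tensv_mem => [|x y xU yU]; first by lin.
  by rewrite tliftE ?memv_tensv ?UM //; lin.
apply/subvP => _ /memv_imgP[a aU ->].
have /memv_imgP[t tU] : a \ox 1 \in (linfun galois @: tensv U U)%VS.
  by rewrite gUU memv_tensv.
rewrite gE => /(congr1 galois_inv); rewrite galoisK => tE.
have <- : tlift (fun x y => (counit H x : F) *: y) t = S a.
  rewrite -tE /galois_inv [tlift _ (a \ox 1)]tliftE; last by lin.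
  rewrite (tlift_comp (L := tlift _)); last by exact: lin_lift.
  rewrite -[RHS](@sw_counitl _ _ H _ S a); last by lin.
  by apply: eq_tlift => x y; rewrite tliftE ?mulr1 //; lin.
move: t tU {tE}; apply: tensv_mem => [|x y xU yU]; first by lin.
by rewrite tliftE ?rpredZ //; lin.
Qed.
End SubAntipode.

Section SubHopf.
Variables (F : fieldType) (D : falgType F) (H : hopf D) (U : {aspace D}).
Hypothesis U_hopf : hopf_subalgebra H U.
Local Notation X := (subvs_of U).
Local Notation S := (antipode H).

Let U1 : 1 \in U.
Proof. by have /and3P[/subalgebraP[]] := U_hopf. Qed.
Let U_comul : {in U, forall x, comul H x \in tensv U U}.
Proof.
by have /and3P[_ /subvP sU _] := U_hopf; move=> x xU; apply/sU/memv_img.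
Qed.
Let U_antipode : {in U, forall x, S x \in U}.
Proof.
by have /and3P[_ _ /subvP sU] := U_hopf; move=> x xU; apply/sU/memv_img.
Qed.

(** The unit of the algebra [subvs_of U] is that of [U], which is [1] as [1] lies in [U]. *)
Lemma vsval_alg : alg_morph (@vsval _ _ U : X -> D).
Proof.
split=> [|x y|]; [lin|by []|].
by rewrite -[LHS]/(algid U); apply/eqP; rewrite algid_eq1.
Qed.

Local Notation vv := (tmap (@vsval _ _ U) (@vsval _ _ U)).
Local Notation pp := (tmap (vsproj U) (vsproj U)).

Definition sub_comul_fun (x : X) : tens X X := pp (comul H (vsval x)).

Lemma vsval_sub_comul x : vv (sub_comul_fun x) = comul H (vsval x).
Proof. exact/tmap_vsvalK/U_comul/subvsP. Qed.

Lemma vv_alg : alg_morph vv.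
Proof. exact: alg_morph_tmap vsval_alg vsval_alg. Qed.

Lemma sub_comul_alg : alg_morph sub_comul_fun.
Proof.
have inj := @tmap_vsval_inj _ _ _ U U.
split=> [|x y|]; first by rewrite /sub_comul_fun; lin.
  apply: inj; rewrite (algM vv_alg) !vsval_sub_comul.
  by rewrite (algM vsval_alg) rmorphM.
by apply: inj; rewrite (alg1 vv_alg) vsval_sub_comul (alg1 vsval_alg) rmorph1.
Qed.

Definition sub_comul : 'AHom(X, tens X X) := ahom_of sub_comul_alg.

Lemma vv_comul x : vv (sub_comul x) = comul H (vsval x).
Proof. by rewrite ahom_ofE vsval_sub_comul. Qed.

Definition sub_counit : 'AHom(X, F^o) :=
  ahom_of (alg_morph_comp (ahom_alg (counit H)) vsval_alg).

Lemma sub_counitE x : sub_counit x = counit H (vsval x).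
Proof. exact: ahom_ofE. Qed.

Lemma vsval_inj' : injective (@vsval _ _ U). Proof. exact: val_inj. Qed.

Lemma sub_comulA x :
  tassoc (tmap id sub_comul (sub_comul x)) = tmap sub_comul id (sub_comul x).
Proof.
have vK := @vsvalK _ _ U.
have vv3 : injective (tmap vv (@vsval _ _ U)).
  apply: (can_inj (g := tmap pp (vsproj U))); apply: tmap_can => //; try by lin.
  by apply: tmap_can => //; lin.
apply: vv3; rewrite -tassoc_tmap; try by lin.
rewrite !tmap_comp; try by lin.
transitivity (tassoc (tmap id (comul H) (vv (sub_comul x)))).
  congr tassoc; rewrite tmap_comp; try by lin.
  by apply: eq_tmap => // y; rewrite vv_comul.
rewrite vv_comul comulA -vv_comul tmap_comp; try by lin.
by apply: eq_tmap => // y; rewrite vv_comul.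
Qed.

Lemma sub_tlift (W : vectType F) (f : D -> D -> W) x : bilin f ->
  tlift f (comul H (vsval x)) =
  tlift (fun u v => f (vsval u) (vsval v)) (sub_comul x).
Proof. by move=> bf; rewrite -vv_comul tlift_tmap. Qed.

Lemma sub_counitl x : tlift (fun a b => (sub_counit a : F) *: b) (sub_comul x) = x.
Proof.
apply: vsval_inj'; rewrite -[RHS](counitl H) sub_tlift; last by lin.
rewrite tlift_comp; last by lin.
by apply: eq_tlift => a b; rewrite linearZ /= sub_counitE.
Qed.

Lemma sub_counitr x : tlift (fun a b => (sub_counit b : F) *: a) (sub_comul x) = x.
Proof.
apply: vsval_inj'; rewrite -[RHS](counitr H) sub_tlift; last by lin.
rewrite tlift_comp; last by lin.
by apply: eq_tlift => a b; rewrite linearZ /= sub_counitE.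
Qed.

Definition sub_antipode : 'End(X) := linfun (fun x => vsproj U (S (vsval x))).

Lemma sub_antipodeE x : vsval (sub_antipode x) = S (vsval x).
Proof.
rewrite linfunE; last by lin.
by rewrite vsprojK // U_antipode // subvsP.
Qed.

Definition sub_bialgebra : bialgebra X := Bialgebra sub_comulA sub_counitl sub_counitr.

Lemma sub_antipodel x :
  tlift (fun a b => sub_antipode a * b) (sub_comul x) = (sub_counit x : F)%:A.
Proof.
apply: vsval_inj'; rewrite (linZ (alg_lin vsval_alg)) (alg1 vsval_alg) sub_counitE -antipodel.
rewrite sub_tlift ?tlift_comp; try by lin.
by apply: eq_tlift => a b; rewrite (algM vsval_alg) sub_antipodeE.
Qed.

Lemma sub_antipoder x :
  tlift (fun a b => a * sub_antipode b) (sub_comul x) = (sub_counit x : F)%:A.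
Proof.
apply: vsval_inj'; rewrite (linZ (alg_lin vsval_alg)) (alg1 vsval_alg) sub_counitE -antipoder.
rewrite sub_tlift ?tlift_comp; try by lin.
by apply: eq_tlift => a b; rewrite (algM vsval_alg) sub_antipodeE.
Qed.

Definition sub_hopf : hopf X :=
  @Hopf _ _ sub_bialgebra sub_antipode sub_antipodel sub_antipoder.

Definition sub_incl : 'AHom(X, D) := ahom_of vsval_alg.

Lemma sub_inclE x : sub_incl x = vsval x.
Proof. exact: ahom_ofE. Qed.

Lemma sub_incl_embeds : embeds_onto sub_hopf H sub_incl U.
Proof.
split.
- split=> x; rewrite sub_inclE; last exact/esym/sub_counitE.
  by rewrite -[RHS](eq_tmap _ (fun y => esym (sub_inclE y)) (fun y => esym (sub_inclE y))) vv_comul.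
- by apply/eqP/lker0P => x y; rewrite !sub_inclE; exact: vsval_inj'.
apply/eqP; rewrite eqEsubv; apply/andP; split; apply/subvP => x.
  by move=> /memv_imgP[y _ ->]; rewrite sub_inclE subvsP.
by move=> xU; rewrite -(vsprojK xU) -sub_inclE; apply: memv_img; exact: memvf.
Qed.
End SubHopf.

(** * The Hopf algebra map out of the dual defined by an R-matrix *)

Section RMatrixPairing.
Variables (F : fieldType) (D : falgType F) (H : hopf D) (U : {aspace D}).
Hypothesis U_hopf : hopf_subalgebra H U.
Variable R : tens D D.
Hypotheses (R_qt : quasitriangular H R) (R_U : R \in tensv U fullv).
Hypothesis R_counitl : place (fun a => (counit H a : F)%:A) id R = (1 : D).
Hypothesis R_counitr : place id (fun a => (counit H a : F)%:A) R = (1 : D).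
Hypothesis S_inj : lker (antipode H) == 0%VS.
Local Notation X := (subvs_of U).
Local Notation HX := (sub_hopf U_hopf).
Local Notation incl := (sub_incl U_hopf).

(** [R] regarded as an element of [X (x) D], for [X] the algebra [U] on its own. *)
Definition corestr_R : tens X D := tmap (vsproj U) id R.
Local Notation RX := corestr_R.

Let va := vsval_alg U_hopf.
Let vl : linear (@vsval _ _ U) := alg_lin va.

Lemma vsval_corestr : tmap vsval id RX = R.
Proof.
rewrite /corestr_R; move: R R_U; apply: tensv_ext => [||a b aU _]; [lin|lin|].
by rewrite !tmapE ?vsprojK //; lin.
Qed.

Lemma RX_tlift (W : vectType F) (f : D -> D -> W) : bilin f ->
  tlift f R = tlift (fun x d => f (vsval x) d) RX.
Proof. by move=> bf; rewrite -{1}vsval_corestr tlift_tmap. Qed.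

Lemma vsval_id_inj (V : vectType F) : injective (tmap (@vsval _ _ U) (id : V -> V)).
Proof.
apply: (can_inj (g := tmap (vsproj U) id)); apply: tmap_can => //; try by lin.
exact: vsvalK.
Qed.

Lemma RX_comul_id : tmap (comul HX) id RX =
  tlift (fun p q => (p \ox 1) \ox q) RX * tlift (fun p q => (1 \ox p) \ox q) RX.
Proof.
have inj : injective (tmap (tmap (@vsval _ _ U) (@vsval _ _ U)) (id : D -> D)).
  apply: (can_inj (g := tmap (tmap (vsproj U) (vsproj U)) id)).
  apply: tmap_can => //; try by lin.
  by apply: tmap_can => //; try lin; exact: vsvalK.
have aa := alg_morph_tmap (alg_morph_tmap va va) (alg_morph_id D).
apply: inj; rewrite (algM aa) tmap_comp; try by lin.
rewrite ![in RHS]tmap_tlift.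
have [_ _ Rc _] := R_qt; transitivity (comul_id H R).
  rewrite -vsval_corestr /comul_id tmap_comp; try by lin.
  by apply: eq_tmap => // x; exact: vv_comul.
rewrite Rc /leg13 /leg23 !RX_tlift; try by lin.
congr (_ * _); apply: eq_tlift => p q.
  by rewrite !tmapE ?(alg1 va) //; lin.
by rewrite !tmapE ?(alg1 va) //; lin.
Qed.

Lemma RX_id_comul : tassoc (tmap id (comul H) RX) =
  tlift (fun p q => (p \ox 1) \ox q) RX * tlift (fun p q => (p \ox q) \ox 1) RX.
Proof.
have inj : injective (tmap (tmap (@vsval _ _ U) (id : D -> D)) (id : D -> D)).
  apply: (can_inj (g := tmap (tmap (vsproj U) id) id)).
  apply: tmap_can => //; try by lin.
  by apply: tmap_can => //; try lin; exact: vsvalK.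
have aa := alg_morph_tmap (alg_morph_tmap va (alg_morph_id D)) (alg_morph_id D).
apply: inj; rewrite (algM aa) -tassoc_tmap; try by lin.
rewrite ![in RHS]tmap_tlift.
have [_ _ _ Rc] := R_qt; transitivity (id_comul H R).
  rewrite -vsval_corestr /id_comul !tmap_comp; try by lin.
  by congr tassoc; apply: eq_tmap => // x; rewrite tmap_id.
have e12 : leg12 R = tlift (fun a b => (a \ox b) \ox 1) R.
  by rewrite -[in LHS](tens_sum R) /leg12 (tlift_comp (L := fun t => t \ox 1)) //; lin.
rewrite Rc e12 /leg13 !RX_tlift; try by lin.
congr (_ * _); apply: eq_tlift => p q.
  by rewrite !tmapE ?(alg1 va) //; lin.
by rewrite !tmapE //; lin.
Qed.

Definition pair_map_fun (y : dual HX) : D := coslice y RX.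

Lemma lin_pair_map : linear pair_map_fun.
Proof. by rewrite /pair_map_fun /coslice; lin. Qed.

(** The product of the dual is dual to the coproduct of [X], so multiplicativity is the
    identity for [(comul (x) id) R] with its first two legs paired with [y] and [y']. *)
Lemma pair_map_alg : alg_morph pair_map_fun.
Proof.
split; first exact: lin_pair_map.
  move=> y y'; rewrite /pair_map_fun.
  pose E := tlift (fun s (q : D) =>
     (tlift (fun u v : X => pairing u y * pairing v y' : F^o) s : F) *: q).
  have lE : linear E by exact: lin_lift.
  have EE u v q : E ((u \ox v) \ox q) = (pairing u y * pairing v y' : F) *: q.
    by rewrite /E tliftE ?tliftE //; lin.
  transitivity (E (tmap (comul HX) id RX)).
    rewrite /E tlift_tmap; last by lin.
    by apply: eq_tlift => x d; rewrite pairingM.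
  rewrite RX_comul_id.
  suff gen s t : E (tlift (fun p q => (p \ox 1) \ox q) s *
      tlift (fun p q => (1 \ox p) \ox q) t) = coslice y s * coslice y' t by exact: gen.
  have [lc lc'] := (@lin_coslice _ _ HX D y, @lin_coslice _ _ HX D y').
  move: s; apply: tens_ext => [||p q]; [lin|lin|].
  move: t; apply: tens_ext => [||p' q']; [lin|lin|].
  rewrite !tliftE; try by lin.
  rewrite !pureM mulr1 mul1r EE !coslice_pure.
  by rewrite -scalerAl -scalerAr scalerA.
rewrite -R_counitl /pair_map_fun /place RX_tlift; last by lin.
by apply: eq_tlift => x d; rewrite mulr_algl pairing1 sub_counitE.
Qed.

Definition pair_map : 'AHom(dual HX, D) := ahom_of pair_map_alg.

Lemma pair_mapE y : pair_map y = coslice y RX. Proof. exact: ahom_ofE. Qed.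

(** The coproduct of the dual is the opposite of the transpose of the product of [X],
    in accordance with the order of the factors of [(id (x) comul) R]. *)
Lemma pair_map_morph : bialg_morph (dual_cop HX) H pair_map.
Proof.
split=> y.
  pose G := tlift (fun s (q : D) =>
    tlift (fun (p : X) (d : D) => (pairing p y : F) *: (d \ox q)) s).
  have lG : linear G by exact: lin_lift.
  have GE p d q : G ((p \ox d) \ox q) = (pairing p y : F) *: (d \ox q).
    by rewrite /G tliftE ?tliftE //; lin.
  rewrite pair_mapE -(coslice_tmap (g := comul H)); last by lin.
  have -> (t : tens X (tens D D)) : coslice y t = G (tassoc t).
    have lc := @lin_coslice _ _ HX (tens D D) y.
    move: t; apply: tens_ext => [||p t]; [lin|lin|].
    rewrite coslice_pure; move: t; apply: tens_ext => [||d q]; [lin|lin|].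
    by rewrite tassoc_pure GE.
  rewrite RX_id_comul.
  transitivity (tlift (fun y1 y2 => coslice y1 RX \ox coslice y2 RX)
      (comul (dual_cop HX) y)); last first.
    by apply: eq_tlift => y1 y2; rewrite !pair_mapE.
  suff gen s t : G (tlift (fun p q => (p \ox 1) \ox q) s *
      tlift (fun p q => (p \ox q) \ox 1) t) =
      tlift (fun y1 y2 => coslice y1 t \ox coslice y2 s) (comul (dual_cop HX) y).
    exact: gen.
  have lc y1 := @lin_coslice _ _ HX D y1.
  move: s; apply: tens_ext => [||p q]; [lin|lin|].
  move: t; apply: tens_ext => [||p' q']; [lin|lin|].
  rewrite !tliftE; try by lin.
  rewrite !pureM mulr1 mul1r GE pairing_mul.
  rewrite (tlift_comp (L := fun k : F^o => (k : F) *: _)); last by lin.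
  apply: eq_tlift => y1 y2; rewrite !coslice_pure.
  by rewrite pureZl pureZr scalerA.
rewrite pair_mapE counit_dual /coslice tlift_comp; last by lin.
transitivity (pairing (tlift (fun x d => (counit H d : F) *: x) RX) y).
  rewrite (tlift_comp (L := fun z => pairing z y)); last by lin.
  by apply: eq_tlift => x d; rewrite pairing_scale linearZ /= mulrC.
congr pairing; apply: vsval_inj'; rewrite (alg1 va) -R_counitr /place RX_tlift; last by lin.
rewrite tlift_comp //; apply: eq_tlift => x d.
by rewrite (linZ vl) mulr_algr.
Qed.

Lemma RX_canonical : RX = tmap id pair_map (canonical_tensor HX).
Proof.
apply: (@coslice_ext _ _ HX) => y.
by rewrite coslice_tmap ?coslice_canon ?pair_mapE //; lin.
Qed.

Lemma pair_map_rmatrix : double_rmatrix incl pair_map = R.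
Proof.
rewrite -vsval_corestr RX_canonical tmap_comp; try by lin.
by apply: eq_tmap => // x; rewrite sub_inclE.
Qed.

(** This is [R * comul x = comul^op x * R], as the canonical tensor of [X] is sent to
    [R] by [pair_map_rmatrix]. *)
Lemma pair_map_crossed : crossed incl pair_map.
Proof.
apply/crossed_R_comul; [lin|lin|] => x; rewrite -RX_canonical.
have aa := alg_morph_tmap va (alg_morph_id D).
apply: (@vsval_id_inj D); rewrite -[tmap vsval id]/(tmap vsval (fun d => d)).
rewrite !(algM aa) vsval_corestr.
have -> : tmap vsval (fun d => d) (tmap id incl (comul HX x)) = comul H (vsval x).
  rewrite tmap_comp; try by lin.
  by rewrite -vv_comul; apply: eq_tmap => // y; rewrite sub_inclE.
have [_ RD _ _] := R_qt; rewrite RD; congr (_ * _).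
rewrite tmap_tlift /tswap sub_tlift; last by lin.
apply: eq_tlift => u v; rewrite tmapE ?sub_inclE //.
Qed.

Lemma sub_antipode_inj : lker (antipode HX) == 0%VS.
Proof.
have /lker0P Si := S_inj; apply/lker0P => x y xy; apply: vsval_inj'; apply: Si.
by rewrite -!(sub_antipodeE U_hopf) xy.
Qed.

Lemma pair_map_rule a b : pair_map b * incl a = double_rule incl pair_map a b.
Proof.
rewrite double_ruleE; [|lin|lin].
apply: (crossed_rule (T := (antipode HX)^-1%VF)) => //; try by lin.
  exact: antipodeV_l sub_antipode_inj.
exact: pair_map_crossed.
Qed.

End RMatrixPairing.

(** * The twisted double *)

Lemma intertwine_factor (W : unitRingType) (u1 u2 x x' : W) :
  u1 \is a GRing.unit -> u2 \is a GRing.unit -> (u1 * u2) * x = x' * (u1 * u2) ->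
  u2 * x * u2^-1 = u1^-1 * x' * u1.
Proof.
move=> U1 U2 e; apply: (mulrI U1); apply: (mulIr U2).
by rewrite !mulrA mulrV // mul1r mulrVK // -[RHS]mulrA.
Qed.

Lemma conj_mem (F : fieldType) (D : falgType F) (U : {vspace D}) (u x : D) :
  subalgebra U -> u \in U -> u \is a GRing.unit -> x \in U ->
  u * x * u^-1 \in U /\ u^-1 * x * u \in U.
Proof.
move=> sU uU uu xU; have /subalgebraP[_ UM] := sU.
have uV := subalgebra_inv sU uU uu.
by split; rewrite !UM.
Qed.

Lemma subalgebra_prodv (F : fieldType) (D : falgType F) (U V : {vspace D}) :
  subalgebra U -> subalgebra V -> (V * U <= U * V)%VS -> subalgebra (U * V)%VS.
Proof.
move=> /andP[U1 UU] /andP[V1 VV] VU; apply/andP; split.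
  by rewrite -[1]mulr1 memv_mul.
have -> : (U * V * (U * V) = U * (V * U) * V)%VS by rewrite !prodvA.
apply: (subv_trans (prodvSl V (prodvSr U VU))).
have -> : (U * (U * V) * V = U * U * (V * V))%VS by rewrite !prodvA.
exact: prodvS.
Qed.

Lemma subalgebra_full (F : fieldType) (D : falgType F) : subalgebra {:D}%VS.
Proof. by rewrite /subalgebra memvf subvf. Qed.

Lemma subalgebra_img (F : fieldType) (A D : falgType F) (f : 'AHom(A, D))
    (U : {vspace A}) : subalgebra U -> subalgebra (f @: U)%VS.
Proof.
move=> /subalgebraP[U1 UM]; apply/subalgebraP; split.
  by rewrite -(rmorph1 f) memv_img.
move=> _ _ /memv_imgP[x xU ->] /memv_imgP[y yU ->].
by rewrite -rmorphM memv_img // UM.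
Qed.

Lemma lker0_surj (F : fieldType) (U V : vectType F) (f : 'Hom(U, V)) :
  limg f = fullv -> (\dim {:U} <= \dim {:V})%N -> lker f == 0%VS.
Proof.
move=> lf; have := limg_ker_dim f fullv; rewrite lf capfv => <-.
by rewrite -{2}[\dim {:V}]add0n leq_add2r leqn0 dimv_eq0.
Qed.

Section DoubleAntipode.
Variables (F : fieldType) (A D : falgType F) (HA : hopf A) (HD : hopf D).
Variables (iA : 'AHom(A, D)) (iB : 'AHom(dual HA, D)).
Hypothesis dD : is_double HA HD iA iB.
Local Notation B := (dual HA).
Local Notation S := (antipode HA).

Lemma antipode_double_A a : antipode HD (iA a) = iA (S a).
Proof.
have [mA eA] := double_morphA dD.
move: a; apply: (conv_inv_uniq (HC := HA) (g := iA)) => [||| a|a]; try by lin.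
  by rewrite -eA -antipodel mA tlift_tmap //; lin.
rewrite -[RHS](rmorph_alg iA) -antipoder [RHS]tlift_comp; last by lin.
by apply: eq_tlift => x y; rewrite rmorphM.
Qed.

(** On the dual with opposite coproduct the transpose of [S] is a skew antipode. *)
Lemma antipode_double_B (b : B) : antipode HD (iB ((b \o S)%VF : B)) = iB b.
Proof.
have [mB eB] := double_morphB dD.
pose sg (b : B) : B := (b \o S)%VF.
have lsg : linear sg by move=> c u v; rewrite /sg comp_lfunDl comp_lfunZl.
have sgE a b' : pairing a (sg b') = pairing (S a) b' by rewrite /pairing comp_lfunE.
rewrite -[(b \o S)%VF]/(sg b).
apply: (antipode_skew (HC := dual_cop HA) (f := iB) (g := fun b => iB (sg b))) => //; try by lin.
move=> c; transitivity (iB (tlift (fun x y => y * sg x) (comul (dual_cop HA) c))).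
  by rewrite tlift_comp; [apply: eq_tlift => x y; rewrite rmorphM|lin].
rewrite -[RHS](rmorph_alg iB); congr (iB _); apply: pairing_ext => a.
rewrite pairingZ pairing1 counit_dual tlift_comp; last by lin.
rewrite mulrC -pairing_scale -antipoder.
rewrite [RHS](tlift_comp (L := fun z => pairing z c)); last by lin.
transitivity (tlift (fun x y => tlift (fun u v => pairing u y * pairing (S v) x : F^o)
   (comul HA a)) (comul (dual_cop HA) c)).
  by apply: eq_tlift => x y; rewrite pairingM; apply: eq_tlift => u v; rewrite sgE.
rewrite tlift_exch; apply: eq_tlift => u v; rewrite pairing_mul.
by apply: eq_tlift => x y; rewrite mulrC.
Qed.

(** The antipode is onto, as it sends [iB (b o S) * iA (T a)] to [iA a * iB b]. *)
Lemma antipode_double_inj : lker (antipode HD) == 0%VS.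
Proof.
apply: lker0_surj => //; apply/eqP; rewrite eqEsubv subvf; apply/subvP => x _.
suff -> : x = projv (limg (antipode HD)) x by exact: memv_proj.
move: x; apply: (double_ext dD) => [||a b]; [lin|lin|].
rewrite projv_id // -(double_antipodeK dD a) -antipode_double_A -antipode_double_B.
by rewrite -antipodeM memv_img ?memvf.
Qed.
End DoubleAntipode.

Section ConvolutionSupport.
Variables (F : fieldType) (C C' W : falgType F).
Variables (HC : bialgebra C) (HC' : bialgebra C').

Lemma conv_mem (f g : C -> C' -> W) a b (X Y : {vspace C}) (X' Y' : {vspace C'})
    (Z : {vspace W}) : bilin f -> bilin g ->
  comul HC a \in tensv X Y -> comul HC' b \in tensv X' Y' ->
  (forall x y x' y', x \in X -> y \in Y -> x' \in X' -> y' \in Y' ->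
    f x x' * g y y' \in Z) -> conv2 HC HC' f g a b \in Z.
Proof.
move=> bf bg aXY bXY fgZ; rewrite /conv2; move: (comul HC a) aXY.
apply: tensv_mem => [|x y xX yY]; first by lin.
rewrite tliftE; last by lin.
move: (comul HC' b) bXY; apply: tensv_mem => [|x' y' xX' yY']; first by lin.
by rewrite tliftE ?fgZ //; lin.
Qed.

Lemma conv_sub (f g f' g' : C -> C' -> W) a b (X Y : {vspace C}) (X' Y' : {vspace C'}) :
  bilin f -> bilin g -> bilin f' -> bilin g' ->
  comul HC a \in tensv X Y -> comul HC' b \in tensv X' Y' ->
  (forall x y x' y', x \in X -> y \in Y -> x' \in X' -> y' \in Y' ->
    f x x' * g y y' = f' x x' * g' y y') -> conv2 HC HC' f g a b = conv2 HC HC' f' g' a b.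
Proof.
move=> bf bg bf' bg' aXY bXY e; rewrite /conv2; move: (comul HC a) aXY.
apply: tensv_ext => [||x y xX yY]; [lin|lin|].
rewrite !tliftE; [|lin|lin].
move: (comul HC' b) bXY; apply: tensv_ext => [||x' y' xX' yY']; [lin|lin|].
by rewrite !tliftE ?e //; lin.
Qed.

End ConvolutionSupport.

Lemma dim_limg_leq (F : fieldType) (U V : vectType F) (f : 'Hom(U, V)) (X : {vspace U}) :
  (\dim (f @: X) <= \dim X)%N.
Proof. by rewrite -(limg_ker_dim f X) leq_addl. Qed.

Section TwistOfDouble.
Variables (F : fieldType) (A D : falgType F) (HA : hopf A) (HD : hopf D).
Variables (A1 A2 : {vspace A}).
Hypotheses (A1_subalg : subalgebra A1) (A2_subalg : subalgebra A2).
Hypothesis A_fact : factorization A1 A2.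
Hypotheses (A1_coideal : left_coideal HA A1) (A2_coideal : right_coideal HA A2).
Variables (P1 P2 : 'End(A)).
Hypotheses (P1_def : is_left_proj HA A1 A2 P1) (P2_def : is_right_proj HA A1 A2 P2).
Variables (iA : 'AHom(A, D)) (iB : 'AHom(dual HA, D)).
Hypothesis dD : is_double HA HD iA iB.
Local Notation B := (dual HA).
Local Notation HB := (dual_cop HA).
Local Notation eps := (counit HA).
Local Notation r := (canonical_tensor HA).
Local Notation r1 := (tmap P1 id r).
Local Notation r2 := (tmap P2 id r).
Local Notation R := (double_rmatrix iA iB).
Local Notation R1 := (tmap iA iB r1).
Local Notation R2 := (tmap iA iB r2).
Local Notation B1 := (perp HA (augmentation HA A1 * A2)%VS).
Local Notation B2 := (perp HA (A1 * augmentation HA A2)%VS).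
Local Notation dproj1 := (@dproj1 F A HA P2).
Local Notation dproj2 := (@dproj2 F A HA P1).

Let P1K := P1_id A2_subalg P1_def.
Let P2K := P2_id A1_subalg P2_def.
Let P1in := P1_mem A_fact P1_def.
Let P2in := P2_mem A_fact P2_def.
Let r12 := r1_mul_r2 A1_subalg A2_subalg A_fact A1_coideal A2_coideal P1_def P2_def.
Let P2l := P2_mull A1_subalg A_fact P2_def.
Let dproj1K := dproj1_id A1_subalg A_fact P2_def.
Let dproj2K := dproj2_id A2_subalg A_fact P1_def.
Let R_qt := double_quasitriangular dD.

Lemma R1_mul_R2 : R1 * R2 = R.
Proof.
have aAB := alg_morph_tmap (ahom_alg iA) (ahom_alg iB).
by rewrite -(algM aAB) r12.
Qed.

Lemma R2_unit : R2 \is a GRing.unit.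
Proof.
have [uR _ _ _] := R_qt; have e : (R^-1 * R1) * R2 = 1.
  by rewrite -mulrA R1_mul_R2 mulVr.
have [_ e'] := mulr1_unit e; exact: (mulr1_unit e').1.
Qed.

Lemma R1_unit : R1 \is a GRing.unit.
Proof.
have [uR _ _ _] := R_qt; have e : R1 * (R2 * R^-1) = 1.
  by rewrite mulrA R1_mul_R2 mulrV.
exact: (mulr1_unit e).1.
Qed.

Local Notation RAD := (tmap id iB r : tens A D).
Local Notation R2AD := (tmap P2 iB r : tens A D).
Local Notation comulAD a := (tmap id iA (comul HA a) : tens A D).

Let aiB : alg_morph (tmap (id : A -> A) iB) := alg_morph_tmap (alg_morph_id A) (ahom_alg iB).

(** [P2] only sees the left factors in [A1] through their counit. *)
Lemma P2_tens_mul s (t : tens A D) : s \in tensv A1 fullv ->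
  tmap P2 id (s * t) = (1 \ox coslice (1 : B) s) * tmap P2 id t.
Proof.
have lc := @lin_coslice _ _ HA D 1.
move: s; apply: tensv_ext => [||x d xA _]; [lin|lin|].
move: t; apply: tens_ext => [||a d']; [lin|lin|].
rewrite coslice_pure pairing1 pureM !tmapE; try by lin.
by rewrite pureM mul1r P2l // pureZl -scalerAl pureZr.
Qed.

(** In [R * comul y = comul^op y * R], apply [P2] to the first leg. On the left, the
    factor [R1] of [R] disappears and the rest, which lies in [A2 (x) D], is fixed. *)
Lemma R2_comulAD y : y \in A2 -> R2AD * comulAD y =
  tlift (fun u v => (1 \ox iA u) * tmap P2 id ((v \ox 1) * RAD)) (comul HA y).
Proof.
move=> yA.
have RE : RAD = tmap P1 iB r * R2AD.
  rewrite -{1}r12.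
  by rewrite (algM aiB) !tmap_comp //; lin.
have R2m : R2AD \in tensv A2 fullv.
  by apply: (memv_tmap _ _ _ _ (tensv_full r));
    [lin|lin|by move=> *; exact: P2in|by move=> *; exact: memvf].
have R1m : (tmap P1 iB r : tens A D) \in tensv A1 fullv.
  by apply: (memv_tmap _ _ _ _ (tensv_full r));
    [lin|lin|by move=> *; exact: P1in|by move=> *; exact: memvf].
have ym : comulAD y \in tensv A2 fullv.
  by apply: (memv_tmap _ _ _ _ (comul_A2 A2_coideal yA)); [lin|lin|by []|by move=> *; exact: memvf].
have P2m (t : tens A D) : t \in tensv A2 fullv -> tmap P2 id t = t.
  move: t; apply: (tensv_ext (g := id)) => [||x d xA _]; [lin|lin|].
  by rewrite tmapE ?P2K //; lin.
have prod : R2AD * comulAD y \in tensv A2 fullv.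
  have /subalgebraP[_ M] := subalgebra_tensv A2_subalg (subalgebra_full D).
  exact: M.
rewrite -[LHS]P2m //.
have cR1 : coslice (1 : B) (tmap P1 iB r) = (1 : D).
  have -> : tmap P1 iB r = tmap id iB r1 by rewrite tmap_comp //; lin.
  rewrite coslice_tmap; last by lin.
  rewrite coslice_r1 // dproj2K ?rmorph1 //.
  by have /subalgebraP[] := B2_subalgebra A2_subalg A_fact A2_coideal P1_def.
transitivity (tmap P2 id (RAD * comulAD y)).
  by rewrite RE -mulrA [RHS]P2_tens_mul // cR1 mul1r.
have RA := (crossed_R_comul (lin_lfun iA) (lin_lfun iB)).1 (double_crossed dD) y.
rewrite RA (tlift_comp (L := fun t => tmap P2 id (t * RAD))); last by lin.
apply: eq_tlift => u v.
have -> : v \ox iA u = (1 \ox iA u) * (v \ox 1) by rewrite pureM mul1r mulr1.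
rewrite -mulrA [LHS]P2_tens_mul ?memv_tensv ?memvf //.
  by rewrite coslice_pure pairing1 rmorph1 scale1r.
by have /subalgebraP[] := A1_subalg.
Qed.

Let B1_subalg : subalgebra B1 := B1_subalgebra A1_subalg A_fact A1_coideal P2_def.
Let B2_subalg : subalgebra B2 := B2_subalgebra A2_subalg A_fact A2_coideal P1_def.

(** This is the cocycle identity with its third leg paired with [a]. Both sides
    depend on [a] only through [P2 a], and on [A2] it is [R2_comulAD]. *)
Lemma cocycle_slice a : R2AD * comulAD (P2 a) =
  tlift (fun u v => (1 \ox iA (P2 u)) * tmap P2 id ((v \ox 1) * RAD)) (comul HA a).
Proof.
have [f bf fE] : exists2 f : A -> A -> tens A D, bilin f & forall u v,
    f u v = (1 \ox iA (P2 u)) * tmap P2 id ((v \ox 1) * RAD).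
  by eexists; [|by move=> u v; reflexivity]; lin.
have <- : tlift f (comul HA a) =
    tlift (fun u v => (1 \ox iA (P2 u)) * tmap P2 id ((v \ox 1) * RAD)) (comul HA a).
  exact: eq_tlift.
move: a; apply: (factorization_ext A_fact) => [||x y xA yA]; [lin|lin|].
have lg : linear (fun z => R2AD * comulAD z) by lin.
transitivity ((eps x : F) *: (R2AD * comulAD y)).
  by rewrite P2_def //; exact: (linZ lg).
rewrite R2_comulAD // sw_mul //.
transitivity ((counit HA x : F) *: tlift f (comul HA y)).
  congr (_ *: _); apply: (sw_sub (comul_A2 A2_coideal yA)) => // [|u v uA _]; first by lin.
  by rewrite fE P2K.
transitivity (tlift (fun x1 x2 => (eps x2 : F) *:
    tlift (fun y1 y2 => f (x1 * y1) y2) (comul HA y)) (comul HA x)).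
  rewrite sw_counitr; last by lin.
  rewrite -tliftDZ; apply: eq_tlift => y1 y2.
  by rewrite !fE P2l // linearZ pureZr -scalerAl.
apply: (sw_sub (comul_A1 A1_coideal xA)); [lin|lin|] => x1 x2 _ x2A.
rewrite -tliftDZ; apply: eq_tlift => y1 y2; rewrite !fE scalerAr; congr (_ * _).
have -> : (x2 * y2) \ox 1 = (x2 \ox 1) * (y2 \ox 1) :> tens A D.
  by rewrite pureM mulr1.
rewrite -mulrA [RHS]P2_tens_mul ?memv_tensv ?memvf //.
by rewrite coslice_pure pairing1 pureZr -scalerAl mul1r.
Qed.

Lemma R2_cocycle : is_cocycle HD R2.
Proof.
pose W := tens (tens A D) B.
pose phi := tmap (tmap iA (id : D -> D)) iB : W -> tens (tens D D) D.
have aphi : alg_morph phi.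
  exact: alg_morph_tmap (alg_morph_tmap (ahom_alg iA) (alg_morph_id D)) (ahom_alg iB).
pose X : W := tmap (tmap id iB) id (tassoc (tmap id (comul HB) r)).
pose lhs : W := (R2AD \ox 1) * tmap (fun a => comulAD a) id r2.
pose rhs : W := tlift (fun a b => (1 \ox iA a) \ox b) r2 * tmap (tmap P2 id) id X.
have E : lhs = rhs.
  apply: slice_ext => a; rewrite !slice_mul.
  transitivity (R2AD * comulAD (P2 a)).
    transitivity (tlift (fun x y => (eps x : F) *: (R2AD * comulAD (P2 y))) (comul HA a)).
      apply: eq_tlift => x y; rewrite sliceE pairing1 slice_tmap ?slice_r2 -?scalerAl //; lin.
    by rewrite (sw_counitl HA (f := fun y => R2AD * comulAD (P2 y))) //; lin.
  rewrite cocycle_slice; apply: eq_tlift => x y; congr (_ * _).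
    rewrite -[tlift _ r2]/(tmap (fun a => 1 \ox iA a) id r2) slice_tmap ?slice_r2 //; lin.
  rewrite !slice_tmap ?slice_canonical_id_comul; try by lin.
  congr (tmap _ _ _); rewrite (algM aiB) tmapE ?rmorph1 //; lin.
rewrite /is_cocycle.
have [mA eA] := double_morphA dD; have [mB eB] := double_morphB dD.
have e12 : leg12 R2 = phi (R2AD \ox 1).
  rewrite /phi tmapE ?rmorph1; try by lin.
  by rewrite /leg12 !tmap_comp //; lin.
have ec : comul_id HD R2 = phi (tmap (fun a => comulAD a) id r2).
  rewrite /phi /comul_id !tmap_comp; try by lin.
  apply: eq_tmap => // a; rewrite mA !tmap_comp //; lin.
have e23 : leg23 R2 = phi (tlift (fun a b => (1 \ox iA a) \ox b) r2).
  rewrite /phi /leg23 tlift_tmap; last by lin.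
  rewrite tmap_tlift; apply: eq_tlift => a b.
  by rewrite !tmapE ?rmorph1 //; lin.
have ei : id_comul HD R2 = phi (tmap (tmap P2 id) id X).
  rewrite /phi /X !tmap_comp; try by lin.
  transitivity (tmap (tmap (fun a => iA (P2 a)) iB) iB (tassoc (tmap id (comul HB) r))).
    rewrite -tassoc_tmap; try by lin.
    rewrite /id_comul !tmap_comp; try by lin.
    by congr tassoc; apply: eq_tmap => // b; rewrite mB.
  apply: eq_tmap => // t; rewrite !tmap_comp //; lin.
by rewrite e12 ec e23 ei -!(algM aphi) -/lhs -/rhs E.
Qed.

Lemma place_counitl (t : tens A B) :
  place (fun a => (counit HD a : F)%:A) id (tmap iA iB t) = iB (coslice (1 : B) t).
Proof.
have [_ eA] := double_morphA dD.
rewrite /place tlift_tmap; last by lin.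
rewrite /coslice tlift_comp; last by lin.
by apply: eq_tlift => a b; rewrite mulr_algl eA linearZ.
Qed.

Lemma place_counitr (t : tens A B) :
  place id (fun a => (counit HD a : F)%:A) (tmap iA iB t) = iA (slice 1 t).
Proof.
have [_ eB] := double_morphB dD.
rewrite /place tlift_tmap; last by lin.
rewrite /slice tlift_comp; last by lin.
by apply: eq_tlift => a b; rewrite mulr_algr eB counit_dual linearZ.
Qed.

Lemma R2_counitl : place (fun a => (counit HD a : F)%:A) id R2 = (1 : D).
Proof.
rewrite place_counitl coslice_r2 dproj1K ?rmorph1 //.
by have /subalgebraP[] := B1_subalg.
Qed.

Lemma R2_counitr : place id (fun a => (counit HD a : F)%:A) R2 = (1 : D).
Proof.
rewrite place_counitr slice_r2 P2K ?rmorph1 //.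
by have /subalgebraP[] := A2_subalg.
Qed.

Lemma R1_counitl : place (fun a => (counit HD a : F)%:A) id R1 = (1 : D).
Proof.
rewrite place_counitl coslice_r1 dproj2K ?rmorph1 //.
by have /subalgebraP[] := B2_subalg.
Qed.

Lemma R1_counitr : place id (fun a => (counit HD a : F)%:A) R1 = (1 : D).
Proof.
rewrite place_counitr slice_r1 P1K ?rmorph1 //.
by have /subalgebraP[] := A1_subalg.
Qed.

Definition twisted_double : hopf D :=
  twist_hopf R2_unit R2_cocycle R2_counitl R2_counitr.
Local Notation HT := twisted_double.
Local Notation RT := (tswap R2 * R1).

Lemma twisted_comulE x : comul HT x = R2 * comul HD x * R2^-1.
Proof. exact: twist_comulE. Qed.

Lemma twisted_RmatrixE : twist_Rmatrix R R2 = RT.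
Proof.
by rewrite /twist_Rmatrix -R1_mul_R2 -mulrA mulrK // R2_unit.
Qed.

Lemma twisted_qt : quasitriangular HT RT.
Proof. by rewrite -twisted_RmatrixE; exact: twist_quasitriangular. Qed.

Local Notation DA1 := (iA @: A1)%VS.
Local Notation DA2 := (iA @: A2)%VS.
Local Notation DB1 := (iB @: B1)%VS.
Local Notation DB2 := (iB @: B2)%VS.
Local Notation D1 := (DA1 * DB1)%VS.
Local Notation D2 := (DA2 * DB2)%VS.
Local Notation T := (antipode HA)^-1%VF.
Local Notation conv := (@conv2 F A B D HA HB).
Local Notation pairf := (@pair_form F A D HA).
Local Notation skewf := (@skew_form F A D HA T).
Local Notation pAB := (prodAB iA iB).
Local Notation pBA := (prodBA iA iB).

Let bp : bilin pairf. Proof. exact: pair_form_bilin. Qed.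
Let bs : bilin skewf. Proof. by apply: skew_form_bilin; lin. Qed.
Let bAB : bilin pAB. Proof. by apply: prodAB_bilin; lin. Qed.
Let bBA : bilin pBA. Proof. by apply: prodBA_bilin; lin. Qed.
Let cr : conv pairf pBA =2 conv pAB pairf := double_crossed dD.
Let ps : conv pairf skewf =2 @conv2_unit F A B D HA HB :=
  conv_pair_skew D (lin_lfun T) (antipodeV_r (double_antipode_inj dD)).

Let comulA1 x : x \in A1 -> comul HA x \in tensv fullv A1 := @comul_A1 F A HA A1 A1_coideal x.
Let comulA2 x : x \in A2 -> comul HA x \in tensv A2 fullv := @comul_A2 F A HA A2 A2_coideal x.
Let comulB1 b : b \in B1 -> comul HB b \in tensv fullv B1.
Proof. exact: (comul_B1 A1_subalg A_fact P2_def). Qed.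
Let comulB2 b : b \in B2 -> comul HB b \in tensv B2 fullv.
Proof. exact: (comul_B2 A2_subalg A_fact P1_def). Qed.

Let unit_bilin : bilin (@conv2_unit F A B D HA HB).
Proof. by rewrite /conv2_unit; lin. Qed.

(** For [b] in [B1] and [x] in [A1] the right-hand pairing of the cross relation is
    trivial, as [x2] stays in [A1] and [b2] in [B1]; so the relation exchanges [A1]
    and [B1]. On [A2] and [B2] it is the left-hand pairing that is trivial. *)
Lemma cross_D1 x b : x \in A1 -> b \in B1 -> conv pAB pairf x b = pAB x b.
Proof.
move=> xA bB; rewrite -[RHS](conv2_unitr HA HB) //.
apply: (conv_sub _ _ _ _ (comulA1 xA) (comulB1 bB)) => // u v u' v' _ vA _ vB.
congr (_ * _); rewrite /pair_form /conv2_unit counit_dual -[v]mulr1.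
by rewrite (pairing_B1 A1_subalg A_fact P2_def) // mulr1.
Qed.

Lemma cross_D2 x b : x \in A2 -> b \in B2 -> conv pairf pBA x b = pBA x b.
Proof.
move=> xA bB; rewrite -[RHS](conv2_unitl HA HB) //.
apply: (conv_sub _ _ _ _ (comulA2 xA) (comulB2 bB)) => // u v u' v' uA _ uB _.
congr (_ * _); rewrite /pair_form /conv2_unit counit_dual -[u]mul1r.
by rewrite (pairing_B2 A2_subalg A_fact P1_def) // mul1r.
Qed.

Lemma prodBA_conv a b : pBA a b = conv skewf (conv pAB pairf) a b.
Proof.
rewrite -(conv2A HA HB) //.
by apply: crossed_rule (antipodeV_l (double_antipode_inj dD)) cr _ _; lin.
Qed.

Lemma prodAB_conv a b : pAB a b = conv (conv pairf pBA) skewf a b.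
Proof.
rewrite (eq_conv2 HA HB cr (fun x y => erefl (skewf x y))) conv2A //.
by rewrite (eq_conv2 HA HB (fun x y => erefl (pAB x y)) ps) conv2_unitr.
Qed.

Let prod_img (X : {vspace A}) (Y : {vspace B}) (Z : {vspace D}) :
  (forall a b, a \in X -> b \in Y -> iA a * iB b \in Z) -> (iA @: X * iB @: Y <= Z)%VS.
Proof.
by move=> h; apply/prodvP => _ _ /memv_imgP[a aX ->] /memv_imgP[b bY ->]; exact: h.
Qed.
Let prod_img' (X : {vspace A}) (Y : {vspace B}) (Z : {vspace D}) :
  (forall a b, a \in X -> b \in Y -> iB b * iA a \in Z) -> (iB @: Y * iA @: X <= Z)%VS.
Proof.
by move=> h; apply/prodvP => _ _ /memv_imgP[b bY ->] /memv_imgP[a aX ->]; exact: h.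
Qed.

Lemma D1_swap : (DA1 * DB1 = DB1 * DA1)%VS.
Proof.
apply/eqP; rewrite eqEsubv; apply/andP; split.
  apply: prod_img => a b aA bB; rewrite -[_ * _]/(pAB a b) -cross_D1 // -cr.
  apply: (conv_mem _ _ (comulA1 aA) (comulB1 bB)) => // x y x' y' _ yA _ yB.
  by rewrite mulr_algl rpredZ // memv_mul // memv_img.
apply: prod_img' => a b aA bB; rewrite -[_ * _]/(pBA a b) prodBA_conv.
apply: (conv_mem _ _ (comulA1 aA) (comulB1 bB)) => [//||x y x' y' _ yA _ yB].
  exact: conv2_bilin.
by rewrite cross_D1 // mulr_algl rpredZ // memv_mul // memv_img.
Qed.

Lemma D2_swap : (DA2 * DB2 = DB2 * DA2)%VS.
Proof.
apply/eqP; rewrite eqEsubv; apply/andP; split; last first.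
  apply: prod_img' => a b aA bB; rewrite -[_ * _]/(pBA a b) -cross_D2 // cr.
  apply: (conv_mem _ _ (comulA2 aA) (comulB2 bB)) => // x y x' y' xA _ xB _.
  by rewrite mulr_algr rpredZ // memv_mul // memv_img.
apply: prod_img => a b aA bB; rewrite -[_ * _]/(pAB a b) prodAB_conv.
apply: (conv_mem _ _ (comulA2 aA) (comulB2 bB)) => [||x y x' y' xA _ xB _] //.
  exact: conv2_bilin.
by rewrite cross_D2 // mulr_algr rpredZ // memv_mul // memv_img.
Qed.

Let DA1_subalg : subalgebra DA1 := subalgebra_img iA A1_subalg.
Let DA2_subalg : subalgebra DA2 := subalgebra_img iA A2_subalg.
Let DB1_subalg : subalgebra DB1 := subalgebra_img iB B1_subalg.
Let DB2_subalg : subalgebra DB2 := subalgebra_img iB B2_subalg.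

Lemma D1_subalg : subalgebra D1.
Proof. by apply: subalgebra_prodv => //; rewrite D1_swap. Qed.

Lemma D2_subalg : subalgebra D2.
Proof. by apply: subalgebra_prodv => //; rewrite D2_swap. Qed.

Let sub_prodl (U V : {vspace D}) : subalgebra V -> (U <= U * V)%VS.
Proof.
by move=> /subalgebraP[V1 _]; apply/subvP => u uU; rewrite -[u]mulr1 memv_mul.
Qed.
Let sub_prodr (U V : {vspace D}) : subalgebra U -> (V <= U * V)%VS.
Proof.
by move=> /subalgebraP[U1 _]; apply/subvP => v vV; rewrite -[v]mul1r memv_mul.
Qed.

Lemma DA1_D1 : (DA1 <= D1)%VS. Proof. exact: sub_prodl. Qed.
Lemma DB1_D1 : (DB1 <= D1)%VS. Proof. exact: sub_prodr. Qed.
Lemma DA2_D2 : (DA2 <= D2)%VS. Proof. exact: sub_prodl. Qed.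
Lemma DB2_D2 : (DB2 <= D2)%VS. Proof. exact: sub_prodr. Qed.

Lemma R1_mem : R1 \in tensv DA1 DB2.
Proof.
apply: (memv_tmap _ _ _ _ (r1_mem A2_subalg A_fact P1_def)) => [||x xA|y yB].
- by lin.
- by lin.
- exact: memv_img.
- exact: memv_img.
Qed.

Lemma R2_mem : R2 \in tensv DA2 DB1.
Proof.
apply: (memv_tmap _ _ _ _ (r2_mem A1_subalg A_fact P2_def)) => [||x xA|y yB].
- by lin.
- by lin.
- exact: memv_img.
- exact: memv_img.
Qed.

(** Together with the definition, this second form confines both legs of a twisted
    coproduct: [R2] lies in [A2 (x) B1] and [R1] in [A1 (x) B2]. *)
Lemma twisted_comul_op x : comul HT x = R1^-1 * tswap (comul HD x) * R1.
Proof.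
rewrite twisted_comulE; apply: intertwine_factor R1_unit R2_unit _.
by have [_ RD _ _] := R_qt; rewrite R1_mul_R2 RD.
Qed.

Lemma twisted_comul_mem (U V U' V' : {vspace D}) x :
  subalgebra U -> subalgebra V -> subalgebra U' -> subalgebra V' ->
  comul HD x \in tensv U V -> R2 \in tensv U V ->
  tswap (comul HD x) \in tensv U' V' -> R1 \in tensv U' V' ->
  comul HT x \in (tensv U V :&: tensv U' V')%VS.
Proof.
move=> sU sV sU' sV' xUV RUV xUV' RUV'; rewrite memv_cap; apply/andP; split.
  rewrite twisted_comulE.
  exact: (conj_mem (subalgebra_tensv sU sV) RUV R2_unit xUV).1.
rewrite twisted_comul_op.
exact: (conj_mem (subalgebra_tensv sU' sV') RUV' R1_unit xUV').2.
Qed.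

Let comulDA a (X Y : {vspace A}) : comul HA a \in tensv X Y ->
  comul HD (iA a) \in tensv (iA @: X) (iA @: Y).
Proof.
rewrite (double_morphA dD).1; apply: memv_tmap => [||x xX|y yY];
  by [lin|lin|exact: memv_img|exact: memv_img].
Qed.
Let comulDB b (X Y : {vspace B}) : comul HB b \in tensv X Y ->
  comul HD (iB b) \in tensv (iB @: X) (iB @: Y).
Proof.
rewrite (double_morphB dD).1; apply: memv_tmap => [||x xX|y yY];
  by [lin|lin|exact: memv_img|exact: memv_img].
Qed.

Let mono (U U' V V' : {vspace D}) t : t \in tensv U V -> (U <= U')%VS -> (V <= V')%VS ->
  t \in tensv U' V'.
Proof. by move=> tU UU' VV'; apply: (subvP (tensvS UU' VV')). Qed.

Let fullS := @subalgebra_full F D.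

Lemma twisted_comul_DA1 : (comul HT @: DA1 <= tensv DA1 D1)%VS.
Proof.
apply/subvP => _ /memv_imgP[_ /memv_imgP[a aA ->] ->].
have c := comulDA (comulA1 aA).
have /memv_capP[] := twisted_comul_mem fullS D1_subalg DA1_subalg fullS
  (mono c (subvf _) DA1_D1) (mono R2_mem (subvf _) DB1_D1)
  (memv_tswap (mono c (subvf _) (subvv _))) (mono R1_mem (subvv _) (subvf _)).
by move=> h h'; apply: tensv_cap.
Qed.

Lemma twisted_comul_DB1 : (comul HT @: DB1 <= tensv D1 DB1)%VS.
Proof.
apply/subvP => _ /memv_imgP[_ /memv_imgP[b bB ->] ->].
have c := comulDB (comulB1 bB).
have /memv_capP[] := twisted_comul_mem fullS DB1_subalg D1_subalg fullS
  (mono c (subvf _) (subvv _)) (mono R2_mem (subvf _) (subvv _))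
  (memv_tswap (mono c (subvf _) DB1_D1)) (mono R1_mem DA1_D1 (subvf _)).
by move=> h h'; apply: tensv_cap.
Qed.

Lemma twisted_comul_DA2 : (comul HT @: DA2 <= tensv DA2 D2)%VS.
Proof.
apply/subvP => _ /memv_imgP[_ /memv_imgP[a aA ->] ->].
have c := comulDA (comulA2 aA).
have /memv_capP[] := twisted_comul_mem DA2_subalg fullS fullS D2_subalg
  (mono c (subvv _) (subvf _)) (mono R2_mem (subvv _) (subvf _))
  (memv_tswap (mono c DA2_D2 (subvf _))) (mono R1_mem (subvf _) DB2_D2).
by move=> h h'; apply: tensv_cap.
Qed.

Lemma twisted_comul_DB2 : (comul HT @: DB2 <= tensv D2 DB2)%VS.
Proof.
apply/subvP => _ /memv_imgP[_ /memv_imgP[b bB ->] ->].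
have c := comulDB (comulB2 bB).
have /memv_capP[] := twisted_comul_mem D2_subalg fullS fullS DB2_subalg
  (mono c DB2_D2 (subvf _)) (mono R2_mem DA2_D2 (subvf _))
  (memv_tswap (mono c (subvv _) (subvf _))) (mono R1_mem (subvf _) (subvv _)).
by move=> h h'; apply: tensv_cap.
Qed.

Let prodv_comul (U V Z : {vspace D}) : subalgebra Z ->
  (comul HT @: U <= tensv Z Z)%VS -> (comul HT @: V <= tensv Z Z)%VS ->
  (comul HT @: (U * V) <= tensv Z Z)%VS.
Proof.
move=> sZ /subvP sU /subvP sV; have /subalgebraP[_ M] := subalgebra_tensv sZ sZ.
suff /subvP h : (U * V <= comul HT @^-1: tensv Z Z)%VS.
  by apply/subvP => _ /memv_imgP[x /h + ->]; rewrite -memv_preim.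
apply/prodvP => u v uU vV; rewrite -memv_preim rmorphM.
by apply: M; [apply: sU|apply: sV]; exact: memv_img.
Qed.

Let hopf_sub (U V : {vspace D}) : subalgebra (U * V)%VS ->
  (comul HT @: U <= tensv (U * V) (U * V))%VS ->
  (comul HT @: V <= tensv (U * V) (U * V))%VS -> hopf_subalgebra HT (U * V)%VS.
Proof.
move=> sUV cU cV; apply/and3P; split=> //; first exact: prodv_comul.
by apply: subbialgebra_antipode => //; exact: prodv_comul.
Qed.

Lemma D1_hopf : hopf_subalgebra HT D1.
Proof.
apply: hopf_sub; first exact: D1_subalg.
  by apply: subv_trans twisted_comul_DA1 (tensvS DA1_D1 (subvv _)).
by apply: subv_trans twisted_comul_DB1 (tensvS (subvv _) DB1_D1).
Qed.

Lemma D2_hopf : hopf_subalgebra HT D2.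
Proof.
apply: hopf_sub; first exact: D2_subalg.
  by apply: subv_trans twisted_comul_DA2 (tensvS DA2_D2 (subvv _)).
by apply: subv_trans twisted_comul_DB2 (tensvS (subvv _) DB2_D2).
Qed.

Fact D1_is_aspace : is_aspace D1.
Proof. by have /andP[D11 DD] := D1_subalg; rewrite /is_aspace has_algid1. Qed.
Definition D1_aspace : {aspace D} := ASpace D1_is_aspace.

Lemma RT_mem : RT \in tensv D1 D2.
Proof. by rewrite D1_swap; exact: tensvM (memv_tswap R2_mem) R1_mem. Qed.

Lemma RT_mem1 : RT \in tensv D1_aspace fullv.
Proof. exact: mono RT_mem (subvv _) (subvf _). Qed.

Lemma RT_counitl : place (fun a => (counit HT a : F)%:A) id RT = (1 : D).
Proof.
have aS := scalar_counit_alg HD.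
rewrite (algM (counitl_alg HD)) R1_counitl mulr1 place_swap; [exact: R2_counitr|lin|by []|].
exact: commuting_scalar.
Qed.

Lemma RT_counitr : place id (fun a => (counit HT a : F)%:A) RT = (1 : D).
Proof.
rewrite (algM (counitr_alg HD)) R1_counitr mulr1 place_swap; [exact: R2_counitl|by []|lin|].
exact/commuting_sym/commuting_scalar.
Qed.

Local Notation X := (subvs_of D1_aspace).
Local Notation HX := (sub_hopf (U := D1_aspace) D1_hopf).
Local Notation j1 := (sub_incl (U := D1_aspace) D1_hopf).
Definition dual_incl : 'AHom(dual HX, D) :=
  pair_map (U := D1_aspace) D1_hopf twisted_qt RT_mem1 RT_counitl.
Local Notation j2 := dual_incl.

Lemma dual_incl_tlift (W : vectType F) (g : D -> W) y : linear g ->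
  g (j2 y) = tlift (fun p d => (pairing (vsproj D1_aspace p) y : F) *: g d) RT.
Proof.
move=> lg; rewrite /dual_incl pair_mapE /coslice tlift_comp //.
rewrite (RX_tlift (U := D1_aspace) D1_hopf RT_mem1); last by lin.
by apply: eq_tlift => x d; rewrite vsvalK (linZ lg).
Qed.

Lemma tlift_swap_mul (W : vectType F) (f : D -> D -> W) (s t : tens A B) : bilin f ->
  tlift f (tswap (tmap iA iB s) * tmap iA iB t) =
  tlift (fun a b => tlift (fun a' b' => f (iB b * iA a') (iA a * iB b')) t) s.
Proof.
move=> bf; move: s; apply: tens_ext => [||a b]; [lin|lin|].
rewrite [RHS]tliftE; last by lin.
move: t; apply: tens_ext => [||a' b']; [lin|lin|].
rewrite [RHS]tliftE; last by lin.
by rewrite !tmapE ?tswapE ?pureM ?tliftE //; lin.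
Qed.

Local Notation mAB := (linfun (tlift (fun (a : A) (b : B) => iA a * iB b)) : 'Hom(tens A B, D)).
Local Notation mBA := (linfun (tlift (fun (b : B) (a : A) => iB b * iA a)) : 'Hom(tens B A, D)).

Lemma mABE a b : mAB (a \ox b) = iA a * iB b.
Proof. by rewrite linfunE ?tliftE //; lin. Qed.

Lemma mBAE a b : mBA (b \ox a) = iB b * iA a.
Proof. by rewrite linfunE ?tliftE //; lin. Qed.

Lemma mAB_inj : lker mAB == 0%VS.
Proof.
have inj := bij_inj (double_bij dD).
apply/lker0P => s t; rewrite !linfunE; try by exact: lin_lift.
exact: inj.
Qed.

Lemma dim_double : \dim {:D} = (\dim {:A} * \dim {:B})%N.
Proof.
rewrite -dim_tens -(limg_dim_eq (f := mAB) (U := fullv)).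
  congr (\dim _); apply/eqP; rewrite eqEsubv subvf andbT; apply/subvP => x _.
  have [h _ hK] := double_bij dD; rewrite -(hK x) -[X in X \in _]linfunE.
    exact: memv_img (memvf _).
  exact: lin_lift.
by rewrite capfv; exact/eqP/mAB_inj.
Qed.

Lemma mBA_inj : lker mBA == 0%VS.
Proof.
apply: lker0_surj; last by rewrite dim_tens dim_double mulnC.
apply/eqP; rewrite eqEsubv subvf; apply/subvP => x _.
suff -> : x = projv (limg mBA) x by exact: memv_proj.
move: x; apply: (double_ext dD) => [||a b]; [lin|lin|].
rewrite projv_id // -[_ * _]/(pAB a b) prodAB_conv.
apply: (conv_mem _ _ (tensv_full _) (tensv_full _)) => [//|//|u v u' v' _ _ _ _].
  exact: conv2_bilin.
rewrite mulr_algr rpredZ //.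
apply: (conv_mem _ _ (tensv_full _) (tensv_full _)) => // x y x' y' _ _ _ _.
by rewrite mulr_algl rpredZ // /prodBA -mBAE memv_img ?memvf.
Qed.

(** Pair [j2 y] with the form [iA a * iB b |-> <a, p> <b, q>] on [D]: the result is
    the value of [y] at [iB (dproj1 p) * iA (P1 q)], and such elements span [D1]. *)
Lemma dual_incl_inj : lker j2 = 0%VS.
Proof.
apply/eqP; rewrite -subv0; apply/subvP => y; rewrite memv_ker memv0 => /eqP y0.
have [g lg gE] : exists2 g : B -> A -> D -> F^o, forall p q, linear (g p q)
    & forall p q a b, g p q (iA a * iB b) = pairing a p * pairing q b.
  exists (fun p q d => pairing q (coslice p (mAB^-1%VF d))) => [p q|p q a b].
    by have ? := @lin_coslice _ _ HA B p; lin.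
  by rewrite -mABE (lker0_lfunK mAB_inj) coslice_pure pairingZ.
have [h bh hE] : exists2 h : B -> A -> F^o, bilin h
    & forall b a, h b a = pairing (vsproj D1_aspace (iB b * iA a)) y.
  by eexists; [|by move=> b a; reflexivity]; lin.
have main p q : pairing (vsproj D1_aspace (iB (dproj1 p) * iA (P1 q))) y = 0.
  have := dual_incl_tlift y (lg p q); rewrite y0 (lin0 (lg p q)) => /esym.
  rewrite tlift_swap_mul; last by have ? := lg p q; lin.
  rewrite -coslice_r2 -(@slice_r1 _ _ HA P1 q) -hE; move: r2 r1 => s t <-.
  have lc := @lin_coslice _ _ HA B; have lgpq := lg p q.
  move: s; apply: tens_ext => [||a b]; [lin|lin|].
  move: t; apply: tens_ext => [||a' b']; [lin|lin|].
  rewrite !tliftE; [|lin|lin].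
  rewrite gE coslice_pure sliceE (linZ (bh.1 _)) (linZ (bh.2 _)) -hE !regularE.
  by rewrite mulrA mulrC.
have sub : (D1 <= lker (linfun (fun d => pairing (vsproj D1_aspace d) y : F^o)))%VS.
  rewrite D1_swap; apply: prod_img' => a b aA bB.
  rewrite memv_ker linfunE; last by lin.
  by rewrite -(dproj1K bB) -(P1K aA) main.
apply/eqP; apply: pairing_ext => x; rewrite -(vsvalK x).
have /(subvP sub) : vsval x \in D1 by exact: subvsP.
rewrite memv_ker linfunE; last by lin.
by move/eqP->; rewrite [RHS]lfunE.
Qed.

(** [iA a * iB b] is the image of the form [iB b' * iA a' |-> <a, b'> <a', b>], which is
    well defined as multiplication [B (x) A -> D] is bijective. *)
Lemma dual_incl_img : limg j2 = D2.
Proof.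
apply/eqP; rewrite eqEsubv; apply/andP; split.
  apply/subvP => _ /memv_imgP[y _ ->].
  rewrite -[j2 y]/((fun d => d) (j2 y)) dual_incl_tlift; last by lin.
  move: RT RT_mem; apply: tensv_mem => [|p d _ dD2]; first by lin.
  by rewrite tliftE ?rpredZ //; lin.
apply: prod_img => a b aA bB.
have [g lg gE] : exists2 g : D -> F^o, linear g
    & forall b' a', g (iB b' * iA a') = pairing a b' * pairing a' b.
  exists (fun d => tlift (fun (b' : B) (a' : A) => pairing a b' * pairing a' b : F^o)
    (mBA^-1%VF d)) => [|b' a']; first by lin.
  by rewrite -mBAE (lker0_lfunK mBA_inj) tliftE //; lin.
pose y : dual HX := linfun (fun x : X => g (vsval x)).
have yE x : pairing x y = g (vsval x) by rewrite /pairing linfunE //; lin.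
suff -> : iA a * iB b = j2 y by rewrite memv_img ?memvf.
rewrite -[j2 y]/((fun d => d) (j2 y)) dual_incl_tlift; last by lin.
transitivity (tlift (fun p d => (g p : F) *: d) RT); last first.
  move: RT RT_mem1; apply: tensv_ext => [||p d pD _]; [lin|lin|].
  by rewrite !tliftE ?yE ?vsprojK //; lin.
rewrite tlift_swap_mul; last by lin.
rewrite -[in LHS](P2K aA) -[in LHS](dproj2K bB) -(@slice_r2 _ _ HA P2 a) -coslice_r1.
move: r2 r1 => s t; have lc := @lin_coslice _ _ HA B.
move: s; apply: tens_ext => [||u v]; [lin|lin|].
move: t; apply: tens_ext => [||u' v']; [lin|lin|].
rewrite !tliftE; [|lin|lin].
by rewrite gE coslice_pure sliceE !linearZ /= -scalerAl -scalerAr scalerA.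
Qed.

Lemma dual_incl_double_rule x y :
  j2 y * j1 x = double_rule j1 j2 x y.
Proof.
have inj : lker (antipode HT) == 0%VS.
  exact: (twist_antipode_inj R2_unit R2_cocycle R2_counitl R2_counitr (antipode_double_inj dD)).
exact: (@pair_map_rule F D HT D1_aspace D1_hopf RT twisted_qt RT_mem1 RT_counitl inj x y).
Qed.

(** The multiplication rule rewrites [j2 y * j1 x] as a combination of [j1 x' * j2 y']. *)
Lemma D2_D1_sub : (D2 * D1 <= D1 * D2)%VS.
Proof.
have [_ _ im1] := sub_incl_embeds (U := D1_aspace) D1_hopf.
have j1m x : j1 x \in D1 by rewrite -[D1]im1 memv_img ?memvf.
have j2m y : j2 y \in D2 by rewrite -dual_incl_img memv_img ?memvf.
rewrite -{1}dual_incl_img -[X in (_ * X <= _)%VS]im1.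
apply/prodvP => _ _ /memv_imgP[y _ ->] /memv_imgP[x _ ->].
rewrite dual_incl_double_rule double_ruleE; [|lin|lin].
have b1 := pair_form_bilin D HX.
have b2 : bilin (@skew_form F _ D HX (antipode HX)^-1%VF).
  by apply: skew_form_bilin; lin.
have b3 : bilin (prodAB j1 j2) by apply: prodAB_bilin; lin.
apply: (conv_mem _ _ (tensv_full _) (tensv_full _)) => [|//|u v u' v' _ _ _ _].
  exact: conv2_bilin.
rewrite mulr_algr rpredZ //.
apply: (conv_mem _ _ (tensv_full _) (tensv_full _)) => // w z w' z' _ _ _ _.
by rewrite mulr_algl rpredZ // memv_mul.
Qed.

(** By [D2_D1_sub] the product [D1 D2] is a subalgebra, and it contains generators. *)
Lemma D1_D2_full : (D1 * D2 = fullv)%VS.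
Proof.
have sZ := subalgebra_prodv D1_subalg D2_subalg D2_D1_sub.
have /subalgebraP[_ M] := sZ.
have s1 : (D1 <= D1 * D2)%VS by apply: sub_prodl D2_subalg.
have s2 : (D2 <= D1 * D2)%VS by apply: sub_prodr D1_subalg.
have ext (W : vectType F) (f : W -> D) :
  (forall x, f x = projv (D1 * D2) (f x)) -> forall x, f x \in (D1 * D2)%VS.
  by move=> e x; rewrite e memv_proj.
have A12 a : iA a \in (D1 * D2)%VS.
  apply: ext; apply: (factorization_ext A_fact) => [||x y xA yA]; [lin|lin|].
  rewrite projv_id // rmorphM; apply: M.
    by apply: (subvP s1); apply: (subvP DA1_D1); exact: memv_img.
  by apply: (subvP s2); apply: (subvP DA2_D2); exact: memv_img.
have Bf := B_factorization A1_subalg A2_subalg A_fact A1_coideal A2_coideal P1_def P2_def.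
have B12 b : iB b \in (D1 * D2)%VS.
  apply: ext; apply: (factorization_ext Bf) => [||x y xA yA]; [lin|lin|].
  rewrite projv_id // rmorphM; apply: M.
    by apply: (subvP s2); apply: (subvP DB2_D2); exact: memv_img.
  by apply: (subvP s1); apply: (subvP DB1_D1); exact: memv_img.
apply/eqP; rewrite eqEsubv subvf; apply/subvP => x _.
apply: (ext _ id); apply: (double_ext dD) => [||a b]; [lin|lin|].
by rewrite projv_id // M.
Qed.

Lemma dim_D1_D2 : (\dim D1 * \dim D2 <= \dim {:D})%N.
Proof.
have Bf := B_factorization A1_subalg A2_subalg A_fact A1_coideal A2_coideal P1_def P2_def.
rewrite dim_double -(dim_factorization A_fact) -(dim_factorization Bf).
rewrite (mulnC (\dim B2)) mulnACA.
apply: leq_mul; (apply: leq_trans (dim_prodv _ _) _; apply: leq_mul; exact: dim_limg_leq).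
Qed.

(** The product map is onto, and the dimensions leave no room for a kernel. *)
Lemma D1_D2_bij : bijective (tlift (fun x y => j1 x * j2 y) : tens X (dual HX) -> D).
Proof.
set L := tlift _; have lL : linear L by exact: lin_lift.
have LE := linfunE lL.
have [_ _ im1] := sub_incl_embeds (U := D1_aspace) D1_hopf.
have limL : limg (linfun L) = fullv.
  apply/eqP; rewrite eqEsubv subvf -D1_D2_full -{1}dual_incl_img -[X in (X * _ <= _)%VS]im1.
  apply/prodvP => _ _ /memv_imgP[x _ ->] /memv_imgP[y _ ->].
  have <- : linfun L (x \ox y) = j1 x * j2 y by rewrite LE /L tliftE //; lin.
  exact: memv_img (memvf _).
have kL : lker (linfun L) == 0%VS.
  apply: lker0_surj => //; rewrite dim_tens.
  have <- : \dim D2 = \dim {:dual HX}.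
    by rewrite -dual_incl_img limg_dim_eq // capfv dual_incl_inj.
  have -> : \dim {:X} = \dim D1 by rewrite dimvf.
  exact: dim_D1_D2.
exists (linfun L)^-1%VF => t; rewrite -LE; first exact: lker0_lfunK.
apply: limg_lfunVK; rewrite limL; exact: memvf.
Qed.

Lemma D1_D2_double : is_double HX HT j1 j2.
Proof.
have [m1 inj1 im1] := sub_incl_embeds (U := D1_aspace) D1_hopf.
split.
- exact: inj1.
- exact: m1.
- rewrite im1; exact: D1_hopf.
- exact: dual_incl_inj.
- exact: (@pair_map_morph F D HT D1_aspace D1_hopf RT twisted_qt RT_mem1 RT_counitl RT_counitr).
- rewrite dual_incl_img; exact: D2_hopf.
- exact: D1_D2_bij.
- by move=> a b; exact: dual_incl_double_rule.
Qed.

Lemma D1_D2_rmatrix : double_rmatrix j1 j2 = RT.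
Proof. exact: (@pair_map_rmatrix F D HT D1_aspace D1_hopf RT twisted_qt RT_mem1 RT_counitl). Qed.

End TwistOfDouble.

Local Open Scope complex_scope.

Theorem theorem1 (K : realType) (A : falgType K[i]) (HA : hopf A)
    (A1 A2 : {vspace A})
    (A1_subalg : subalgebra A1) (A2_subalg : subalgebra A2)
    (A_fact : factorization A1 A2)
    (A1_coideal : left_coideal HA A1) (A2_coideal : right_coideal HA A2)
    (P1 P2 : 'End(A))
    (P1_def : is_left_proj HA A1 A2 P1) (P2_def : is_right_proj HA A1 A2 P2)
    (D : falgType K[i]) (HD : hopf D)
    (iA : 'AHom(A, D)) (iB : 'AHom(dual HA, D))
    (D_double : is_double HA HD iA iB) :
  let HB := dual_cop HA in
  let B1 : {vspace dual HA} := perp HA (augmentation HA A1 * A2)%VS in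
  let B2 : {vspace dual HA} := perp HA (A1 * augmentation HA A2)%VS in
  let r : tens A (dual HA) := canonical_tensor HA in
  let r1 : tens A (dual HA) := tmap P1 id r in
  let r2 : tens A (dual HA) := tmap P2 id r in
  let R1 : tens D D := tmap iA iB r1 in
  let R2 : tens D D := tmap iA iB r2 in
  let DA1 := (iA @: A1)%VS in
  let DA2 := (iA @: A2)%VS in
  let DB1 := (iB @: B1)%VS in
  let DB2 := (iB @: B2)%VS in
  let D1 := (DA1 * DB1)%VS in
  let D2 := (DA2 * DB2)%VS in
  (* 1) *)
  [/\ subalgebra B1 /\ subalgebra B2, left_coideal HB B1, right_coideal HB B2
    & factorization B2 B1] /\
  (* 2) *)
  (exists P1' P2' : 'End(dual HA),
    [/\ is_left_proj HB B2 B1 P2', is_right_proj HB B2 B1 P1',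
        r1 = tmap id P2' r /\ r2 = tmap id P1' r,
        r1 = tmap P1 P2' r /\ r2 = tmap P2 P1' r
      & r1 \in tensv A1 B2 /\ r2 \in tensv A2 B1]) /\
  (* 3) *)
  R2 \is a GRing.unit /\ is_cocycle HD R2 /\
  (exists HT : hopf D,
    [/\ forall x, comul HT x = R2 * comul HD x * R2^-1,
        quasitriangular HT (tswap R2 * R1),
  (* 4) *)
        [/\ (DA1 * DB1 = DB1 * DA1)%VS, (DA2 * DB2 = DB2 * DA2)%VS,
            subalgebra D1 & subalgebra D2],
  (* 5) *)
        [/\ (comul HT @: DA1 <= tensv DA1 D1)%VS,
            (comul HT @: DB1 <= tensv D1 DB1)%VS,
            (comul HT @: DA2 <= tensv DA2 D2)%VS
          & (comul HT @: DB2 <= tensv D2 DB2)%VS]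
  (* 6) *)
      & [/\ hopf_subalgebra HT D1, hopf_subalgebra HT D2
          & exists (X : falgType K[i]) (HX : hopf X)
                   (j1 : 'AHom(X, D)) (j2 : 'AHom(dual HX, D)),
            [/\ embeds_onto HX HT j1 D1, embeds_onto (dual_cop HX) HT j2 D2
              & exists (E : falgType K[i]) (HE : hopf E)
                       (iX : 'AHom(X, E)) (iX' : 'AHom(dual HX, E))
                       (f : 'AHom(E, D)),
                [/\ is_double HX HE iX iX',
                    qt_isom HE HT (double_rmatrix iX iX') (tswap R2 * R1) f,
                    forall x, f (iX x) = j1 x
                  & forall y, f (iX' y) = j2 y]]]]).
Proof.
move=> HB B1 B2 r r1 r2 R1 R2 DA1 DA2 DB1 DB2 D1 D2.
split.
  split; last exact: B_factorization P1_def P2_def.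
  - split; first exact: B1_subalgebra P2_def.
    exact: B2_subalgebra P1_def.
  - exact: B1_coideal P2_def.
  - exact: B2_coideal P1_def.
split.
  exists (dproj1 HA P2), (dproj2 HA P1); split.
  - exact: dproj2_left_proj P1_def P2_def.
  - exact: dproj1_right_proj P1_def P2_def.
  - by split; [exact: r1_dproj2|exact: r2_dproj1].
  - by split; [exact: r1_P1_dproj2 P1_def|exact: r2_P2_dproj1 P2_def].
  - by split; [exact: r1_mem P1_def|exact: r2_mem P2_def].
split; first exact: (R2_unit A1_subalg A2_subalg A_fact A1_coideal
    A2_coideal P1_def P2_def D_double).
split; first exact: (R2_cocycle A1_subalg A2_subalg A_fact A1_coideal
    A2_coideal P1_def P2_def D_double).
pose U := D1_aspace A1_subalg A_fact A1_coideal P2_def D_double.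
pose U_hopf : hopf_subalgebra _ U := D1_hopf A1_subalg A2_subalg A_fact A1_coideal
  A2_coideal P1_def P2_def D_double.
pose j2 := dual_incl A1_subalg A2_subalg A_fact A1_coideal A2_coideal P1_def P2_def
  D_double.
pose HT := twisted_double A1_subalg A2_subalg A_fact A1_coideal A2_coideal P1_def P2_def
  D_double.
have HT_double : is_double (sub_hopf U_hopf) HT (sub_incl U_hopf) j2.
  exact: D1_D2_double.
have HT_rmatrix : double_rmatrix (sub_incl U_hopf) j2 = tswap R2 * R1.
  exact: D1_D2_rmatrix.
exists HT; split.
- exact: twisted_comulE.
- exact: twisted_qt.
- split.
  + exact: (D1_swap A1_subalg A_fact A1_coideal P2_def D_double).
  + exact: (D2_swap A2_subalg A_fact A2_coideal P1_def D_double).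
  + exact: (D1_subalg A1_subalg A_fact A1_coideal P2_def D_double).
  + exact: (D2_subalg A2_subalg A_fact A2_coideal P1_def D_double).
- split.
  + exact: twisted_comul_DA1.
  + exact: twisted_comul_DB1.
  + exact: twisted_comul_DA2.
  + exact: twisted_comul_DB2.
split; [exact: D1_hopf|exact: D2_hopf|].
exists _, (sub_hopf U_hopf), (sub_incl U_hopf), j2; split; first exact: sub_incl_embeds.
  split; [exact: double_morphB HT_double|exact: double_injB HT_double|].
  exact: dual_incl_img.
(* The double of [D1] is [D] itself with the twisted coproduct. *)
exists D, HT, (sub_incl U_hopf), j2, (ahom_of (alg_morph_id D)); split=> //.
- split; first by exists id => x; rewrite ahom_ofE.
    split=> x; rewrite ahom_ofE // -[LHS]tmap_id; apply: eq_tmap => y.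
      by rewrite ahom_ofE.
    by rewrite ahom_ofE.
  by rewrite HT_rmatrix -[RHS]tmap_id; apply: eq_tmap => y; rewrite ahom_ofE.
- by move=> x; rewrite ahom_ofE.
- by move=> y; rewrite ahom_ofE.
Qed.
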